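(* Let $L/K$ be a finite extension of number fields, unramified at $2$ (i.e. every prime ideal of $K$ above $2$ is unramified in $L$). Let $\mathfrak{d}_{L/K}$ be the relative discriminant ideal of $L/K$, let $c$ be the number of complex (infinite) places of $L$ which lie above a real place of $K$, and let $\overline{\mathrm{N}}_{K/\mathbb{Q}}(\mathfrak{d}_{L/K})$ be the absolute norm of $\mathfrak{d}_{L/K}$. Let $k$ be the maximal subfield of $\mathbb{Q}(\mu_{2^\infty})$ contained in $K$ and write $[k:\mathbb{Q}] = 2^m$ with $m \geq 0$. Then $$(-1)^c\,\overline{\mathrm{N}}_{K/\mathbb{Q}}(\mathfrak{d}_{L/K}) \equiv 1 \bmod (4\cdot 2^{m}).$$
   Context: $\mathbb{Q}(\mu_{2^\infty})$ denotes the field generated over $\mathbb{Q}$ by all roots of unity of order a power of $2$ (all number fields are taken inside a fixed algebraic closure of $\mathbb{Q}$, so $k = K \cap \mathbb{Q}(\mu_{2^\infty})$). The absolute norm $\overline{\mathrm{N}}_{K/\mathbb{Q}}(\mathfrak{a})$ of a nonzero ideal $\mathfrak{a}$ of $K$ is the positive rational generator of the ideal norm $\mathrm{N}_{K/\mathbb{Q}}(\mathfrak{a})$; for an integral ideal $\mathfrak{a}$ it is the cardinality of $\mathcal{O}_K/\mathfrak{a}$, where $\mathcal{O}_K$ is the ring of integers of $K$. *)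

(* Defs.v *)
From HB Require Import structures.
From mathcomp Require Import all_boot all_order all_algebra all_field.
From mathcomp Require Import boolp classical_sets cardinality finmap.
Set Implicit Arguments. Unset Strict Implicit. Unset Printing Implicit Defensive.
Import Order.TTheory GRing.Theory Num.Theory.
Local Open Scope ring_scope.
Local Open Scope classical_set_scope.

Section Ideals.
Variable R : comNzRingType.
Implicit Types (I J P : set R).

Definition is_ideal I :=
  [/\ I 0, forall x y, I x -> I y -> I (x + y) & forall a x, I x -> I (a * x)].

Definition is_prime_ideal P :=
  [/\ is_ideal P, ~ P 1 & forall a b, P (a * b) -> P a \/ P b].

Definition ideal_gen (X : set R) : set R := smallest is_ideal X.

Definition ideal_mul I J : set R := ideal_gen [set x * y | x in I & y in J].

Definition ideal_exp I n : set R := iter n (ideal_mul I) setT.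

Definition ideal_dvd I J := exists2 H, is_ideal H & J = ideal_mul I H.

Definition cosets I : set (set R) := range (fun x => [set y | I (y - x)]).

(* The cardinality of R / I; fset_set gives the junk value 0 when R / I is
   infinite. *)
Definition abs_norm I : nat := #|` fset_set (cosets I)|%fset.

End Ideals.

Section RingOfIntegers.
Variable K : fieldType.

Definition int_closure : {pred K} :=
  fun x => `[< integralOver (intr : int -> K) x >].

Lemma int_closure_subring : subring_closed int_closure.
Proof.
split=> [|x y /asboolP Ox /asboolP Oy|x y /asboolP Ox /asboolP Oy].
- exact/asboolP/integral1.
- exact/asboolP/integral_sub.
- exact/asboolP/integral_mul.
Qed.

HB.instance Definition _ :=
  GRing.isSubringClosed.Build K int_closure int_closure_subring.

Record int_ring := IntRing {
  int_ring_val :> K;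
  int_ring_valP : int_ring_val \in int_closure }.

HB.instance Definition _ := [isSub for int_ring_val].
HB.instance Definition _ := [Choice of int_ring by <:].
HB.instance Definition _ :=
  [SubChoice_isSubComNzRing of int_ring by <:].

End RingOfIntegers.

Arguments int_closure K : clear implicits.
Notation "''O_' K" := (int_ring K) (at level 8, K at level 2, format "''O_' K").

Section Extension.
Variables (K : fieldType) (L : fieldExtType K).

Definition ext_ideal (P : set 'O_K) : set 'O_L :=
  ideal_gen [set b : 'O_L | exists2 a, P a & val b = (val a)%:A].

Definition ideal_above (P : set 'O_K) (Q : set 'O_L) :=
  forall (a : 'O_K) (b : 'O_L), val b = (val a)%:A -> (Q b <-> P a).

Definition has_ram_index (P : set 'O_K) (Q : set 'O_L) (e : nat) :=
  ideal_dvd (ideal_exp Q e) (ext_ideal P) /\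
  ~ ideal_dvd (ideal_exp Q e.+1) (ext_ideal P).

(* For number fields the residue fields at nonzero primes are finite, so no
   separability condition on the residue extensions is needed. *)
Definition unramified_prime (P : set 'O_K) :=
  forall Q : set 'O_L, is_prime_ideal Q -> ideal_above P Q ->
    has_ram_index P Q 1.

(* A prime ideal P lies above the rational prime p iff it contains p; such a P
   is automatically nonzero. *)
Definition unramified_at (p : nat) :=
  forall P : set 'O_K, is_prime_ideal P -> P p%:R -> unramified_prime P.

Definition ext_trace (x : L) : K := \tr (passmx.mxof (vbasis {:L}) (vbasis {:L}) (amull x)).

Definition basis_disc n (e : n.-tuple L) : K :=
  \det (\matrix_(i < n, j < n) ext_trace (tnth e i * tnth e j)).

(* O_L need not be free over O_K: the relative discriminant is generated by the
   discriminants of all the K-bases of L consisting of integral elements. *)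
Definition rel_disc : set 'O_K :=
  ideal_gen [set d : 'O_K | exists e : (\dim {:L}).-tuple L,
    [/\ basis_of {:L} e, {subset e <= int_closure L} & val d = basis_disc e]].

End Extension.

Section Places.
Variable K : fieldType.

(* An infinite place is a set {s, conj s}, for an embedding s of the field in
   the complex numbers; embeddings of a number field take algebraic values, so
   algC can serve as their codomain. *)
Definition emb_place (s : {rmorphism K -> algC}) : set (K -> algC) :=
  [set (s : K -> algC); (fun x => (s x)^*)].

Definition infinite_places : set (set (K -> algC)) := range emb_place.

Definition real_place (v : set (K -> algC)) :=
  forall s, v s -> forall x, s x \is Num.real.

End Places.

(* {s, conj s} restricts to {s|K, conj (s|K)}. *)
Definition place_below (K : fieldType) (L : fieldExtType K)
    (w : set (L -> algC)) : set (K -> algC) :=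
  [set (fun x : K => s x%:A) | s in w].

Definition complex_over_real_places (K : fieldType) (L : fieldExtType K) :
    set (set (L -> algC)) :=
  [set w | [/\ infinite_places w, ~ real_place w & real_place (place_below w)]].

Definition num_complex_over_real (K : fieldType) (L : fieldExtType K) : nat :=
  #|` fset_set (@complex_over_real_places K L)|%fset.

(* The field Q(mu_{2^oo}), as a subfield of algC. *)
Definition Q_mu_2inf : set algC :=
  smallest (fun F : set algC => divring_closed [in F])
    [set z | exists n, (2 ^ n).-unity_root z].

(* Main.v *)
(** Let d = disc(e) for a K-basis e of L made of integers, chosen with d odd: as
   L/K is unramified at 2, the embeddings of L over K stay distinct modulo
   every prime above 2.
   - Writing alpha_u = det(Tr(u_i e_j)), the ideal A generated by the alpha_u
     contains d and satisfies A^2 = d D with D the relative discriminant, since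
     alpha_u^2 = d disc(u) and (a, b)^2 = (a^2, b^2) in a Dedekind domain. Hence
     |N d| N(D) = N(A)^2.
   - A primitive root of unity of order 2^(m+2) is quadratic over the integers
     of k, so it acts on (O_K/A)^2, freely outside 0 because #(O_K/A) is odd.
     Hence N(A)^2 = 1 mod 2^(m+2).
   - By Stickelberger's argument d = x^2 + 4y with x the permanent of the matrix
     (sigma_i e_j). Up to an odd square d is therefore of the form 1 + 4z, and
     N(1 + 4z) = 1 mod 2^(m+2): its norm to k lies in 1 + 4 Z[w], and p(X) p(-X)
     gains one factor 2 of congruence to 1 at each step down the tower of
     2-power cyclotomic fields. So N d = 1 mod 2^(m+2).
   - The sign of N d is (-1)^c: complex conjugation permutes the embeddings, and
     over a real place of K its signature counts the pairs of complex ones. *)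

Require Import Defs.
From HB Require Import structures.
From mathcomp Require Import all_boot all_order all_algebra all_fingroup all_field.
From mathcomp Require Import boolp classical_sets cardinality finmap.
From mathcomp Require Import ring zify.
Set Implicit Arguments. Unset Strict Implicit. Unset Printing Implicit Defensive.
Import Order.TTheory GRing.Theory Num.Theory.
Local Open Scope ring_scope.
Local Open Scope classical_set_scope.

(** * Indices of additive subgroups *)

(** O_L need not be free over O_K, so D may have no generator that is a single discriminant:
    Stickelberger's congruence is available for d only, and D is reached through A^2 = d D. The
    square also fits the root of unity, which lies outside K: it needs two copies of O_K/A to act
    on, and two copies control N(A)^2 only. The order 2^(m+2) comes from the automorphism w -> w^5
    of the 2-power cyclotomic tower. An element of k has at most 2^m conjugates, so the 2^m-th power
    of this automorphism fixes k; since 5^(2^m) = 1 + 2^(m+2) times an odd number, it fixes the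
    roots of unity of order 2^(m+2) and moves those of higher 2-power order. Hence k lies in the
    field of the former, which has degree 2^(m+1), twice that of k. The odd square between d and 1 +
    4z is disposed of by the same action: it is x'^2 with x' odd, and N(x')^2 is the squared index
    of x'O_K, so it is 1 mod 2^(m+2). *)

Section Index.

(** Encodes [J : I] = n by a map on V whose restriction to J is the quotient map onto a set of n
    elements, so that no quotient group has to be built. *)
Definition has_index (V : zmodType) (J I : set V) (n : nat) :=
  exists (T : finType) (f : V -> T),
    [/\ forall t, exists2 x, J x & f x = t,
        forall x y, J x -> J y -> f x = f y <-> I (x - y) & #|T| = n].

Definition is_subgroup (V : zmodType) (I : set V) :=
  I 0 /\ forall x y, I x -> I y -> I (x - y).

Lemma subgroupN (V : zmodType) (I : set V) x : is_subgroup I -> I x -> I (- x).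
Proof. by move=> [I0 IB] Ix; rewrite -sub0r; apply: IB. Qed.

Lemma subgroupD (V : zmodType) (I : set V) x y : is_subgroup I -> I x -> I y -> I (x + y).
Proof.
by move=> sI Ix Iy; rewrite -[y]opprK; apply: sI.2 => //; apply: subgroupN.
Qed.

Lemma idx_map (V W : zmodType) (phi : V -> W) (J I : set V) (J' I' : set W) n :
  is_subgroup I' -> (forall x, J x -> J' (phi x)) ->
  (forall y, J' y -> exists2 x, J x & I' (y - phi x)) ->
  (forall x y, J x -> J y -> I (x - y) <-> I' (phi x - phi y)) ->
  has_index J' I' n -> has_index J I n.
Proof.
move=> sI' Jphi surj ker [T [f [fs fk cT]]].
exists T, (f \o phi); split=> //.
- move=> t; have [y J'y <-] := fs t; have [x Jx I'x] := surj _ J'y.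
  by exists x => //=; apply: esym; apply/fk => //; apply: Jphi.
- move=> x y Jx Jy /=; rewrite fk; [|exact: Jphi|exact: Jphi].
  by rewrite ker.
Qed.

Lemma idx_le (V : zmodType) (J I : set V) n n' :
  has_index J I n -> has_index J I n' -> (n <= n')%N.
Proof.
move=> [T [f [fs fk <-]]] [T' [f' [_ fk' <-]]].
have /choice [g gP] : forall t, exists x, J x /\ f x = t.
  by move=> t; have [x] := fs t; exists x.
apply: (@leq_card _ _ (f' \o g)) => t t' /= /fk'.
case: (gP t) (gP t') => [Jt ft] [Jt' ft'] /(_ Jt Jt') /fk.
by move=> /(_ Jt Jt'); rewrite ft ft'.
Qed.

Lemma idx_uniq (V : zmodType) (J I : set V) n n' :
  has_index J I n -> has_index J I n' -> n = n'.
Proof. by move=> h h'; apply/eqP; rewrite eqn_leq !(@idx_le _ J I). Qed.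

Lemma idx_trans (V : zmodType) (J I H : set V) a b :
  is_subgroup J -> is_subgroup I -> is_subgroup H -> I `<=` J -> H `<=` I ->
  has_index J I a -> has_index I H b -> has_index J H (a * b).
Proof.
move=> sJ sI sH IJ HI [T [f [fs fk cT]]] [U [g [gs gk cU]]].
have /choice [r rP] : forall t, exists x, J x /\ f x = t.
  by move=> t; have [x] := fs t; exists x.
have Ir x : J x -> I (x - r (f x)).
  by move=> Jx; have [Jr fr] := rP (f x); apply/fk.
(* Subtracting the chosen representative moves x into I, where its class modulo H can be read. *)
exists (T * U)%type, (fun x => (f x, g (x - r (f x)))); split.
- move=> [t u]; have [x Ix gx] := gs u; have [Jr fr] := rP t.
  have Jx : J (x + r t) by apply: subgroupD => //; apply: IJ.
  have ft : f (x + r t) = t by rewrite -[RHS]fr; apply/fk => //; rewrite addrK.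
  by exists (x + r t) => //; rewrite ft addrK gx.
- move=> x y Jx Jy; split=> [[fxy]|Hxy].
    rewrite fxy => /gk; rewrite -{1}fxy => /(_ (Ir _ Jx) (Ir _ Jy)).
    by rewrite opprB addrA subrK.
  have fxy : f x = f y by apply/fk => //; apply: HI.
  congr pair => //; apply/gk; [exact: Ir|exact: Ir|].
  by rewrite fxy opprB addrA subrK.
- by rewrite card_prod cT cU.
Qed.

Lemma idx_gt0 (V : zmodType) (J I : set V) n : J 0 -> has_index J I n -> (0 < n)%N.
Proof. by move=> J0 [T [f [_ _ <-]]]; apply/card_gt0P; exists (f 0). Qed.

Lemma idx_gt1 (V : zmodType) (J I : set V) n x :
  J 0 -> J x -> ~ I x -> has_index J I n -> (1 < n)%N.
Proof.
move=> J0 Jx Ix [T [f [_ fk <-]]]; rewrite ltnNge; apply/negP => /card_le1P le1.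
have : f x = f 0 by have := le1 (f 0) isT (f x); rewrite !inE => /esym/eqP.
by move/fk; rewrite subr0 => /(_ Jx J0).
Qed.

Lemma idx1 (V : zmodType) (I : set V) : is_subgroup I -> has_index I I 1.
Proof.
move=> sI; exists unit, (fun _ => tt); split; last by rewrite card_unit.
  by case; exists 0; first exact: sI.1.
by move=> x y Ix Iy; split=> // _; apply: sI.2.
Qed.

(** A coset of I is recorded by its image in the finite quotient by H; as H lies in I, distinct
    cosets have distinct images. *)
Lemma idx_exists (V : zmodType) (H I J : set V) n :
  is_subgroup I -> is_subgroup J -> H `<=` I -> I `<=` J -> has_index setT H n ->
  exists n', has_index J I n'.
Proof.
move=> sI sJ HI IJ [T [f [fs fk cT]]].
pose F x := finset (fun t : T => `[< exists2 y, I (y - x) & f y = t >]).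
pose U := {S : {set T} | `[< exists2 x, J x & F x = S >]}.
have J0 : `[< exists2 x, J x & F x = F 0 >].
  by apply/asboolP; exists 0 => //; exact: sJ.1.
pose u0 : U := exist _ (F 0) J0.
exists #|{: U}|, U, (fun x => insubd u0 (F x)); split=> //.
  case=> S pS; have /asboolP [x Jx Fx] := pS; exists x => //.
  by apply: val_inj; rewrite val_insubd Fx pS.
move=> x y Jx Jy.
have mF z : J z -> `[< exists2 x, J x & F x = F z >].
  by move=> Jz; apply/asboolP; exists z.
split=> [/(congr1 val)|Ixy].
  rewrite !val_insubd !mF // => Fxy.
  have : f x \in F x by rewrite inE; apply/asboolP; exists x; rewrite ?subrr //; apply: sI.1.
  rewrite Fxy inE => /asboolP [z Izy fzx].
  have Izx : I (z - x) by apply: HI; apply/fk.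
  by rewrite -[x - y](_ : (z - y) - (z - x) = _); [apply: sI.2|rewrite opprB addrCA addrAC subrr add0r].
congr insubd; apply/setP => t; rewrite !inE.
apply/asboolP/asboolP => -[z Iz <-]; exists z => //.
  by rewrite -(subrKA x); apply: subgroupD.
by rewrite -(subrKA y); apply: subgroupD => //; rewrite -opprB; apply: subgroupN.
Qed.

Lemma idx_pigeon (V : zmodType) (I : set V) n (u : nat -> V) :
  has_index setT I n -> exists i j, (i < j)%N /\ I (u j - u i).
Proof.
move=> [T [f [_ fk _]]].
pose g (i : 'I_#|T|.+1) := f (u i).
have /injectivePn [i [j ij gij]] : ~~ injectiveb g.
  by apply/negP => /injectiveP /leq_card; rewrite card_ord ltnn.
have {}gij : f (u i) = f (u j) by [].
case: (ltngtP i j) => [lt|lt|/val_inj /eqP]; last by rewrite (negPf ij).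
- by exists i, j; split => //; apply/fk.
- by exists j, i; split => //; apply/fk.
Qed.

Lemma idx_prod (V : zmodType) (J I : set V) (n : nat) : has_index J I n ->
  @has_index (V * V)%type [set p | J p.1 /\ J p.2] [set p | I p.1 /\ I p.2] (n * n).
Proof.
move=> [T [f [fs fk <-]]].
exists (T * T)%type, (fun p => (f p.1, f p.2)); split; last by rewrite card_prod.
  by move=> [s t]; have [[x Jx <-] [y Jy <-]] := (fs s, fs t); exists (x, y).
move=> [x1 x2] [y1 y2] /= [J1 J2] [K1 K2]; split.
  by case=> /fk h1 /fk h2; split; [apply: h1|apply: h2].
by case=> /fk h1 /fk h2; rewrite h1 ?h2.
Qed.

End Index.

Lemma idx_abs_norm (R : comNzRingType) (I : set R) n :
  is_subgroup I -> has_index setT I n -> abs_norm I = n.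
Proof.
move=> sI [T [f [fs fk <-]]].
have fk' x y : f x = f y <-> I (x - y) by apply: fk.
pose g (t : T) : set R := [set y | f y = t].
have ginj : injective g.
  move=> t t' /seteqP [sub _]; have [x _ fx] := fs t.
  by have := sub x fx; rewrite /g /= fx.
have gE : cosets I = [set` [fset g t | t : T]%fset].
  apply/seteqP; split=> [_ [x _ <-]|S].
    rewrite /= /mkset; apply/imfsetP; exists (f x) => //.
    by apply/seteqP; split=> y /=; rewrite -fk'.
  move=> /imfsetP [t _ ->]; have [x _ <-] := fs t; exists x => //.
  by apply/seteqP; split=> y /=; rewrite -fk'.
rewrite /abs_norm gE set_fsetK card_imfset //=.
by rewrite cardE /= enumT.
Qed.

(** * Ideals of Dedekind domains with finite residue rings *)

Section Ideals.
Variable R : comNzRingType.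
Implicit Types (A B C I J M P Q : set R) (a b c x y : R).

Definition principal a : set R := [set x | exists z, x = a * z].

Lemma ideal_subgroup I : is_ideal I -> is_subgroup I.
Proof.
move=> [I0 ID IM]; split=> // x y Ix Iy; apply: ID => //.
by rewrite -mulN1r; apply: IM.
Qed.

Lemma idealN I x : is_ideal I -> I x -> I (- x).
Proof. by move=> [I0 ID IM] Ix; rewrite -mulN1r; apply: IM. Qed.

Lemma idealB I x y : is_ideal I -> I x -> I y -> I (x - y).
Proof. by move=> /ideal_subgroup [_]; apply. Qed.

Lemma idealMl I a x : is_ideal I -> I x -> I (a * x).
Proof. by move=> [_ _ IM]; exact: IM. Qed.

Lemma idealMr I a x : is_ideal I -> I x -> I (x * a).
Proof. by rewrite mulrC; exact: idealMl. Qed.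

Lemma ideal_sum I (T : Type) (r : seq T) (F : T -> R) :
  is_ideal I -> (forall t, I (F t)) -> I (\sum_(t <- r) F t).
Proof. by move=> [I0 ID IM] IF; elim/big_ind: _. Qed.

Lemma ideal_principal a : is_ideal (principal a).
Proof.
split; first by exists 0; rewrite mulr0.
  by move=> _ _ [x ->] [y ->]; exists (x + y); rewrite mulrDr.
by move=> b _ [x ->]; exists (b * x); rewrite mulrCA.
Qed.

Lemma principal_mem a : principal a a. Proof. by exists 1; rewrite mulr1. Qed.

Lemma principal_sub a I : is_ideal I -> I a -> principal a `<=` I.
Proof. by move=> iI Ia _ [z ->]; apply: idealMr. Qed.

Lemma ideal_full I : is_ideal I -> I 1 -> I = setT.
Proof.
by move=> iI I1; apply/seteqP; split=> // x _; rewrite -[x]mulr1; apply: idealMl.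
Qed.

Lemma ideal_gen_ideal (X : set R) : is_ideal (ideal_gen X).
Proof.
split=> [M [[M0 _ _] _] //|x y Xx Xy M|a x Xx M] [iM XM]; have [M0 MD MM] := iM.
  by apply: MD; [apply: Xx|apply: Xy].
by apply: MM; apply: Xx.
Qed.

Lemma ideal_gen_sub (X : set R) I : is_ideal I -> X `<=` I -> ideal_gen X `<=` I.
Proof. exact: smallest_sub. Qed.

Lemma ideal_gen_mem (X : set R) x : X x -> ideal_gen X x.
Proof. by move=> Xx I [_]; apply. Qed.

Lemma ideal_mul_ideal A B : is_ideal (ideal_mul A B).
Proof. exact: ideal_gen_ideal. Qed.

Lemma ideal_mul_mem A B a b : A a -> B b -> ideal_mul A B (a * b).
Proof. by move=> Aa Bb; apply: ideal_gen_mem; exists a => //; exists b. Qed.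

Lemma ideal_mul_sub A B I :
  is_ideal I -> (forall a b, A a -> B b -> I (a * b)) -> ideal_mul A B `<=` I.
Proof.
by move=> iI AB; apply: ideal_gen_sub => // _ [a Aa [b Bb <-]]; apply: AB.
Qed.

Lemma ideal_mulC A B : ideal_mul A B = ideal_mul B A.
Proof.
by apply/seteqP; split; apply: ideal_mul_sub;
   try exact: ideal_mul_ideal; move=> a b Ha Hb; rewrite mulrC; apply: ideal_mul_mem.
Qed.

Lemma ideal_mul1 A : is_ideal A -> ideal_mul A setT = A.
Proof.
move=> iA; apply/seteqP; split; first by apply: ideal_mul_sub => // a b Aa _; apply: idealMr.
by move=> a Aa; rewrite -[a]mulr1; apply: ideal_mul_mem.
Qed.

Lemma ideal_mulSl A B C : A `<=` B -> ideal_mul A C `<=` ideal_mul B C.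
Proof.
move=> AB; apply: ideal_mul_sub; first exact: ideal_mul_ideal.
by move=> a c /AB; apply: ideal_mul_mem.
Qed.

Lemma ideal_mulSr A B C : A `<=` B -> ideal_mul C A `<=` ideal_mul C B.
Proof. by rewrite ![ideal_mul C _]ideal_mulC; apply: ideal_mulSl. Qed.

Lemma ideal_mul_subl A B : is_ideal A -> ideal_mul A B `<=` A.
Proof. by move=> iA; apply: ideal_mul_sub => // a b Aa _; apply: idealMr. Qed.

Definition ideal_add (I J : set R) : set R := [set z | exists x y, [/\ I x, J y & z = x + y]].

Lemma ideal_add_ideal I J : is_ideal I -> is_ideal J -> is_ideal (ideal_add I J).
Proof.
move=> [I0 ID IM] [J0 JD JM]; split; first by exists 0, 0; rewrite addr0.
  move=> _ _ [x [y [Ix Jy ->]]] [x' [y' [Ix' Jy' ->]]].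
  by exists (x + x'), (y + y'); rewrite addrACA; split=> //; [apply: ID|apply: JD].
move=> a _ [x [y [Ix Jy ->]]].
by exists (a * x), (a * y); rewrite mulrDr; split=> //; [apply: IM|apply: JM].
Qed.

Lemma ideal_add_l I J : is_ideal J -> I `<=` ideal_add I J.
Proof. by move=> [J0 _ _] x Ix; exists x, 0; rewrite addr0. Qed.

Lemma ideal_add_r I J : is_ideal I -> J `<=` ideal_add I J.
Proof. by move=> [I0 _ _] x Jx; exists 0, x; rewrite add0r. Qed.

Lemma ideal_add_sub I J C : is_ideal C -> I `<=` C -> J `<=` C -> ideal_add I J `<=` C.
Proof. by move=> [_ CD _] IC JC _ [x [y [/IC Cx /JC Cy ->]]]; apply: CD. Qed.

Definition is_maximal M :=
  [/\ is_ideal M, ~ M 1 & forall B, is_ideal B -> M `<=` B -> ~ B 1 -> B `<=` M].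

Lemma maximal_inv M x : is_maximal M -> ~ M x -> exists y, M (1 - x * y).
Proof.
move=> [iM M1 max] Mx.
have iB := ideal_add_ideal iM (ideal_principal x).
have [B1|] := pselect (ideal_add M (principal x) 1).
  have [m [_ [Mm [y ->] e]]] := B1.
  by exists y; rewrite e addrK.
move=> /(max _ iB (ideal_add_l (ideal_principal x))) /(_ x) Mx'.
by case: Mx; apply: Mx'; apply: ideal_add_r => //; apply: principal_mem.
Qed.

Lemma maximal_prime M : is_maximal M -> is_prime_ideal M.
Proof.
move=> maxM; have [iM M1 _] := maxM; split=> // a b Mab.
have [|/(maximal_inv maxM) [y My]] := pselect (M a); [by left|right].
rewrite -[b](_ : (1 - a * y) * b + y * (a * b) = _); last by ring.
by have [_ MD MM] := iM; apply: MD; [apply: idealMr|apply: MM].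
Qed.

(* For integral closures of Z in number fields; the last clause is complete
   integral closedness, with the fraction a / b written without quotients. *)
Definition dedekind_like :=
  [/\ forall x y, x * y = 0 -> x = 0 \/ y = 0,
      forall a, a <> 0 -> exists n, has_index setT (principal a) n
    & forall a b c, b <> 0 -> c <> 0 ->
        (forall n, exists z, c * a ^+ n = b ^+ n * z) -> exists z, a = b * z].

Hypothesis HR : dedekind_like.

Lemma ded_mulI a x y : a <> 0 -> a * x = a * y -> x = y.
Proof.
move=> a0 /eqP; rewrite -subr_eq0 -mulrBr => /eqP.
by case: HR => dom _ _ /dom [//|/eqP]; rewrite subr_eq0 => /eqP.
Qed.

Lemma ded_idx A a : is_ideal A -> A a -> a <> 0 -> exists n, has_index setT A n.
Proof.
move=> iA Aa a0; have [_ /(_ a a0) [n idn] _] := HR.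
apply: (idx_exists _ _ (principal_sub iA Aa) _ idn) => //; exact: ideal_subgroup.
Qed.

Lemma ded_idx2 A B a : is_ideal A -> is_ideal B -> A a -> a <> 0 -> A `<=` B ->
  exists n, has_index B A n.
Proof.
move=> iA iB Aa a0 AB; have [_ /(_ a a0) [n idn] _] := HR.
apply: (idx_exists _ _ (principal_sub iA Aa) _ idn) => //; exact: ideal_subgroup.
Qed.

Lemma idx_lt A B n n' x : is_ideal A -> is_ideal B -> A `<=` B -> B x -> ~ A x ->
  has_index setT A n -> has_index setT B n' -> (n' < n)%N.
Proof.
move=> iA iB AB Bx Ax idA idB.
have [sA sB] := (ideal_subgroup iA, ideal_subgroup iB).
have [m idm] := idx_exists sA sB (fun x h => h) AB idA.
have sT : is_subgroup (@setT R) by [].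
have -> : n = (n' * m)%N by apply: (idx_uniq idA); apply: idx_trans idB idm.
have := @idx_gt1 _ _ _ _ x sB.1 Bx Ax idm.
have := @idx_gt0 _ setT _ _ I idB.
by move=> n'0 m1; rewrite ltn_Pmulr.
Qed.

(** Descent on the index, which drops at each strictly larger ideal, takes the place of Zorn's
    lemma. *)
Lemma ded_maximal A a : is_ideal A -> A a -> a <> 0 -> ~ A 1 ->
  exists2 M, is_maximal M & A `<=` M.
Proof.
move=> iA Aa a0 A1; have [n] := ded_idx iA Aa a0.
have [m] := ubnP n; elim: m n A iA Aa A1 => // m IH n A iA Aa A1 ltn idn.
have [max|] := pselect (forall B, is_ideal B -> A `<=` B -> ~ B 1 -> B `<=` A).
  by exists A.
move=> /existsNP [B] /not_implyP [iB] /not_implyP [AB] /not_implyP [B1].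
move=> /existsNP [x] /not_implyP [Bx Ax].
have [n' idn'] := ded_idx iB (AB _ Aa) a0.
have lt' := idx_lt iA iB AB Bx Ax idn idn'.
have [M mM BM] := IH n' B iB (AB _ Aa) B1 (leq_trans lt' ltn) idn'.
by exists M => // y /AB /BM.
Qed.

(** Powers of x repeat in the finite ring R / P, so x^i (1 - x^(j-i)) lies in P; if x is outside P,
    then 1 - x^(j-i) is in P, and x is a unit modulo P. *)
Lemma prime_maximal P a : is_prime_ideal P -> P a -> a <> 0 -> is_maximal P.
Proof.
move=> [iP P1 primeP] Pa a0; split=> // B iB PB B1 x Bx; apply: contrapT => Px.
have [n idn] := ded_idx iP Pa a0.
have [i [j [ij Pij]]] := idx_pigeon (fun i => x ^+ i) idn.
have Pxi k : ~ P (x ^+ k).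
  by elim: k => [|k IH]; rewrite ?expr0 // exprS => /primeP [].
have : P (x ^+ i * (1 - x ^+ (j - i))).
  by rewrite mulrBr mulr1 -exprD subnKC ?(ltnW ij) // -opprB; apply: idealN.
case/primeP; first exact: Pxi.
move=> /PB B1x; apply: B1; rewrite -(subrK (x ^+ (j - i)) 1).
have [_ BD BM] := iB; apply: BD => //.
by rewrite -[(j - i)%N]prednK ?subn_gt0 // exprS; apply: idealMr.
Qed.

(* In the finite ring R / aR, localise at 1 + C and take a minimal nonzero
   principal ideal of the localisation. *)
Lemma ded_annihilator C a : is_ideal C -> ~ C 1 -> C a -> a <> 0 ->
  exists2 b, ~ principal a b & forall c, C c -> principal a (b * c).
Proof.
move=> iC C1 Ca a0.
pose S s := C (s - 1).
have SM s t : S s -> S t -> S (s * t).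
  move=> Ss St; rewrite /S -[_ - 1](_ : (s - 1) * t + (t - 1) = _); last by ring.
  by have [_ CD _] := iC; apply: CD => //; apply: idealMr.
have S1 : S 1 by rewrite /S subrr; case: iC.
(* The kernel of the map from R to the localisation of R / aR at S = 1 + C. *)
pose Sig : set R := [set b | exists2 s, S s & principal a (s * b)].
have iSig : is_ideal Sig.
  split; first by exists 1 => //; exists 0; rewrite !mulr0.
    move=> x y [s Ss ax] [t St ay]; exists (s * t); first exact: SM.
    rewrite -[_ * _](_ : t * (s * x) + s * (t * y) = _); last by ring.
    by have [_ D M] := ideal_principal a; apply: D; apply: M.
  move=> b x [s Ss ax]; exists s => //.
  by rewrite mulrCA; apply: idealMl => //; apply: ideal_principal.
have aSig : principal a `<=` Sig by move=> x ax; exists 1 => //; rewrite mul1r.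
have Sig1 : ~ Sig 1.
  move=> [s Ss]; rewrite mulr1 => /(principal_sub iC Ca) Cs; apply: C1.
  by have := idealB iC Cs Ss; rewrite opprB subrKC.
have [b Sb minb] : exists2 b, ~ Sig b &
    forall c, C c -> Sig (b * c).
  have [n idn] : exists n, has_index (@setT R) Sig n.
    exact: ded_idx iSig (aSig _ (principal_mem a)) a0.
  suff H : forall m b k, ~ Sig b -> has_index (ideal_add (principal b) Sig) Sig k -> (k < m)%N ->
      exists2 b, ~ Sig b & forall c, C c -> Sig (b * c).
    have [k idk] : exists k, has_index (ideal_add (principal 1) Sig) Sig k.
      apply: (ded_idx2 iSig _ (aSig _ (principal_mem a)) a0).
        by apply: ideal_add_ideal => //; apply: ideal_principal.
      by apply: ideal_add_r; apply: ideal_principal.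
    exact: H Sig1 idk (ltnSn _).
  elim=> // m IH b k Sb idk km.
  have [all|] := pselect (forall c, C c -> Sig (b * c)); first by exists b.
  move=> /existsNP [c] /not_implyP [Cc Sbc].
  have iX x : is_ideal (ideal_add (principal x) Sig).
    by apply: ideal_add_ideal => //; apply: ideal_principal.
  have SX x : Sig `<=` ideal_add (principal x) Sig by apply: ideal_add_r; apply: ideal_principal.
  have sub : ideal_add (principal (b * c)) Sig `<=` ideal_add (principal b) Sig.
    apply: ideal_add_sub => //; apply: principal_sub => //; apply: idealMr => //.
    by apply: ideal_add_l => //; apply: principal_mem.
  have [k' idk'] := ded_idx2 iSig (iX (b * c)) (aSig _ (principal_mem a)) a0 (SX _).
  have [l idl] := ded_idx2 (iX (b * c)) (iX b) (SX _ _ (aSig _ (principal_mem a))) a0 sub.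
  have kE : k = (l * k')%N.
    by apply: (idx_uniq idk); apply: idx_trans idl idk'; first [exact: ideal_subgroup|exact: SX|exact: sub].
  (* If b stays in (bc) + Sig, then b (1 - cr) lies in Sig for some r, and 1 - cr belongs to S, so b
     itself lies in Sig: Nakayama's lemma for a cyclic module. *)
  have [Xb|Xb] := pselect (ideal_add (principal (b * c)) Sig b).
    have [_ [z [[r ->] Sz e]]] := Xb.
    case: Sb; have [s Ss sS] : Sig (b * (1 - c * r)).
      by rewrite mulrBr mulr1 mulrA {1}e addrAC subrr add0r.
    exists (s * (1 - c * r)); last by rewrite -mulrA [(1 - _) * b]mulrC.
    apply: SM => //; rewrite /S addrAC subrr add0r.
    by apply: idealN => //; apply: idealMr.
  apply: (IH (b * c) k') => //; move: km; rewrite ltnS; apply: leq_trans; rewrite kE.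
  have l1 : (1 < l)%N.
    apply: (@idx_gt1 _ (ideal_add (principal b) Sig) _ _ b _ _ Xb idl); first by have [] := iX b.
    by apply: ideal_add_l => //; apply: principal_mem.
  have k'0 : (0 < k')%N.
    by apply: (@idx_gt0 _ (ideal_add (principal (b * c)) Sig) _ _ _ idk'); have [] := iX (b * c).
  by move: k'0; case: (k') => // k'' _; rewrite ltn_Pmull.
(* A common denominator: the product of one denominator for each class of R / aR that meets Sig. *)
have [s Ss sS] : exists2 s, S s & forall x, Sig x -> principal a (s * x).
  have [_ /(_ a a0) [n [T [f [_ fk _]]]] _] := HR.
  suff [s Ss sP] : exists2 s, S s & forall t, t \in enum T -> forall x, Sig x -> f x = t ->
      principal a (s * x).
    by exists s => // x Sx; apply: (sP (f x)); rewrite ?mem_enum.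
  elim: (enum T) => [|t r [s Ss sP]]; first by exists 1.
  have [[y [Sy fy]]|no] := pselect (exists y, Sig y /\ f y = t); last first.
    exists s => // u; rewrite inE => /orP [/eqP -> x Sx fx|]; last exact: sP.
    by case: no; exists x.
  have [s' Ss' ay] := Sy; exists (s' * s); first exact: SM.
  move=> u; rewrite inE => /orP [/eqP -> x Sx fx|ur x Sx fx].
    have axy : principal a (x - y) by apply/fk => //; rewrite fx fy.
    rewrite -[_ * x](_ : s * (s' * y) + (s' * s) * (x - y) = _); last by ring.
    by have [_ D M] := ideal_principal a; apply: D; apply: M.
  by rewrite -mulrA; apply: idealMl; [apply: ideal_principal|apply: (sP u)].
exists (s * b) => [asb|c Cc]; first by case: Sb; exists s.
rewrite -mulrA; by apply: sS; apply: minb.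
Qed.

Definition ideal_quo A B : set R := [set x | forall y, A y -> B (y * x)].

Lemma ideal_quo_ideal A B : is_ideal B -> is_ideal (ideal_quo A B).
Proof.
move=> [B0 BD BM]; split=> [y _|x y Ax Ay z Az|a x Ax z Az].
- by rewrite mulr0.
- by rewrite mulrDr; apply: BD; [apply: Ax|apply: Ay].
- by rewrite mulrCA; apply/BM/Ax.
Qed.

(* [ideal_quo A (principal a)] is a A^-1. *)
Lemma ded_inverse A a : is_ideal A -> A a -> a <> 0 ->
  ideal_mul A (ideal_quo A (principal a)) = principal a.
Proof.
move=> iA Aa a0; set A' := ideal_quo A (principal a).
have iA' : is_ideal A' by apply/ideal_quo_ideal/ideal_principal.
have sub : ideal_mul A A' `<=` principal a.
  by apply: ideal_mul_sub => [|x y Ax]; [apply: ideal_principal|apply].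
pose C : set R := [set c | ideal_mul A A' (a * c)].
have iC : is_ideal C.
  have [I0 ID IM] := ideal_mul_ideal A A'.
  split; rewrite /C /= ?mulr0 //.
    by move=> x y Cx Cy; rewrite /C /= mulrDr; apply: ID.
  by move=> x y Cy; rewrite /C /= mulrCA; apply: IM.
have [C1|C1] := pselect (C 1).
  apply/seteqP; split=> //; apply: principal_sub; first exact: ideal_mul_ideal.
  by rewrite -[a]mulr1.
exfalso.
have A'a : A' a by move=> x Ax; exists x; rewrite mulrC.
have Ca : C a by apply: ideal_mul_mem.
have [b nab bC] := ded_annihilator iC C1 Ca a0.
(* The fraction b / a maps A' into itself because b C lies in aR. Complete integral closedness then
   puts b / a in R, against the choice of b. *)
have step z : A' z -> exists2 r, A' r & b * z = a * r.
  move=> A'z.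
  have key x : A x -> exists r, b * z * x = a * (a * r).
    move=> Ax; have [c e] := A'z x Ax.
    have Cc : C c by rewrite /C /= -e; apply: ideal_mul_mem.
    have [r e'] := bC c Cc; exists r.
    by rewrite -mulrA [z * x]mulrC e -e'; ring.
  have [r e] := key a Aa; have e' : b * z = a * r.
    by apply: (ded_mulI a0); rewrite mulrC.
  exists r => // x Ax; have [r' er'] := key x Ax; exists r'.
  apply: (ded_mulI a0); rewrite -er' e'; ring.
have pow n : exists2 z, A' z & a * b ^+ n = a ^+ n * z.
  elim: n => [|n [z A'z e]]; first by exists a => //; rewrite !expr0 mulr1 mul1r.
  have [r A'r er] := step z A'z; exists r => //.
  by rewrite exprSr mulrA e -mulrA [z * b]mulrC er exprSr mulrA.
apply: nab; have [_ _ cic] := HR.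
by apply: (cic b a a) => // n; have [z _ e] := pow n; exists z.
Qed.

(** To contain is to divide. In place of multiplying by A^-1, the claim that w b lies in a A H is
    checked on the generators of A A', then read at w = a, which belongs to A A' by [ded_inverse];
    cancelling a leaves b in A H. *)
Lemma ded_contains_divides A B a : is_ideal A -> is_ideal B -> A a -> a <> 0 ->
  B `<=` A -> B = ideal_mul A (ideal_quo A B).
Proof.
move=> iA iB Aa a0 BA; set H := ideal_quo A B.
apply/seteqP; split; last by apply: ideal_mul_sub => // x y Ax; apply.
move=> b Bb; have inv := ded_inverse iA Aa a0; set A' := ideal_quo _ _ in inv.
have [_ ID IM] := ideal_mul_ideal A H.
have : ideal_mul A A' `<=` [set w | exists2 v, ideal_mul A H v & w * b = a * v].
  apply: ideal_mul_sub => [|x y Ax A'y].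
    split; first by exists 0; rewrite ?mulr0 ?mul0r //; have [] := ideal_mul_ideal A H.
      move=> x y [v Hv ev] [w Hw ew]; exists (v + w); first exact: ID.
      by rewrite mulrDl ev ew mulrDr.
    move=> c x [v Hv ev]; exists (c * v); first exact: IM.
    by rewrite -mulrA ev mulrCA.
  have [h eh] := A'y b (BA _ Bb).
  exists (x * h); last by rewrite -mulrA [y * b]mulrC eh mulrCA.
  apply: ideal_mul_mem => // z Az; have [r er] := A'y z Az.
  have -> : z * h = b * r; last exact: idealMr.
  by apply: (ded_mulI a0); rewrite mulrCA -eh mulrCA er mulrCA.
rewrite inv => /(_ a (principal_mem a)) [v Hv /(ded_mulI a0) ->]; exact: Hv.
Qed.

Lemma ded_cancel A B C a : is_ideal A -> is_ideal C -> A a -> a <> 0 ->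
  ideal_mul A B `<=` ideal_mul A C -> B `<=` C.
Proof.
move=> iA iC Aa a0 sub b Bb.
have inv := ded_inverse iA Aa a0; set A' := ideal_quo _ _ in inv.
suff : ideal_mul A C `<=` [set v | forall y, A' y -> exists2 c, C c & y * v = a * c].
  move=> H.
  have : ideal_mul A A' `<=` [set w | exists2 c, C c & w * b = a * c].
    have [C0 CD CM] := iC; apply: ideal_mul_sub => [|x y Ax A'y].
      split; first by exists 0; rewrite ?mulr0 ?mul0r.
        move=> u w [c Cc ec] [d Cd ed]; exists (c + d); first exact: CD.
        by rewrite mulrDl ec ed mulrDr.
      move=> u w [c Cc ec]; exists (u * c); first exact: CM.
      by rewrite -mulrA ec mulrCA.
    have [c Cc e] := H _ (sub _ (ideal_mul_mem Ax Bb)) y A'y.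
    by exists c => //; rewrite -e; ring.
  by rewrite inv => /(_ a (principal_mem a)) [c Cc /(ded_mulI a0) ->].
have [C0 CD CM] := iC; apply: ideal_mul_sub => [|x c Ax Cc y A'y].
  split=> [y _|u v Hu Hv y A'y|r u Hu y A'y].
  - by exists 0; rewrite ?mulr0.
  - have [[c Cc ec] [d Cd ed]] := (Hu y A'y, Hv y A'y).
    by exists (c + d); [apply: CD|rewrite mulrDr ec ed mulrDr].
  - have [c Cc ec] := Hu y A'y.
    by exists (r * c); [apply: CM|rewrite mulrCA ec mulrCA].
have [r er] := A'y x Ax.
by exists (r * c); [apply: CM|rewrite mulrA [y * x]mulrC er mulrA].
Qed.

(* (a, b)^2 = (a^2, b^2) *)
Lemma ded_mul_in_squares a b : exists u v, a * b = u * a ^+ 2 + v * b ^+ 2.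
Proof.
have [->|/eqP a0] := eqVneq a 0; first by exists 0, 0; rewrite !mul0r addr0.
have iA := ideal_add_ideal (ideal_principal a) (ideal_principal b).
have Aa : ideal_add (principal a) (principal b) a by apply: ideal_add_l; [apply: ideal_principal|apply: principal_mem].
have Ab : ideal_add (principal a) (principal b) b by apply: ideal_add_r; [apply: ideal_principal|apply: principal_mem].
have inv := ded_inverse iA Aa a0; set A' := ideal_quo _ _ in inv.
have [iA'0 iA'D iA'M] : is_ideal A' by apply/ideal_quo_ideal/ideal_principal.
have : ideal_mul (ideal_add (principal a) (principal b)) A' `<=`
    [set w | exists x y, [/\ A' x, A' y & w = a * x + b * y]].
  apply: ideal_mul_sub => [|_ z [_ [_ [[x ->] [y ->] ->]]] A'z].
    split; first by exists 0, 0; rewrite !mulr0 addr0.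
      move=> _ _ [x [y [Ax Ay ->]]] [x' [y' [Ax' Ay' ->]]].
      by exists (x + x'), (y + y'); split; [exact: iA'D|exact: iA'D|ring].
    move=> c _ [x [y [Ax Ay ->]]].
    by exists (c * x), (c * y); split; [exact: iA'M|exact: iA'M|ring].
  by exists (x * z), (y * z); split; [exact: iA'M|exact: iA'M|ring].
rewrite inv => /(_ a (principal_mem a)) [x [y [A'x A'y e]]].
(* From b x = a p and b y = a q follows 1 = x + q, and ab (x + q) = p a^2 + y b^2. *)
have [[p ep] [q eq]] := (A'x b Ab, A'y b Ab).
exists p, y.
have q1 : 1 = x + q by apply: (ded_mulI a0); rewrite mulr1 {1}e mulrDr -eq.
transitivity (a * (b * x) + b * (a * q)); first by rewrite -[LHS]mulr1 {1}q1; ring.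
by rewrite ep -eq; ring.
Qed.

(** Induction along an ideal B' minimal above B: B' / B and AB' / AB are simple modules, each
    isomorphic to R modulo the annihilator of a nonzero element, and the two annihilators coincide,
    so both steps have the same index. *)
Lemma ded_idx_mul A B a b n : is_ideal A -> is_ideal B -> A a -> a <> 0 ->
  B b -> b <> 0 -> has_index setT B n -> has_index A (ideal_mul A B) n.
Proof.
move=> iA iB Aa a0 Bb b0; have [m] := ubnP n.
elim: m n B iB Bb => // m IH n B iB Bb lenm idn.
have [B1|B1] := pselect (B 1).
  have ET := ideal_full iB B1; rewrite ET in idn *.
  rewrite ideal_mul1 //; have -> : n = 1%N by apply: (idx_uniq idn); apply: idx1.
  exact/idx1/ideal_subgroup.
have [B' [iB' BB' [x [B'x Bx]] min]] : exists B', [/\ is_ideal B', B `<=` B',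
     exists x, B' x /\ ~ B x &
     forall C, is_ideal C -> B `<=` C -> C `<=` B' -> C `<=` B \/ B' `<=` C].
  suff H : forall l B' k, is_ideal B' -> B `<=` B' -> (exists x, B' x /\ ~ B x) ->
      has_index B' B k -> (k < l)%N -> exists B', [/\ is_ideal B', B `<=` B',
     exists x, B' x /\ ~ B x &
     forall C, is_ideal C -> B `<=` C -> C `<=` B' -> C `<=` B \/ B' `<=` C].
    by apply: (H _ setT _ _ _ _ idn (ltnSn _)) => //; exists 1.
  elim=> // l IHl B' k iB' BB' ex idk kl.
  have [//|] := pselect (exists B', [/\ is_ideal B', B `<=` B',
     exists x, B' x /\ ~ B x &
     forall C, is_ideal C -> B `<=` C -> C `<=` B' -> C `<=` B \/ B' `<=` C]).
  have [all _|] := pselect (forall C, is_ideal C -> B `<=` C -> C `<=` B' ->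
     C `<=` B \/ B' `<=` C); first by exists B'.
  move=> /existsNP [C] /not_implyP [iC] /not_implyP [BC] /not_implyP [CB'].
  move=> /not_orP [/existsNP [x /not_implyP [Cx Bx]] /existsNP [y /not_implyP [B'y Cy]]].
  have [k' idk'] := ded_idx2 iB iC Bb b0 BC.
  have [j idj] := ded_idx2 iC iB' (BC _ Bb) b0 CB'.
  move=> _; apply: (IHl C k') => //; first by exists x.
  move: kl; rewrite ltnS; apply: leq_trans.
  have -> : k = (j * k')%N.
    by apply: (idx_uniq idk); apply: idx_trans idj idk'; try exact: ideal_subgroup.
  have j1 : (1 < j)%N by apply: (@idx_gt1 _ B' _ _ y _ _ Cy idj) => //; have [] := iB'.
  have k'0 : (0 < k')%N by apply: (@idx_gt0 _ C _ _ _ idk'); have [] := iC.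
  by case: (k') k'0 => // k'' _; rewrite ltn_Pmull.
have [n' idn'] := ded_idx iB' (BB' _ Bb) b0.
have [k idk] := ded_idx2 iB iB' Bb b0 BB'.
have nE : n = (n' * k)%N.
  by apply: (idx_uniq idn); apply: idx_trans idn' idk; try exact: ideal_subgroup.
have lt' := idx_lt iB iB' BB' B'x Bx idn idn'.
have idA' := IH n' B' iB' (BB' _ Bb) (leq_trans lt' lenm) idn'.
have iAB := ideal_mul_ideal A B; have iAB' := ideal_mul_ideal A B'.
have ABB' : ideal_mul A B `<=` ideal_mul A B' by apply: ideal_mulSr.
have dom : a * b <> 0 by case: HR => dom _ _ /dom [].
have [k' idk'] := ded_idx2 iAB iAB' (ideal_mul_mem Aa Bb) dom ABB'.
suff kk' : k = k'.
  rewrite nE kk'; apply: idx_trans idA' idk'; try exact: ideal_subgroup => //.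
    exact: ideal_mul_subl.
  exact: ABB'.
(* A simple module D' / D is generated by the class of y, so r -> r y identifies it with R modulo
   the annihilator of that class. *)
have simple (D D' : set R) y l : is_ideal D -> is_ideal D' -> D `<=` D' -> D' y -> ~ D y ->
    (forall C, is_ideal C -> D `<=` C -> C `<=` D' -> C `<=` D \/ D' `<=` C) ->
    has_index D' D l -> has_index setT [set r | D (r * y)] l.
  move=> iD iD' DD' D'y Dy minD; apply: (@idx_map _ _ (fun r => r * y)).
  - exact: ideal_subgroup.
  - by move=> r _; apply: idealMl.
  - move=> z D'z; have [] := minD (ideal_add D (principal y)).
    + by apply: ideal_add_ideal => //; apply: ideal_principal.
    + by apply: ideal_add_l; apply: ideal_principal.
    + by apply: ideal_add_sub => //; apply: principal_sub.
    + by move=> /(_ y) H; case: Dy; apply: H; apply: ideal_add_r => //; apply: principal_mem.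
    + move=> /(_ z D'z) [d [_ [Dd [r ->] ->]]].
      by exists r => //; rewrite [y * r]mulrC addrK.
  - by move=> r s _ _; rewrite /= mulrBl.
have inv := ded_inverse iA Aa a0; set A' := ideal_quo _ _ in inv.
(* The ideal D below is A^-1 C: division by A carries an ideal between AB and AB' to one between B
   and B', where minimality is known. *)
have minAB C : is_ideal C -> ideal_mul A B `<=` C -> C `<=` ideal_mul A B' ->
    C `<=` ideal_mul A B \/ ideal_mul A B' `<=` C.
  move=> iC ABC CAB'.
  have [iC0 iCD iCM] := iC.
  pose D : set R := [set c | ideal_mul A' C (a * c)].
  have [I0 ID IM] := ideal_mul_ideal A' C.
  have iD : is_ideal D.
    split; rewrite /D /= ?mulr0 //.
      by move=> u v Du Dv; rewrite /D /= mulrDr; apply: ID.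
    by move=> u v Dv; rewrite /D /= mulrCA; apply: IM.
  have BD : B `<=` D.
    move=> c Bc; rewrite /D /=.
    have : ideal_mul A A' `<=` [set w | ideal_mul A' C (w * c)].
      apply: ideal_mul_sub => [|u v Au A'v].
        split=> [|u v Hu Hv|u v Hv]; rewrite /= ?mul0r //.
          by rewrite mulrDl; apply: ID.
        by rewrite -mulrA; apply: IM.
      rewrite /= [u * v]mulrC -mulrA; apply: ideal_mul_mem => //.
      by apply: ABC; apply: ideal_mul_mem.
    by rewrite inv => /(_ a (principal_mem a)).
  have A'C c : ideal_mul A' C c -> exists2 d, B' d & c = a * d.
    have [B0' B'D B'M] := iB'.
    have iE : is_ideal [set v | exists2 d, B' d & v = a * d].
      split; first by exists 0; rewrite ?mulr0.
        by move=> _ _ [d Bd ->] [e Be ->]; exists (d + e); [exact: B'D|rewrite mulrDr].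
      by move=> r _ [d Bd ->]; exists (r * d); [exact: B'M|rewrite mulrCA].
    move=> H; suff : ideal_mul A' C `<=` [set v | exists2 d, B' d & v = a * d] by apply.
    apply: ideal_mul_sub => // u v A'u /CAB' Cv.
    suff : ideal_mul A B' `<=` [set v | exists2 d, B' d & u * v = a * d] by apply.
    apply: ideal_mul_sub => [|s t As Bt].
      split; first by exists 0; rewrite ?mulr0.
        move=> s t [d Bd ed] [e Be ee]; exists (d + e); first exact: B'D.
        by rewrite !mulrDr ed ee.
      move=> r s [d Bd ed]; exists (r * d); first exact: B'M.
      by rewrite mulrCA ed mulrCA.
    have [z ez] := A'u s As; exists (z * t); first exact: B'M.
    by rewrite mulrA [u * s]mulrC ez mulrA.
  have DB' : D `<=` B'.
    by move=> c /A'C [d B'd /(ded_mulI a0) ->].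
  have [DB|B'D] := min D iD BD DB'.
    left=> c Cc.
    have : ideal_mul A A' `<=` [set w | exists2 v, ideal_mul A B v & w * c = a * v].
      have [J0 JD JM] := ideal_mul_ideal A B.
      apply: ideal_mul_sub => [|u v Au A'v].
        split; first by exists 0; rewrite ?mulr0 ?mul0r.
          move=> s t [v Hv ev] [w Hw ew]; exists (v + w); first exact: JD.
          by rewrite mulrDl ev ew mulrDr.
        move=> s t [v Hv ev]; exists (s * v); first exact: JM.
        by rewrite -mulrA ev mulrCA.
      have mem := ideal_mul_mem A'v Cc.
      have [d B'd ed] := A'C _ mem.
      exists (u * d); last by rewrite -mulrA ed mulrCA.
      by apply: ideal_mul_mem => //; apply: DB; rewrite /D /= -ed.
    by rewrite inv => /(_ a (principal_mem a)) [v Hv /(ded_mulI a0) ->].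
  right; apply: ideal_mul_sub => // u v Au B'v.
  have : ideal_mul A' C (a * v) by apply: B'D.
  suff sub : ideal_mul A' C `<=` [set w | exists2 c, C c & u * w = a * c].
    move=> /sub [c Cc e]; suff -> : u * v = c by [].
    by apply: (ded_mulI a0); rewrite -e; ring.
  apply: ideal_mul_sub => [|s t A's Ct].
    split; first by exists 0; rewrite ?mulr0.
      move=> s t [d Bd ed] [e Be ee]; exists (d + e); first exact: iCD.
      by rewrite !mulrDr ed ee.
    move=> r s [d Bd ed]; exists (r * d); first exact: iCM.
    by rewrite mulrCA ed mulrCA.
  have [z ez] := A's u Au; exists (z * t); first exact: iCM.
  by rewrite mulrA ez mulrA.
have [y [AB'y ABy]] : exists y, ideal_mul A B' y /\ ~ ideal_mul A B y.
  apply: contrapT => no; apply: Bx; apply: (ded_cancel iA iB Aa a0 _ B'x).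
  by move=> y AB'y; apply: contrapT => ABy; apply: no; exists y.
have id1 := simple _ _ _ _ iB iB' BB' B'x Bx min idk.
have id2 := simple _ _ _ _ iAB iAB' ABB' AB'y ABy minAB idk'.
apply: (idx_uniq id1); suff -> : [set r | B (r * x)] = [set r | ideal_mul A B (r * y)] by [].
have PP' : [set r | B (r * x)] `<=` [set r | ideal_mul A B (r * y)].
  move=> r /= Brx.
  have rB' z : B' z -> B (r * z).
    move=> B'z; have [] := min (ideal_add B (principal x)).
    + by apply: ideal_add_ideal => //; apply: ideal_principal.
    + by apply: ideal_add_l; apply: ideal_principal.
    + by apply: ideal_add_sub => //; apply: principal_sub.
    + by move=> /(_ x) H; case: Bx; apply: H; apply: ideal_add_r => //; apply: principal_mem.
    + move=> /(_ z B'z) [d [_ [Bd [s ->] ->]]]; have [_ BD BM] := iB.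
      by rewrite mulrDr mulrA; apply: BD; [apply: BM|apply: idealMr].
  suff sub : ideal_mul A B' `<=` [set z | ideal_mul A B (r * z)] by apply: sub.
  have [J0 JD JM] := ideal_mul_ideal A B.
  apply: ideal_mul_sub => [|s t As Bt].
    split; rewrite /= ?mulr0 //.
      by move=> s t Hs Ht; rewrite /= mulrDr; apply: JD.
    by move=> s t Ht; rewrite /= mulrCA; apply: JM.
  by rewrite /= mulrCA; apply: ideal_mul_mem => //; apply: rB'.
(* Conversely, if r kills y but not x, then r x generates B' modulo B, so some 1 - r s kills x,
   hence also y; together with r it puts y in AB. *)
apply/seteqP; split=> // r /= Hr; apply: contrapT => Brx.
have [] := min (ideal_add B (principal (r * x))).
+ by apply: ideal_add_ideal => //; apply: ideal_principal.
+ by apply: ideal_add_l; apply: ideal_principal.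
+ by apply: ideal_add_sub => //; apply: principal_sub => //; apply: idealMl.
+ by move=> /(_ (r * x)) H; case: Brx; apply: H; apply: ideal_add_r => //; apply: principal_mem.
move=> /(_ x B'x) [d [_ [Bd [s ->] e]]].
have /PP' /= : [set r | B (r * x)] (1 - r * s).
  rewrite /= mulrBl mul1r {1}e.
  by rewrite -[_ - _](_ : d = _) //; ring.
rewrite mulrBl mul1r => H; apply: ABy.
rewrite -[y](_ : (y - r * s * y) + s * (r * y) = _); last by ring.
by have [_ JD JM] := iAB; apply: JD => //; apply: JM.
Qed.

End Ideals.

(** * Embeddings, traces and norms *)

Section Embeddings.
Variables (F : fieldType) (E : fieldExtType F).
Local Notation n := (\dim {:E}).
Local Notation inE := (map_poly (in_alg E)).

(** The [E : F] extensions of s to E, listed without repetition. A primitive element on which they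
    differ is kept because its powers give a Vandermonde matrix and because [quadratic_relation]
    works with its conjugates. *)
Definition is_embeddings (s : F -> algC) (sig : 'I_n -> {rmorphism E -> algC}) :=
  [/\ forall i a, sig i a%:A = s a,
      exists2 z : E, (forall x, exists p : {poly F}, x = (inE p).[z]) &
        injective (fun i => sig i z)
    & forall tau : {rmorphism E -> algC}, (forall a, tau a%:A = s a) ->
        exists i, tau =1 sig i].

Lemma embeddings_exist (s : {rmorphism F -> algC}) :
  exists sig, is_embeddings s sig.
Proof.
have pch : [pchar E] =i pred0.
  move=> p; apply/negbTE/negP => /andP [pp /eqP p0].
  have /eqP : (p%:R : F) = 0.
    by apply: (fmorph_inj (in_alg E)); rewrite rmorph_nat rmorph0.
  rewrite -(fmorph_eq0 s) rmorph_nat pnatr_eq0 => /eqP p0'.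
  by move: pp; rewrite p0'.
pose z := separable_generator 1%AS {:E}%VS.
have Ez : {:E}%VS = <<1; z>>%VS.
  apply: eq_adjoin_separable_generator; last exact: sub1v.
  by apply/separableP => y _; apply: pcharf0_separable.
have genz x : exists p : {poly F}, x = (inE p).[z].
  by apply/Fadjoin1_polyP; rewrite -Ez memvf.
have sepz : separable_element 1%AS z by apply: pcharf0_separable.
have /polyOver1P [q Dq] := minPolyOver 1%AS z.
have szq : size q = n.+1.
  rewrite -(size_map_poly (in_alg E)) -Dq size_minPoly.
  by rewrite [in RHS]Ez adjoin_degreeE dimv1 divn1.
have monq : q \is monic.
  by rewrite -(map_monic (in_alg E)) -Dq monic_minPoly.
have sepq : separable_poly q.
  by rewrite -(separable_map (in_alg E)) -Dq.
have divq (p : {poly F}) : (inE p).[z] = 0 -> q %| p.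
  move=> pz; rewrite -(dvdp_map (in_alg E)) -Dq minPoly_dvdp ?alg_polyOver //.
  exact/rootP.
have [rs Drs] := closed_field_poly_normal (map_poly s q).
rewrite lead_coef_map (monicP monq) rmorph1 scale1r in Drs.
have szrs : size rs = n.
  apply/eqP; rewrite -eqSS -[(size rs).+1](size_prod_XsubC rs id) -Drs.
  by rewrite size_map_poly szq.
have urs : uniq rs by rewrite -separable_prod_XsubC -Drs separable_map.
have lift r : root (map_poly s q) r -> exists f : {rmorphism E -> algC},
    forall p : {poly F}, f (inE p).[z] = (map_poly s p).[r].
  move=> qr; have /choice [rep repP] := genz.
  pose f x := (map_poly s (rep x)).[r].
  have fP (p : {poly F}) : f (inE p).[z] = (map_poly s p).[r].
    apply/eqP; rewrite -subr_eq0 /f -hornerN -hornerD -rmorphN -rmorphD /=.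
    have /dvdpP [c ->] : q %| rep (inE p).[z] - p.
      by apply: divq; rewrite rmorphB hornerD hornerN -repP subrr.
    by rewrite rmorphM hornerM (eqP qr) mulr0.
  have fB : zmod_morphism f.
    move=> x y; rewrite [x]repP [y]repP -hornerN -hornerD -rmorphN -rmorphD /=.
    by rewrite !fP rmorphD rmorphN hornerD hornerN.
  have fM : monoid_morphism f.
    split.
      have -> : (1 : E) = (inE 1).[z] by rewrite rmorph1 hornerC.
      by rewrite fP rmorph1 hornerC.
    move=> x y; rewrite [x]repP [y]repP -hornerM -rmorphM /= !fP.
    by rewrite rmorphM hornerM.
  pose fB' := GRing.isZmodMorphism.Build _ _ f fB.
  pose fM' := GRing.isMonoidMorphism.Build _ _ f fM.
  pose f' : {rmorphism E -> algC} := HB.pack f fB' fM'.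
  by exists f'.
have rs_root (i : 'I_n) : root (map_poly s q) rs`_i.
  by rewrite Drs root_prod_XsubC mem_nth // szrs.
have /choice [sig sigP] : forall i : 'I_n, exists f : {rmorphism E -> algC},
    forall p : {poly F}, f (inE p).[z] = (map_poly s p).[rs`_i].
  by move=> i; apply: lift.
have sigz i : sig i z = rs`_i.
  by have := sigP i 'X; rewrite !map_polyX !hornerX.
exists sig; split.
- by move=> i a; have := sigP i a%:P; rewrite !map_polyC !hornerC.
- exists z => // i j /=; rewrite !sigz => /eqP.
  by rewrite nth_uniq ?szrs // => /eqP /val_inj.
- move=> tau Htau.
  have tauP (p : {poly F}) : tau (inE p).[z] = (map_poly s p).[tau z].
    rewrite -horner_map -map_poly_comp; congr horner.
    by apply: eq_map_poly => a /=; rewrite Htau.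
  have : tau z \in rs.
    rewrite -root_prod_XsubC -Drs; apply/rootP.
    by rewrite -tauP -Dq minPolyxx rmorph0.
  move=> /(nthP 0) [k]; rewrite szrs => kn e.
  exists (Ordinal kn) => x; have [p ->] := genz x.
  by rewrite tauP sigP e.
Qed.

Variables (s : {rmorphism F -> algC}) (sig : 'I_n -> {rmorphism E -> algC}).
Hypothesis sigP : is_embeddings s sig.

Lemma emb_scale i a x : sig i (a *: x) = s a * sig i x.
Proof. by have [sa _ _] := sigP; rewrite -mulr_algl rmorphM sa. Qed.

Lemma emb_inj i j : sig i =1 sig j -> i = j.
Proof. by have [_ [z _ inj] _] := sigP; move=> eq; apply: inj; rewrite eq. Qed.

Definition emb_mx (e : n.-tuple E) : 'M[algC]_n := \matrix_(i, j) sig i (tnth e j).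

Lemma basis_tnth (e : n.-tuple E) x : basis_of {:E} e ->
  x = \sum_i coord e i x *: tnth e i.
Proof.
move=> be; rewrite {1}(coord_basis be (memvf x)).
by apply: eq_bigr => i _; rewrite (tnth_nth 0).
Qed.

(** Independence of characters: a linear relation between the embeddings, read on the powers of the
    primitive element z, contradicts the Vandermonde determinant. *)
Lemma emb_mx_unit (e : n.-tuple E) : basis_of {:E} e -> \det (emb_mx e) != 0.
Proof.
move=> be; rewrite -unitfE; suff : emb_mx e \in unitmx by rewrite unitmxE.
rewrite -row_free_unit -kermx_eq0; apply/rowV0P => u /sub_kermxP uV.
have ux x : \sum_i u 0 i * sig i x = 0.
  rewrite [x](basis_tnth _ be).
  transitivity (\sum_j s (coord e j x) * (u *m emb_mx e) 0 j).
    under eq_bigr => i _ do rewrite rmorph_sum mulr_sumr.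
    rewrite exchange_big; apply: eq_bigr => j _; rewrite mxE mulr_sumr.
    by apply: eq_bigr => i _; rewrite emb_scale mxE mulrCA.
  by rewrite uV; apply: big1 => j _; rewrite mxE mulr0.
have [_ [z _ injz] _] := sigP.
pose W := Vandermonde n (\row_i sig i z).
have uW : u *m W^T = 0.
  apply/rowP => j; rewrite !mxE -[RHS](ux (z ^+ j)).
  by apply: eq_bigr => i _; rewrite !mxE rmorphXn.
have Wu : W^T \in unitmx.
  rewrite unitmx_tr unitmxE unitfE det_Vandermonde.
  apply/prodf_neq0 => i _; apply/prodf_neq0 => j ij; rewrite !mxE subr_eq0.
  by apply/negP => /eqP /injz ji; rewrite ji ltnn in ij.
by rewrite -[u]mulmx1 -(mulmxV Wu) mulmxA uW mul0mx.
Qed.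

Lemma emb_basis (e : n.-tuple E) : \det (emb_mx e) != 0 -> basis_of {:E} e.
Proof.
move=> de; rewrite basisEfree size_tuple leqnn andbT subvf andbT.
apply/freeP => k k0 i.
have : emb_mx e *m (\col_j s (k j)) = 0.
  apply/colP => l; rewrite !mxE -[RHS](rmorph0 (sig l)) -k0 rmorph_sum.
  by apply: eq_bigr => j _; rewrite !mxE emb_scale mulrC (tnth_nth 0).
move=> /(congr1 (mulmx (invmx (emb_mx e)))); rewrite mulmx0 mulKmx; last first.
  by rewrite unitmxE unitfE.
by move=> /colP /(_ i); rewrite !mxE => /eqP; rewrite fmorph_eq0 => /eqP.
Qed.

Definition mul_mx (x : E) : 'M[F]_n :=
  passmx.mxof (vbasis {:E}) (vbasis {:E}) (amull x).

(** The matrix of conjugates of a basis diagonalises multiplication by x, with the conjugates of x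
    as eigenvalues; trace, norm and characteristic polynomial are all read off from this
    identity. *)
Lemma emb_mul_mx x : emb_mx (vbasis {:E}) *m (map_mx s (mul_mx x))^T =
  diag_mx (\row_i sig i x) *m emb_mx (vbasis {:E}).
Proof.
have be := vbasisP {:E}%VS.
apply/matrixP => i j; rewrite mul_diag_mx !mxE -rmorphM.
rewrite [x * _](basis_tnth _ be) rmorph_sum; apply: eq_bigr => k _.
rewrite !mxE emb_scale mulrC /= passmx.vecof_delta lfunE /=.
by rewrite [in RHS](tnth_nth 0).
Qed.

Lemma emb_trace x : s (ext_trace x) = \sum_i sig i x.
Proof.
have Vu : emb_mx (vbasis {:E}) \in unitmx.
  by rewrite unitmxE unitfE emb_mx_unit // vbasisP.
rewrite -[ext_trace x]/(\tr (mul_mx x)) -mxtrace_tr.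
rewrite -[RHS](_ : \tr (diag_mx (\row_i sig i x)) = _); last first.
  by rewrite mxtrace_diag; apply: eq_bigr => i _; rewrite mxE.
rewrite -[diag_mx _](mulmxK Vu) -emb_mul_mx mxtrace_mulC mulKmx //.
by rewrite !mxtrace_tr trace_map_mx.
Qed.

Definition ext_norm (x : E) : F := \det (mul_mx x).

Lemma emb_charpoly x :
  map_poly s (char_poly (mul_mx x)) = \prod_i ('X - (sig i x)%:P).
Proof.
set V := emb_mx (vbasis {:E}).
have V0 : \det (map_mx polyC V) != 0.
  by rewrite det_map_mx polyC_eq0 emb_mx_unit // vbasisP.
rewrite map_char_poly /char_poly -det_tr.
apply: (mulfI V0); rewrite -det_mulmx.
have -> : map_mx polyC V *m (char_poly_mx (map_mx s (mul_mx x)))^T =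
   diag_mx (\row_i ('X - (sig i x)%:P)) *m map_mx polyC V.
  rewrite /char_poly_mx linearB /= tr_scalar_mx mulmxBr mul_mx_scalar.
  rewrite matrix.map_trmx -map_mxM emb_mul_mx -/V map_mxM map_diag_mx.
  by rewrite !mul_diag_mx; apply/matrixP => i j; rewrite !mxE mulrBl.
rewrite det_mulmx mulrC det_diag; congr (_ * _).
by apply: eq_bigr => i _; rewrite mxE.
Qed.

Lemma emb_norm x : s (ext_norm x) = \prod_i sig i x.
Proof.
set V := emb_mx (vbasis {:E}).
have V0 : \det V != 0 by rewrite emb_mx_unit // vbasisP.
apply: (mulfI V0); rewrite -det_map_mx -[X in _ * X = _]det_tr -det_mulmx emb_mul_mx.
rewrite det_mulmx mulrC det_diag; congr (_ * _).
by apply: eq_bigr => i _; rewrite mxE.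
Qed.

Lemma emb_norm_eq0 x : ext_norm x = 0 -> x = 0.
Proof.
move=> n0; have := emb_norm x; rewrite n0 rmorph0 => /esym /eqP.
by move=> /prodf_eq0 [i _]; rewrite fmorph_eq0 => /eqP.
Qed.

(** The mixed discriminant of two families. The alpha_u of the overview are of this kind, and
    [basis_disc] is the diagonal case. *)
Definition trace_det (g e : n.-tuple E) : F :=
  \det (\matrix_(i, j) ext_trace (tnth g i * tnth e j)).

Lemma emb_trace_det g e : s (trace_det g e) = \det (emb_mx g) * \det (emb_mx e).
Proof.
rewrite -det_map_mx -[\det (emb_mx g)]det_tr -det_mulmx; congr (\det _).
apply/matrixP => i j; rewrite !mxE emb_trace.
by apply: eq_bigr => k _; rewrite !mxE rmorphM.
Qed.

Lemma emb_disc (e : n.-tuple E) : s (basis_disc e) = \det (emb_mx e) ^+ 2.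
Proof. exact: emb_trace_det. Qed.

Lemma disc_neq0 (e : n.-tuple E) : basis_of {:E} e <-> basis_disc e != 0.
Proof.
by rewrite -(fmorph_eq0 s) emb_disc expf_eq0 /=; split=> [/emb_mx_unit|/emb_basis].
Qed.

End Embeddings.

Section Integral.

Lemma int_closure_rmorph (K K' : fieldType) (f : {rmorphism K -> K'}) x :
  x \in int_closure K -> f x \in int_closure K'.
Proof.
move=> /asboolP [p mp rp]; apply/asboolP; exists p => //.
rewrite (_ : map_poly intr p = map_poly f (map_poly intr p)) ?fmorph_root //.
by rewrite -map_poly_comp; apply: eq_map_poly => a; rewrite /= rmorph_int.
Qed.

Lemma int_closure_rmorphE (K K' : fieldType) (f : {rmorphism K -> K'}) x :
  (f x \in int_closure K') = (x \in int_closure K).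
Proof.
apply/idP/idP; last exact: int_closure_rmorph.
move=> /asboolP [p mp rp]; apply/asboolP; exists p => //.
rewrite -(fmorph_root f).
rewrite (_ : map_poly f (map_poly intr p) = map_poly intr p) //.
by rewrite -map_poly_comp; apply: eq_map_poly => a; rewrite /= rmorph_int.
Qed.

Lemma int_closure_Aint z : (z \in int_closure algC) = (z \in Aint).
Proof.
apply/idP/idP => [/asboolP [p mp rp]|].
  apply: (root_monic_Aint rp); first by rewrite monic_map.
  by apply/polyOverP => i; rewrite coef_map /=; apply: Num.Theory.intr_int.
move=> zA; apply/asboolP.
have /floorpP [p Dp] : minCpoly z \is a polyOver Num.int by [].
exists p; last by rewrite -Dp root_minCpoly.
have := minCpoly_monic z; rewrite Dp !monicE lead_coef_map_inj //; last exact: intr_inj.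
by rewrite -(rmorph1 (intr : {rmorphism int -> algC})) (inj_eq intr_inj).
Qed.

Lemma int_closure_rat (q : rat) : q \in int_closure rat -> exists k : int, q = k%:~R.
Proof.
move=> /(int_closure_rmorph (ratr : rat -> algC)); rewrite int_closure_Aint => qA.
have /intrP [k /eqP e] := Cint_rat_Aint (Crat_rat q) qA.
by exists k; apply/eqP; rewrite -(fmorph_eq (ratr : {rmorphism rat -> algC})) rmorph_int.
Qed.

Lemma int_closure_trans (K : fieldType) (p : {poly K}) x :
  p \is monic -> {subset (p : seq K) <= int_closure K} -> root p x ->
  x \in int_closure K.
Proof.
move=> mp ip rp; apply/asboolP; apply: (integral_root_monic mp rp).
by move=> y /ip /asboolP.
Qed.

End Integral.

(** * Integers of number fields *)

Section IntMatrixIndex.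

Lemma idx_diag N (d : 'rV[int]_N) : (forall i, d 0 i != 0) ->
  @has_index 'rV[int]_N setT [set v | exists u, v = u *m diag_mx d] (\prod_i `|d 0%R i|)%N.
Proof.
move=> d0.
pose k (i : 'I_N) := `|d 0 i|.-1.
have kE i : (k i).+1 = `|d 0%R i|%N by rewrite /k prednK // absz_gt0.
pose T := {dffun forall i : 'I_N, 'I_(k i).+1}.
pose f (v : 'rV[int]_N) : T := [ffun i => inord `|(v 0%R i %% d 0%R i)%Z|%N].
have fE v i : (f v i : nat) = `|(v 0%R i %% d 0%R i)%Z|%N.
  rewrite ffunE inordK // kE -ltz_nat.
  by rewrite gez0_abs ?modz_ge0 // abszE; apply: ltz_mod.
exists T, f; split.
- move=> t; exists (\row_i (t i : nat)%:Z) => //; apply/ffunP => i.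
  apply: val_inj; rewrite [LHS]fE mxE -modz_abs modz_small //.
  by rewrite lez_nat leq0n ltz_nat -kE ltn_ord.
- move=> x y _ _; split=> [fxy|[u e]].
    exists (\row_i ((x - y)%R 0%R i %/ d 0%R i)%Z); apply/rowP => i.
    rewrite mul_mx_diag !mxE divzK //.
    rewrite -eqz_mod_dvd; apply/eqP.
    have := congr1 (fun t : T => (t i : nat)%:Z) fxy.
    by rewrite !fE !gez0_abs ?modz_ge0.
  apply/ffunP => i; apply: val_inj; rewrite [LHS]fE [RHS]fE.
  congr (absz _); apply/eqP; rewrite eqz_mod_dvd; apply/dvdzP.
  exists (u 0 i); move/rowP/(_ i): e; rewrite mul_mx_diag !mxE => ->; ring.
- rewrite card_dep_ffun foldrE big_image /=.
  by apply: eq_bigr => i _; rewrite card_ord kE.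
Qed.

Lemma idx_mx N (M : 'M[int]_N) : \det M != 0 ->
  @has_index 'rV[int]_N setT [set v | exists u, v = u *m M] `|\det M|%N.
Proof.
move=> dM; have [L uL [R uR [d _ E]]] := int_Smith_normal_form M.
pose dd : 'rV[int]_N := \row_i d`_i.
have Ed : (\matrix_(i, j) (d`_i *+ (i == j :> nat))) = diag_mx dd.
  apply/matrixP => i j; rewrite !mxE -[(i == j :> nat)]/(i == j).
  by case: eqP.
rewrite Ed in E.
have detU (A : 'M[int]_N) : A \in unitmx -> `|\det A|%N = 1%N.
  rewrite unitmxE => /unitrP [x [_ e]]; apply/eqP.
  by move/(congr1 absz): e => /eqP; rewrite abszM muln_eq1 => /andP [].
have dE : `|\det M|%N = (\prod_i `|dd 0%R i|)%N.
  rewrite E !det_mulmx !abszM (detU _ uL) (detU _ uR) mul1n muln1 det_diag.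
  by elim/big_rec2: _ => // i x y _ <-; rewrite abszM.
have dd0 i : dd 0 i != 0.
  apply: contraNneq dM => e; rewrite -absz_eq0 dE.
  by rewrite (bigD1 i) //= e mul0n.
rewrite dE.
apply: (@idx_map _ _ (fun v => v *m invmx R) _ _ _ _ _ _ _ _ _ (idx_diag dd0)).
- split; first by exists 0; rewrite mul0mx.
  by move=> _ _ [u ->] [w ->]; exists (u - w); rewrite mulmxBl.
- by [].
- move=> y _; exists (y *m R) => //; exists 0.
  by rewrite mulmxK // subrr mul0mx.
- move=> x y _ _; rewrite -mulmxBl; split=> -[u e].
    by exists (u *m L); rewrite e E !mulmxA mulmxK.
  exists (u *m invmx L); rewrite E !mulmxA mulmxKV // -e mulmxKV //.
Qed.

End IntMatrixIndex.

Section IntClosure.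
Variable K : fieldType.

Lemma int_multiple (q : {poly int}) (x : K) : q != 0 ->
  root (map_poly intr q) x -> (lead_coef q)%:~R * x \in int_closure K.
Proof.
move=> q0 rq; set l := lead_coef q; set k := (size q).-1.
have szq : size q = k.+1 by rewrite /k prednK // size_poly_gt0.
have qk : q`_k = l by [].
have hq : \sum_(i < k.+1) (q`_i)%:~R * x ^+ i = 0.
  have := rootP rq; rewrite (@horner_coef_wide _ k.+1); last first.
    by rewrite -szq; apply: size_poly.
  by move=> e; rewrite -[RHS]e; apply: eq_bigr => i _; rewrite coef_map.
case: (posnP k) => [k0|kgt0].
  have e : q = (q`_0)%:P by apply: size1_polyC; rewrite szq k0.
  have := rootP rq; rewrite e map_polyC hornerC -[q`_0]lead_coefC -e /= => ->.
  by rewrite mul0r rpred0.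
(* P below is l^(k-1) q(X / l), monic with root l x. Its top coefficient is l / l = 1, which
   truncated subtraction in the exponent would miss; hence the case distinction. *)
pose c i : int := if i == k then 1 else q`_i * l ^+ (k.-1 - i).
pose P : {poly K} := \poly_(i < k.+1) (c i)%:~R.
have szP : size P = k.+1.
  by rewrite size_poly_eq // /c eqxx rmorph1 oner_eq0.
apply: (@int_closure_trans _ P).
- by rewrite monicE lead_coefE szP coef_poly ltnSn /c eqxx.
- move=> y /(nthP 0) [i]; rewrite szP => ik <-.
  by rewrite coef_poly ik; apply: rpred_int.
- apply/rootP; rewrite horner_poly.
  transitivity (l%:~R ^+ k.-1 * \sum_(i < k.+1) (q`_i)%:~R * x ^+ i); last first.
    by rewrite hq mulr0.
  rewrite mulr_sumr; apply: eq_bigr => i _.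
  rewrite /c exprMn; case: eqP => [ik|/eqP ik].
    rewrite ik qk rmorph1 mul1r mulrA; congr (_ * _).
    by rewrite -exprSr prednK.
  rewrite rmorphM rmorphXn /= -mulrA [_ ^+ (_ - _) * _]mulrA -exprD subnK.
    by rewrite mulrCA.
  by rewrite -ltnS prednK // ltn_neqAle ik -ltnS ltn_ord.
Qed.

Lemma int_closure_det N (A : 'M[K]_N) :
  (forall i j, A i j \in int_closure K) -> \det A \in int_closure K.
Proof.
move=> iA; apply: rpred_sum => s _; apply: rpredM; first by apply: rpredX; rewrite rpredN1.
by apply: rpred_prod => i _.
Qed.

End IntClosure.

Lemma int_closure_norm (F : fieldType) (E : fieldExtType F) (s : {rmorphism F -> algC}) x :
  x \in int_closure E -> ext_norm x \in int_closure F.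
Proof.
move=> ix; have [sig sigP] := embeddings_exist E s.
rewrite -(int_closure_rmorphE s) (emb_norm sigP).
by apply: rpred_prod => i _; rewrite int_closure_rmorphE.
Qed.

Lemma int_closure_trace_det (F : fieldType) (E : fieldExtType F)
    (s : {rmorphism F -> algC}) (g e : (\dim {:E}).-tuple E) :
  {subset g <= int_closure E} -> {subset e <= int_closure E} ->
  trace_det g e \in int_closure F.
Proof.
move=> ig ie; have [sig sigP] := embeddings_exist E s.
rewrite -(int_closure_rmorphE s) (emb_trace_det sigP).
by apply: rpredM; apply: int_closure_det => i j;
   rewrite mxE int_closure_rmorphE; [apply: ig|apply: ie]; apply: mem_tnth.
Qed.

(** Frees the norm from its basis: [ext_norm] is computed in [vbasis], while [nf_idx] needs it in an
    integral basis. *)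
Lemma det_mult_matrix (F : fieldType) (E : fieldExtType F) (s : {rmorphism F -> algC})
    (e : (\dim {:E}).-tuple E) (A : 'M[F]_(\dim {:E})) x :
  basis_of {:E} e -> (forall j, x * tnth e j = \sum_k A j k *: tnth e k) ->
  \det A = ext_norm x.
Proof.
move=> be Ax; have [sig sigP] := embeddings_exist E s.
apply: (fmorph_inj s); rewrite (emb_norm sigP).
have V0 := emb_mx_unit sigP be.
apply: (mulfI V0); rewrite -det_map_mx -[X in _ * X = _]det_tr -det_mulmx.
have -> : emb_mx sig e *m (map_mx s A)^T = diag_mx (\row_i sig i x) *m emb_mx sig e.
  apply/matrixP => i j; rewrite mul_diag_mx !mxE -rmorphM Ax rmorph_sum.
  by apply: eq_bigr => k _; rewrite !mxE (emb_scale sigP) mulrC.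
rewrite det_mulmx mulrC det_diag; congr (_ * _).
by apply: eq_bigr => i _; rewrite mxE.
Qed.

(** The cofactors along column i involve the other columns only, so they are those of the identity
    matrix. *)
Lemma det_replace_col (R : comNzRingType) n (P : 'M[R]_n) i :
  (forall k j, j != i -> P k j = (k == j)%:R) -> \det P = P i i.
Proof.
move=> HP; rewrite (expand_det_col _ i).
have adj1 : \adj (1%:M : 'M[R]_n) = 1%:M.
  by have := mul_adj_mx (1%:M : 'M[R]_n); rewrite mulmx1 det1.
transitivity ((\adj (1%:M : 'M[R]_n) *m P) i i); last by rewrite adj1 mul1mx.
rewrite mxE; apply: eq_bigr => k _; rewrite mxE mulrC; congr (_ * _).
rewrite /cofactor; congr (_ * \det _); apply/matrixP => a b; rewrite !mxE.
by rewrite HP // eq_sym neq_lift.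
Qed.

Section NumberField.
Variable E : fieldExtType rat.
Local Notation n := (\dim {:E}).
Let s : {rmorphism rat -> algC} := ratr.

Lemma nf_multiple (x : E) : exists2 c : int, c != 0 & c%:~R * x \in int_closure E.
Proof.
have [sig sigP] := embeddings_exist E s.
have [q [a a0 Dp]] := rat_poly_scale (char_poly (mul_mx x)).
have p0 : char_poly (mul_mx x) != 0 by rewrite monic_neq0 // char_poly_monic.
have q0 : q != 0.
  by apply: contra_neq p0 => q0; rewrite Dp q0 rmorph0 scaler0.
exists (lead_coef q); first by rewrite lead_coef_eq0.
apply: int_multiple => //.
have n0 : (0 < n)%N by rewrite adim_gt0.
rewrite -(fmorph_root (sig (Ordinal n0))).
have : root (map_poly s (char_poly (mul_mx x))) (sig (Ordinal n0) x).
  rewrite (emb_charpoly sigP); apply/rootP.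
  by rewrite horner_prod (bigD1 (Ordinal n0)) //= !hornerE subrr mul0r.
rewrite Dp linearZ /= rootZ ?fmorph_eq0 ?invr_eq0 ?intr_eq0 //.
rewrite -!map_poly_comp; congr (root _ _).
by apply: eq_map_poly => c; rewrite /= !rmorph_int.
Qed.

Lemma nf_integral_basis_exists : exists e : n.-tuple E,
  basis_of {:E} e /\ {subset e <= int_closure E}.
Proof.
have [sig sigP] := embeddings_exist E s.
have /choice [c cP] : forall x : E, exists c : int,
    c != 0 /\ c%:~R * x \in int_closure E.
  by move=> x; have [c c0 cx] := nf_multiple x; exists c.
pose v := vbasis {:E}.
exists [tuple (c (tnth v i))%:~R * tnth v i | i < n]; split; last first.
  by move=> _ /mapP [i _ ->]; have [_] := cP (tnth v i).
apply: (emb_basis sigP).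
have -> : emb_mx sig [tuple (c (tnth v i))%:~R * tnth v i | i < n] =
    emb_mx sig v *m diag_mx (\row_i (c (tnth v i))%:~R).
  rewrite mul_mx_diag; apply/matrixP => i j; rewrite !mxE tnth_mktuple.
  by rewrite rmorphM rmorph_int mulrC.
rewrite det_mulmx det_diag mulf_neq0 ?(emb_mx_unit sigP (vbasisP _)) //.
apply/prodf_neq0 => i _; rewrite mxE intr_eq0.
by have [] := cP (tnth v i).
Qed.

(* An integral basis whose discriminant is minimal in absolute value generates
   all the integers. *)
Lemma nf_integral_basis : exists e : n.-tuple E,
  [/\ basis_of {:E} e, {subset e <= int_closure E} &
      forall x i, x \in int_closure E -> coord e i x \is a Num.int].
Proof.
have [sig sigP] := embeddings_exist E s.
have discZ (e : n.-tuple E) : {subset e <= int_closure E} ->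
    exists k : int, basis_disc e = k%:~R.
  move=> ie; have [k] := int_closure_rat (int_closure_trace_det s ie ie).
  by exists k.
pose Q m := `[< exists e : n.-tuple E, [/\ basis_of {:E} e, {subset e <= int_closure E}
  & exists2 k : int, basis_disc e = k%:~R & `|k|%N = m] >].
have exQ : exists m, Q m.
  have [e [be ie]] := nf_integral_basis_exists; have [k dk] := discZ e ie.
  by exists `|k|%N; apply/asboolP; exists e; split=> //; exists k.
have [m /asboolP [e [be ie [k dk km]]] min] := ex_minnP exQ.
exists e; split=> // x i ix; apply: contrapT => /negP nint.
(* If the fractional part f of a coordinate is nonzero, replacing e_i by y multiplies the
   discriminant by f^2 < 1, against minimality. *)
pose c := coord e i x; pose f := c - (Num.floor c)%:~R.
have f0 : 0 < f < 1.
  rewrite /f; have /andP [le lt] := floor_itv c.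
  rewrite subr_gt0 ltrBlDl -[1 in X in _ && X](rmorph1 (intr : {rmorphism int -> rat})) -rmorphD /= lt andbT.
  rewrite lt_neqAle le andbT; apply: contraNneq nint => e'.
  by rewrite -/c -e' intr_int.
pose y := x - (Num.floor c)%:~R * tnth e i.
have iy : y \in int_closure E.
  by rewrite rpredB // rpredM ?rpred_int // ie // mem_tnth.
pose g := [tuple if j == i then y else tnth e j | j < n].
have ig : {subset g <= int_closure E}.
  by move=> _ /mapP [j _ ->]; case: eqP => // _; rewrite ie // mem_tnth.
have dg : \det (emb_mx sig g) = s f * \det (emb_mx sig e).
  pose P : 'M[algC]_n := \matrix_(l, j) if j == i then s (coord e l y) else (l == j)%:R.
  have -> : emb_mx sig g = emb_mx sig e *m P.
    apply/matrixP => a j; rewrite !mxE tnth_mktuple; case: eqP => [->|/eqP ji].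
      rewrite {1}[y](basis_tnth _ be) rmorph_sum; apply: eq_bigr => l _.
      by rewrite !mxE eqxx (emb_scale sigP) mulrC.
    rewrite (bigD1 j) //= !mxE (negPf ji) eqxx mulr1 big1 ?addr0 // => l lj.
    by rewrite !mxE (negPf ji) (negPf lj) mulr0.
  rewrite det_mulmx mulrC (@det_replace_col _ _ P i); last first.
    by move=> l j ji; rewrite mxE (negPf ji).
  rewrite mxE eqxx; congr (s _ * _).
  rewrite /y /f linearB /= -/c; congr (_ - _).
  rewrite -[_%:~R * _](_ : ((Num.floor c)%:~R : rat) *: tnth e i = _); last first.
    by rewrite scaler_int mulrzl.
  rewrite linearZ /= (tnth_nth 0) coord_free ?(basis_free be) // eqxx.
  by rewrite mulr1.
have [k' dk'] := discZ g ig.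
have ddg : basis_disc g = f ^+ 2 * basis_disc e.
  by apply: (fmorph_inj s); rewrite rmorphM rmorphXn /= !(emb_disc sigP) dg exprMn.
have f_neq0 : f != 0 by case/andP: f0 => /lt0r_neq0.
have bg : basis_of {:E} g.
  by apply/(disc_neq0 sigP); rewrite ddg mulf_neq0 ?expf_neq0 // (disc_neq0 sigP _).1.
have := min `|k'|%N; rewrite -km => /(_ _) H.
have : (`|k| <= `|k'|)%N by apply: H; apply/asboolP; exists g; split=> //; exists k'.
rewrite leqNgt; case/negP.
have k0 : k != 0 by rewrite -(intr_eq0 rat) -dk; apply/(disc_neq0 sigP).
rewrite -ltz_nat !abszE -(ltr_int rat) !intr_norm -dk' -dk ddg normrM.
rewrite gtr_pMl ?normr_gt0 ?dk ?intr_eq0 // normrX.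
have /andP [f_gt0 f_lt1] := f0.
by rewrite gtr0_norm // exprn_ilt1 // ltW.
Qed.

(** A finite family generating the integers over Z; independence is not part of the notion. *)
Definition Zbasis (K : fieldType) N (b : 'I_N -> 'O_K) :=
  forall x : 'O_K, exists c : 'I_N -> int, x = \sum_i (c i)%:~R * b i.

Lemma val_sumO (K : fieldType) (I : finType) (F : I -> 'O_K) :
  val (\sum_i F i) = \sum_i val (F i).
Proof. exact: raddf_sum. Qed.

Lemma nf_Zbasis : exists N (b : 'I_N -> 'O_E), Zbasis b.
Proof.
have [e [be ie inte]] := nf_integral_basis.
exists n, (fun i => IntRing (ie _ (mem_tnth i e))) => x.
have /choice [c cP] : forall i, exists c : int, coord e i (val x) = c%:~R.
  by move=> i; have /intrP := inte (val x) i (int_ring_valP x).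
exists c; apply: val_inj; rewrite val_sumO [val x in LHS](basis_tnth _ be).
by apply: eq_bigr => i _; rewrite cP rmorphM rmorph_int /= scaler_int mulrzl.
Qed.

(** In coordinates on an integral basis, the ideal of d is the row lattice of the matrix of
    multiplication by d, whose determinant is the norm of d. *)
Lemma nf_idx (d : 'O_E) (k : int) : ext_norm (val d) = k%:~R -> d <> 0 ->
  has_index setT (principal d) `|k|%N.
Proof.
move=> Nk d0.
have [sig sigP] := embeddings_exist E s.
have [e [be ie inte]] := nf_integral_basis.
pose b i : 'O_E := IntRing (ie _ (mem_tnth i e)).
have /choice [C CP] : forall x : 'O_E, exists c : 'rV[int]_n,
     forall i, coord e i (val x) = (c 0 i)%:~R.
  move=> x; have /choice [c cP] : forall i, exists c : int, coord e i (val x) = c%:~R.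
    by move=> i; have /intrP := inte (val x) i (int_ring_valP x).
  by exists (\row_i c i) => i; rewrite mxE.
pose D (v : 'rV[int]_n) : 'O_E := \sum_i (v 0 i)%:~R * b i.
have valD v : val (D v) = \sum_i (v 0 i)%:~R *: tnth e i.
  by rewrite val_sumO; apply: eq_bigr => i _; rewrite rmorphM rmorph_int /= scaler_int mulrzl.
have DK v : C (D v) = v.
  apply/rowP => i; apply/eqP; rewrite -(eqr_int rat) -CP valD; apply/eqP.
  rewrite -[RHS](coord_sum_free (fun j => (v 0 j)%:~R) i (basis_free be)).
  by congr coord; apply: eq_bigr => j _; rewrite (tnth_nth 0).
have CK x : D (C x) = x.
  apply: val_inj; rewrite valD [RHS](basis_tnth _ be).
  by apply: eq_bigr => i _; rewrite CP.
have CB x y : C (x - y) = C x - C y.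
  apply/rowP => i; apply/eqP; rewrite -(eqr_int rat) -CP.
  have -> : val (x - y) = val x - val y by [].
  by rewrite linearB /= !CP !mxE -rmorphB.
pose M : 'M[int]_n := \matrix_(i, j) C (d * b i) 0 j.
have detM : \det M = k.
  apply/eqP; rewrite -(eqr_int rat) -Nk -det_map_mx; apply/eqP.
  apply: (det_mult_matrix s be) => j.
  rewrite -[LHS]/(val (d * b j)) [LHS](basis_tnth _ be).
  by apply: eq_bigr => l _; rewrite !mxE CP.
have CM u : C (d * D u) = u *m M.
  rewrite -[RHS]DK; congr C; rewrite mulr_sumr /D.
  transitivity (\sum_i (u 0 i)%:~R * D (C (d * b i))).
    by apply: eq_bigr => i _; rewrite CK mulrCA.
  rewrite /D; under eq_bigr => i _ do rewrite mulr_sumr.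
  rewrite exchange_big; apply: eq_bigr => j _; rewrite mxE rmorph_sum mulr_suml.
  by apply: eq_bigr => i _; rewrite rmorphM /= -mulrA !mxE.
have k0 : k != 0.
  apply/eqP => k0; apply: d0; apply: val_inj; rewrite /=.
  by apply: (emb_norm_eq0 sigP); rewrite Nk k0.
rewrite -detM in k0 *.
apply: (@idx_map _ _ C _ _ _ _ _ _ _ _ _ (idx_mx k0)).
- split; first by exists 0; rewrite mul0mx.
  by move=> _ _ [u ->] [w ->]; exists (u - w); rewrite mulmxBl.
- by [].
- by move=> y _; exists (D y) => //; exists 0; rewrite DK subrr mul0mx.
- move=> x y _ _; rewrite -CB; split=> [[z ->]|[u e']].
    by exists (C z); rewrite -CM CK.
  by exists (D u); rewrite -[LHS]CK e' -CM CK.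
Qed.

Lemma nf_norm_int (d : 'O_E) : exists k : int, ext_norm (val d) = k%:~R.
Proof. by apply: int_closure_rat; apply/(int_closure_norm s)/int_ring_valP. Qed.

Lemma nf_finite_quotients (d : 'O_E) : d <> 0 -> exists k, has_index setT (principal d) k.
Proof. by move=> d0; have [k Nk] := nf_norm_int d; exists `|k|%N; apply: nf_idx. Qed.

End NumberField.

(** For complete integral closedness, put y = a / b and suppose that all c y^n are integers: two of
    them agree modulo c, so y is a root of X^j - X^i - w with i < j and w integral. *)
Lemma intO_dedekind (K : fieldType) :
  (forall d : 'O_K, d <> 0 -> exists k, has_index setT (principal d) k) -> dedekind_like 'O_K.
Proof.
move=> fin; split=> //.
  move=> x y /(congr1 val) /= /eqP; rewrite mulf_eq0 => /orP [] /eqP e; [left|right];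
  exact: val_inj.
move=> a b c b0 c0 /choice [z zP].
have vb0 : val b != 0.
  by apply/eqP => e; apply: b0; apply: val_inj.
have vc0 : val c != 0.
  by apply/eqP => e; apply: c0; apply: val_inj.
pose y := val a / val b.
have zE i : val (z i) = val c * y ^+ i.
  have := congr1 val (zP i); rewrite !rmorphM !rmorphXn /= => e.
  apply: (mulfI (expf_neq0 i vb0)); rewrite -e mulrCA -exprMn /y.
  by rewrite [_ * (_ / _)]mulrC mulfVK.
have [k idk] := fin c c0.
have [i [j [ij [w e]]]] := idx_pigeon z idk.
have ew : y ^+ j - y ^+ i = val w.
  apply: (mulfI vc0); rewrite mulrBr -!zE -[RHS]/(val (c * w)) -e.
  by rewrite raddfB.
have iy : y \in int_closure K.
  pose p := 'X^j - ('X^i + (val w)%:P).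
  have szl : (size ('X^i + (val w)%:P)%R <= j)%N.
    apply: leq_trans (size_polyD _ _) _; rewrite geq_max size_polyXn ij.
    by apply: leq_trans (size_polyC_leq1 _) _; case: (j) ij.
  have szp : (size ('X^i + (val w)%:P)%R < size ('X^j : {poly K}))%N by rewrite size_polyXn.
  apply: (@int_closure_trans _ p).
  - by rewrite monicE /p lead_coefDl ?size_polyN // lead_coefXn.
  - move=> u /(nthP 0) [l _ <-].
    rewrite coefB coefD !coefXn coefC rpredB ?rpredD ?rpred_nat //.
    by case: ifP => // _; [exact: int_ring_valP|rewrite rpred0].
  - by rewrite /root !hornerE -ew; apply/eqP; ring.
exists (IntRing iy); apply: val_inj; rewrite rmorphM /= /y mulrC mulfVK //.
Qed.

Lemma nf_dedekind (E : fieldExtType rat) : dedekind_like 'O_E.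
Proof. exact/intO_dedekind/nf_finite_quotients. Qed.

Section Tower.
Variables (K : fieldExtType rat) (L : fieldExtType K).

(** [int_ring] sees only the field structure, so L may be regarded as an extension of the
    rationals. *)
Lemma ext_dedekind : dedekind_like 'O_L.
Proof. exact: (nf_dedekind (baseFieldType L)). Qed.

Lemma ext_Zbasis : exists N (b : 'I_N -> 'O_L), Zbasis b.
Proof. exact: (nf_Zbasis (baseFieldType L)). Qed.

Lemma ext_multiple (x : L) : exists2 c : int, c != 0 & c%:~R * x \in int_closure L.
Proof. exact: (@nf_multiple (baseFieldType L) x). Qed.

End Tower.

(** * Modules with an action of a root of unity *)

Lemma iter_order_dvdn (X : finType) (f : X -> X) k x :
  injective f -> iter k f x = x -> (fingraph.order f x %| k)%N.
Proof.
move=> fI; rewrite (divn_eq k (fingraph.order f x)) addnC iterD.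
have -> : iter (k %/ fingraph.order f x * fingraph.order f x) f x = x.
  elim: (k %/ _)%N => // q IH; rewrite mulSn iterD IH; exact: fingraph.iter_order.
move=> e; have lt : (k %% fingraph.order f x < fingraph.order f x)%N by rewrite ltn_mod fingraph.order_gt0.
have := findex_iter lt; rewrite e findex0 => <-.
by rewrite add0n dvdn_mull.
Qed.

(** Away from x0 the length of an orbit divides 2^(e+1) but not 2^e, so it equals 2^(e+1), and the
    complement of x0 is a union of such orbits. *)
Lemma card_free_action (X : finType) (f : X -> X) x0 e :
  (forall x, iter (2 ^ e.+1) f x = x) -> f x0 = x0 ->
  (forall x, iter (2 ^ e) f x = x -> x = x0) -> (2 ^ e.+1 %| #|X|.-1)%N.
Proof.
move=> f1 fx0 free.
have fI : injective f.
  apply: (can_inj (g := iter (2 ^ e.+1).-1 f)) => x.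
  by rewrite -iterSr prednK ?expn_gt0.
have ord x : x != x0 -> fingraph.order f x = (2 ^ e.+1)%N.
  move=> xx0; have := iter_order_dvdn fI (f1 x).
  move=> /(dvdn_pfactor _ _ (isT : prime 2)) [l le ol].
  rewrite ol; congr (2 ^ _)%N; apply/eqP; rewrite eqn_leq le ltnNge.
  apply: contra xx0 => le'; apply/eqP/free.
  have : (fingraph.order f x %| 2 ^ e)%N by rewrite ol dvdn_exp2l.
  move=> /dvdnP [q ->]; elim: q => // q IH; rewrite mulSn iterD IH.
  exact: fingraph.iter_order.
have cX : (#|X|.-1 = #|predC1 x0|)%N by rewrite cardC1.
have sub : predC1 x0 \subset order_set f (2 ^ e.+1)%N.
  by apply/fintype.subsetP => x; rewrite !inE => /ord ->.
have cl : fclosed f (predC1 x0).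
  apply: (intro_closed (fconnect_sym fI)) => x y /eqP <-; rewrite !inE.
  by apply: contra => /eqP fx; apply/eqP/fI; rewrite fx fx0.
by rewrite cX -(fcard_order_set fI sub cl) dvdn_mull.
Qed.

(* Multiplication by a root of X^2 - t X - u on R[X]/(X^2 - t X - u). *)
Definition quad_act (R : comNzRingType) (t u : R) (p : R * R) : R * R :=
  (u * p.2, p.1 + t * p.2).

Lemma idx_square_mod (R : comNzRingType) (A : set R) a (t u : R) e :
  is_ideal A -> has_index setT A a -> (exists w, A (1 - 2%:R * w)) ->
  (forall p, iter (2 ^ e) (quad_act t u) p = (- p.1, - p.2)) ->
  (2 ^ e.+1 %| (a * a).-1)%N.
Proof.
move=> iA idA [w Aw] TN.
have [A0 AD AM] := iA.
have [X [f [fs fk <-]]] := idx_prod idA.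
have fE p q : A (p.1 - q.1) -> A (p.2 - q.2) -> f p = f q.
  by move=> h1 h2; apply/fk.
have fE' p q : f p = f q -> A (p.1 - q.1) /\ A (p.2 - q.2).
  by move=> /fk; apply.
have /choice [r rP] : forall x, exists p, f p = x.
  by move=> x; have [p _] := fs x; exists p.
pose T := quad_act t u.
pose g x := f (T (r x)).
have gf p : g (f p) = f (T p).
  have [h1 h2] := fE' _ _ (rP (f p)).
  apply: fE; rewrite /= -?mulrBr; first exact: AM.
  by rewrite opprD addrACA -mulrBr; apply: AD => //; apply: AM.
have giter k p : iter k g (f p) = f (iter k T p).
  by elim: k => // k IH; rewrite !iterS IH gf.
apply: (@card_free_action X g (f 0)).
- move=> x; rewrite -(rP x) giter expnS mul2n -addnn iterD !TN /= !opprK.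
  by case: (r x).
- by rewrite gf /T /quad_act /= !mulr0 addr0.
- move=> x; rewrite -(rP x) giter TN => /fE' /= [h1 h2].
  (* The power T^(2^e) = -1 fixes p modulo A only if 2p lies in A, and w inverts 2 there. *)
  have half y : A (- y - y) -> A (y - 0).
    move=> Ay; rewrite -[_ - 0](_ : y * (1 - 2%:R * w) + (- w) * (- y - y) = _); last by ring.
    by apply: AD; apply: AM.
  by apply: fE; apply: half.
Qed.

(** * Products over roots of unity and cyclotomic integers *)

Section Descent.

Definition desc1 (R : comNzRingType) (p : {poly R}) : {poly R} :=
  even_poly p ^+ 2 - 'X * odd_poly p ^+ 2.

(* desc1 p evaluated at X^2 is p(X) p(-X), so desc k p is the product of the
   p(w) over the roots w of X^(2^k) + 1. *)
Fixpoint desc (R : comNzRingType) k (p : {poly R}) : R :=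
  if k is k'.+1 then desc k' (desc1 p) else p.[-1].

Lemma map_even_poly (R C : comNzRingType) (phi : {rmorphism R -> C}) p :
  map_poly phi (even_poly p) = even_poly (map_poly phi p).
Proof. by apply/polyP => i; rewrite coef_map !coef_even_poly coef_map. Qed.

Lemma map_odd_poly (R C : comNzRingType) (phi : {rmorphism R -> C}) p :
  map_poly phi (odd_poly p) = odd_poly (map_poly phi p).
Proof. by apply/polyP => i; rewrite coef_map !coef_odd_poly coef_map. Qed.

Lemma desc_map (R C : comNzRingType) (phi : {rmorphism R -> C}) k p :
  desc k (map_poly phi p) = phi (desc k p).
Proof.
elim: k p => [|k IH] p /=.
  by rewrite -[-1](rmorphN1 phi) horner_map.
rewrite -IH; congr desc.
by rewrite /desc1 -map_even_poly -map_odd_poly !(rmorphB, rmorphXn, rmorphM) /= map_polyX.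
Qed.

Lemma desc1_horner (C : comNzRingType) (p : {poly C}) w :
  (desc1 p).[w ^+ 2] = p.[w] * p.[- w].
Proof.
rewrite -[p in RHS]poly_even_odd /desc1 !hornerE !horner_comp !hornerE sqrrN /=; ring.
Qed.

Lemma desc_prod (C : comNzRingType) k (p : {poly C}) w :
  w ^+ (2 ^ k) = -1 -> \prod_(j < 2 ^ k) p.[w ^+ (2 * j + 1)] = desc k p.
Proof.
elim: k p w => [|k IH] p w.
  by rewrite expn0 expr1 big_ord1 => ->.
move=> wk /=; rewrite -(IH _ (w ^+ 2)); last by rewrite -exprM -expnS.
under [RHS]eq_bigr => j _ do rewrite -exprM mulnC exprM desc1_horner.
rewrite big_split /= -(big_mkord xpredT (fun j => p.[w ^+ (2 * j + 1)])).
rewrite (@big_cat_nat _ _ _ (2 ^ k)%N) //=; last by rewrite leq_exp2l.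
congr (_ * _); first by rewrite big_mkord.
rewrite -{1}[(2 ^ k)%N]add0n big_addn expnS mul2n -addnn addnK big_mkord.
(* Shifting j by 2^k multiplies the root by w^(2^(k+1)) = -1. *)
apply: eq_bigr => j _; congr (_.[_]).
rewrite mulnDr -expnS addnAC exprD wk; ring.
Qed.

(** In p(X) p(-X) the term linear in u is 2^a (u(X) + u(-X)), which doubles the even part of u, and
    the quadratic term carries 2^(2a), a multiple of 2^(a+1) because a > 0. *)
Lemma desc_one_mod (k a : nat) (u : {poly int}) : (0 < a)%N ->
  exists w : int, desc k (1 + (2 ^ a)%:R *: u) = 1 + (2 ^ (a + k))%:R * w.
Proof.
elim: k a u => [|k IH] a u a0 /=.
  by exists u.[-1]; rewrite hornerD hornerC hornerZ addn0.
rewrite addnS -addSn.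
have -> : desc1 (1 + (2 ^ a)%:R *: u) = 1 + (2 ^ a.+1)%:R *:
    (even_poly u + (2 ^ a.-1)%:R *: (even_poly u ^+ 2 - 'X * odd_poly u ^+ 2)).
  rewrite /desc1 even_polyD odd_polyD even_polyZ odd_polyZ even_polyC odd_polyC.
  have -> : (2 ^ a.+1)%:R = 2%:R * (2 ^ a)%:R :> int by rewrite expnS natrM.
  have -> : (2 ^ a)%:R = 2%:R * (2 ^ a.-1)%:R :> int.
    by rewrite -natrM -expnS prednK.
  rewrite -!mul_polyC !rmorphM /= !polyC_natr; ring.
exact: IH.
Qed.

End Descent.

Section ConjugatePoly.

(** A root of P is shared with q, which is irreducible, so q divides P; the cofactor satisfies the
    same hypotheses. *)
Lemma conj_poly_pow (z : algC) (q P : {poly rat}) :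
  map_poly ratr q = minCpoly z -> q \is monic ->
  (forall p, root (map_poly ratr p) z = (q %| p)) ->
  P \is monic -> (forall b, root (map_poly ratr P) b -> root (minCpoly z) b) ->
  exists i, P = q ^+ i.
Proof.
move=> Dq mq qP; have [l] := ubnP (size P); elim: l P => // l IH P szP mP rootsP.
have q0 : q != 0 by rewrite monic_neq0.
have szq : (1 < size q)%N.
  rewrite -(size_map_poly (ratr : {rmorphism rat -> algC})) Dq.
  exact: size_minCpoly.
have [sz1|szP1] := leqP (size P) 1.
  have e := size1_polyC sz1; exists 0%N; rewrite expr0 e; congr (_%:P).
  by rewrite -[P`_0]lead_coefC -e; apply/monicP.
have /closed_rootP [b rb] : size (map_poly (ratr : rat -> algC) P) != 1%N.
  by rewrite size_map_poly neq_ltn szP1 orbT.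
have gP : gcdp P q %| P by rewrite dvdp_gcdl.
have /dvdpP [h qE] : gcdp P q %| q by rewrite dvdp_gcdr.
have g0 : gcdp P q != 0 by rewrite gcdp_eq0 (negPf q0) andbF.
have h0 : h != 0 by apply: contraNneq q0 => h0; rewrite qE h0 mul0r.
have qdP : q %| P.
  have : root (map_poly ratr q) z by rewrite Dq root_minCpoly.
  rewrite {1}qE rmorphM rootM !qP => /orP [/(dvdp_leq h0)|/dvdp_trans /(_ gP) //].
  rewrite [size q](congr1 (fun p : {poly rat} => size p) qE) size_mul // => le.
  have szg : (1 < size (gcdp P q))%N.
    rewrite -(size_map_poly (ratr : {rmorphism rat -> algC})).
    apply: (@root_size_gt1 _ b); first by rewrite map_poly_eq0.
    by rewrite gcdp_map root_gcd rb Dq rootsP.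
  have := size_poly_gt0 h; rewrite h0 => szh; exfalso.
  by move: le szg szh; set a := size _; set b' := size _; case: (a) => [|[|a']]; case: (b') => [|b'']; rewrite ?addnS ?addSn /=; lia.
have /dvdpP [P' PE] := qdP.
have mP' : P' \is monic by rewrite -(monicMr _ mq) -PE.
have [i Ei] : exists i, P' = q ^+ i.
  apply: IH => //.
    move: szP; rewrite PE size_Mmonic ?monic_neq0 //.
    have : (0 < size P')%N by rewrite size_poly_gt0 monic_neq0.
    by move: szq; lia.
  by move=> c rc; apply: rootsP; rewrite PE rmorphM rootM rc.
by exists i.+1; rewrite exprSr PE Ei.
Qed.

Lemma conj_poly_square (z : algC) (P Q : {poly rat}) :
  P \is monic -> Q \is monic -> (size Q).-1 = (2 * (size P).-1)%N ->
  (forall b, root (map_poly ratr P) b -> root (minCpoly z) b) ->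
  (forall b, root (map_poly ratr Q) b -> root (minCpoly z) b) -> Q = P ^+ 2.
Proof.
have [q [Dq mq qP]] := minCpolyP z.
move=> mP mQ sz /(conj_poly_pow (esym Dq) mq qP mP) [i Ei].
move=> /(conj_poly_pow (esym Dq) mq qP mQ) [j Ej].
move: sz; rewrite Ei Ej -exprM !size_exp.
have szq : (0 < (size q).-1)%N.
  by rewrite -ltnS prednK ?size_poly_gt0 ?monic_neq0 // -(size_map_poly (ratr : {rmorphism rat -> algC})) -Dq size_minCpoly.
by move=> /eqP; rewrite mulnCA eqn_pmul2l // mulnC => /eqP ->.
Qed.

End ConjugatePoly.

Section CyclotomicIntegers.

Lemma Aint_horner (h : {poly int}) z : z \in Aint -> (map_poly intr h).[z] \in Aint.
Proof.
move=> zA; rewrite horner_poly rpred_sum // => i _.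
by rewrite rpredM ?Aint_int // rpredX.
Qed.

Definition Zspan (w x : algC) := exists h : {poly int}, x = (map_poly intr h).[w].

Lemma ZspanD w x y : Zspan w x -> Zspan w y -> Zspan w (x + y).
Proof. by move=> [h ->] [g ->]; exists (h + g); rewrite rmorphD hornerD. Qed.

Lemma ZspanM w x y : Zspan w x -> Zspan w y -> Zspan w (x * y).
Proof. by move=> [h ->] [g ->]; exists (h * g); rewrite rmorphM hornerM. Qed.

Lemma Zspan_int w (k : int) : Zspan w k%:~R.
Proof. by exists k%:P; rewrite map_polyC hornerC. Qed.

Lemma Zspan_id w : Zspan w w.
Proof. by exists 'X; rewrite map_polyX hornerX. Qed.

Lemma ZspanX w x i : Zspan w x -> Zspan w (x ^+ i).
Proof.
by move=> [h ->]; exists (h ^+ i); rewrite rmorphXn horner_exp.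
Qed.

Lemma ZspanN w x : Zspan w x -> Zspan w (- x).
Proof. by move=> [h ->]; exists (- h); rewrite rmorphN hornerN. Qed.

Lemma Zspan_horner w x (h : {poly int}) : Zspan w x -> Zspan w (map_poly intr h).[x].
Proof.
move=> [g ->]; exists (h \Po g); rewrite map_comp_poly horner_comp; congr horner.
Qed.

Lemma Zspan_Aint w x : w \in Aint -> Zspan w x -> x \in Aint.
Proof. by move=> wA [h ->]; apply: Aint_horner. Qed.

Lemma frob_two k : exists q : {poly int}, (1 - 'X) ^+ (2 ^ k) = 1 + 'X ^+ (2 ^ k) + 2%:R * q.
Proof.
elim: k => [|k [q IH]]; first by exists (- 'X); rewrite expn0 !expr1; ring.
rewrite expnSr !exprM IH.
exists ('X ^+ (2 ^ k) + 2%:R * q ^+ 2 + 2%:R * q * (1 + 'X ^+ (2 ^ k))); ring.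
Qed.

Lemma pi_pow_two (w : algC) k : w ^+ (2 ^ k) = -1 ->
  exists2 y, Zspan w y & (1 - w) ^+ (2 ^ k) = 2%:R * y.
Proof.
move=> wk; have [q Eq] := frob_two k.
exists (map_poly intr q).[w]; first by exists q.
have := congr1 (fun p : {poly int} => (map_poly (intr : int -> algC) p).[w]) Eq.
rewrite !(rmorphXn, rmorphD, rmorphN, rmorphM, rmorph1, rmorph_nat) /= !map_polyX.
by rewrite !hornerE wk subrr add0r.
Qed.

(** Induction through w^2: 1 - w^2 = (1 - w)(1 + w), and for w^(2^(k+1)) = -1 the factor 1 + w = 1 -
    w^(2^(k+1)+1) is itself a multiple of 1 - w in Z[w]. With [pi_pow_two], 2 and (1 - w)^(2^k)
    divide each other. *)
Lemma two_pi_pow (w : algC) k : w ^+ (2 ^ k) = -1 ->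
  exists2 y, Zspan w y & 2%:R = (1 - w) ^+ (2 ^ k) * y.
Proof.
elim: k w => [|k IH] w.
  rewrite expn0 expr1 => ->; exists 1; first exact: (Zspan_int _ 1).
  by rewrite expr1 mulr1 opprK.
move=> wk; have [|y [h ->] E] := IH (w ^+ 2); first by rewrite -exprM -expnS.
have sp : Zspan w (map_poly intr h).[w ^+ 2].
  by apply: Zspan_horner; apply: ZspanX; apply: Zspan_id.
pose S := \sum_(i < (2 ^ k.+1).+1) w ^+ i.
have SZ : Zspan w S.
  rewrite /S; elim/big_ind: _ => [|a b|i _]; [exact: (Zspan_int _ 0)|exact: ZspanD|].
  by apply: ZspanX; apply: Zspan_id.
have E2 : 1 + w = (1 - w) * S.
  by have := subrXX 1 w (2 ^ k.+1).+1; rewrite expr1n exprS wk mulrN1 opprK => ->;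
     congr (_ * _); apply: eq_bigr => i _; rewrite expr1n mul1r.
exists (S ^+ (2 ^ k) * (map_poly intr h).[w ^+ 2]).
  by apply: ZspanM => //; apply: ZspanX.
rewrite E expnS mul2n -addnn exprD !mulrA; congr (_ * _).
have -> : 1 - w ^+ 2 = (1 - w) * (1 - w) * S by rewrite -mulrA -E2; ring.
by rewrite !exprMn.
Qed.

(* The prime 1 - w over 2 is totally ramified in Z[w]. *)
Lemma Zspan_half (w : algC) k (h : {poly int}) x : w ^+ (2 ^ k) = -1 -> x \in Aint ->
  2%:R * x = (map_poly intr h).[w] -> Zspan w x.
Proof.
move=> wk xA E.
have wA : w \in Aint.
  apply: (@Aint_unity_root (2 ^ k.+1)); first by rewrite expn_gt0.
  by apply/unity_rootP; rewrite expnSr exprM wk sqrrN expr1n.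
set p := 1 - w.
have pA : p \in Aint by rewrite rpredB ?Aint1.
have [y0 y0Z E0] := two_pi_pow wk; rewrite -/p in E0.
have [y1 y1Z E1] := pi_pow_two wk; rewrite -/p in E1.
have two0 : 2%:R != 0 :> algC by rewrite pnatr_eq0.
have p0 : p != 0.
  by apply: contraNneq two0 => p0; rewrite E0 p0 expr0n expn_eq0 /= mul0r.
have pZ : Zspan w p.
  by apply: ZspanD; [exact: (Zspan_int _ 1)|apply: ZspanN; apply: Zspan_id].
have y0A := Zspan_Aint wA y0Z.
(* Powers of p are gained one at a time: the constant term a of g is a multiple of p among algebraic
   integers, hence even, a = 2b, and moving p^(2^k-i-1) b out of v raises the power of p. At
   p^(2^k), a multiple of 2, the factor 2 cancels. *)
have step : forall i, (i <= 2 ^ k)%N -> forall (g : {poly int}) v, v \in Aint ->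
    p ^+ (2 ^ k - i) * (map_poly intr g).[p] = 2%:R * v -> Zspan w v.
  elim=> [|i IH] ik g v vA Ev.
    have -> : v = y1 * (map_poly intr g).[p].
      by apply: (mulfI two0); rewrite -Ev subn0 E1 mulrA.
    by apply: ZspanM => //; apply: Zspan_horner.
  have sE : (2 ^ k - i)%N = (2 ^ k - i.+1).+1 by rewrite -subSn // subSS.
  have [g1 [a Eg]] : exists g1 (a : int), g = g1 * 'X + a%:P.
    by elim/poly_ind: g {Ev} => [|g1 a _]; [exists 0, 0; rewrite mul0r addr0|exists g1, a].
  have Eg' : (map_poly intr g).[p] = (map_poly intr g1).[p] * p + a%:~R.
    by rewrite Eg rmorphD rmorphM /= map_polyX map_polyC !hornerE.
  have aE : a%:~R = p * (p ^+ i * y0 * v - (map_poly intr g1).[p]).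
    apply: (mulfI (expf_neq0 (2 ^ k - i.+1) p0)).
    have -> : p ^+ (2 ^ k - i.+1) * a%:~R = 2%:R * v - p ^+ (2 ^ k - i) * (map_poly intr g1).[p].
      by rewrite -Ev Eg' sE exprSr; ring.
    have -> : 2%:R = p ^+ (2 ^ k - i.+1) * p * p ^+ i * y0.
      by rewrite {1}E0 -exprSr -sE -exprD subnK // ltnW.
    rewrite sE exprSr; ring.
  have bA : p ^+ i * y0 * v - (map_poly intr g1).[p] \in Aint.
    by rewrite rpredB ?Aint_horner // rpredM // rpredM // rpredX.
  (* The number (a/2)^(2^k) 2^(2^k-1) = a^(2^k) / 2 is rational, and it is an algebraic integer
     because p divides a and p^(2^k) = 2 y1; so a^(2^k) is even. *)
  have [b Eb] : exists b : int, a = 2%:R * b.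
    have ev : (a%:~R / 2%:R) ^+ (2 ^ k) * 2%:R ^+ (2 ^ k).-1 \in (Num.int : qualifier 1 algC).
      apply: Cint_rat_Aint.
        by rewrite rpredM ?rpredX ?rpred_div ?rpred_int ?rpred_nat.
      have -> : (a%:~R / 2%:R) ^+ (2 ^ k) * 2%:R ^+ (2 ^ k).-1 = a%:~R ^+ (2 ^ k) / 2%:R :> algC.
        rewrite expr_div_n -mulrA; congr (_ * _).
        move: (expn_gt0 2 k) => /=; case: (2 ^ k)%N => // l _.
        by rewrite exprS invfM mulfVK // expf_neq0.
      by rewrite aE exprMn E1 mulrC !mulrA mulVf // mul1r rpredM ?rpredX // (Zspan_Aint wA y1Z).
    have /intrP [c Ec] := ev.
    have : a ^+ (2 ^ k) = 2%:R * c.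
      apply: (intr_inj (R := algC)); rewrite rmorphXn rmorphM /= rmorph_nat -Ec mulrCA.
      rewrite -exprS prednK ?expn_gt0 // expr_div_n.
      by rewrite mulfVK // expf_neq0.
    move=> ec; have : (2 %| a ^+ (2 ^ k))%Z by apply/dvdzP; exists c; rewrite ec mulrC.
    rewrite dvdzE abszX Euclid_dvdX // => /andP [d _].
    have /dvdzP [b ->] : (2 %| a)%Z by rewrite dvdzE.
    by exists b; rewrite mulrC.
  have v'E : p ^+ (2 ^ k - i) * (map_poly intr g1).[p] = 2%:R * (v - p ^+ (2 ^ k - i.+1) * b%:~R).
    rewrite mulrBr -Ev Eg' Eb rmorphM rmorph_nat sE exprSr; ring.
  have : Zspan w (v - p ^+ (2 ^ k - i.+1) * b%:~R).
    apply: IH v'E; first exact: ltnW.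
    by rewrite rpredB // rpredM ?Aint_int // rpredX.
  move=> /ZspanD /(_ (ZspanM (ZspanX (2 ^ k - i.+1) pZ) (Zspan_int w b))).
  by rewrite subrK.
apply: (step (2 ^ k)%N (leqnn _) (h \Po (1 - 'X)) x xA).
have e1 : map_poly (intr : int -> algC) (1 - 'X) = 1 - 'X.
  by rewrite rmorphB /= rmorph1 map_polyX.
by rewrite subnn expr0 mul1r E map_comp_poly horner_comp e1 !hornerE /p subKr.
Qed.

Lemma prim_root_half k (w : algC) : (2 ^ k.+1).-primitive_root w -> w ^+ (2 ^ k) = -1.
Proof.
move=> pw; have : (w ^+ (2 ^ k)) ^+ 2 = 1 by rewrite -exprM -expnSr prim_expr_order.
move=> /eqP; rewrite sqrf_eq1 => /orP [/eqP e|/eqP //].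
have := eq_prim_root_expr pw (2 ^ k) 0; rewrite e expr0 eqxx.
by rewrite eqn_mod_dvd // subn0 dvdn_Pexp2l // ltnn.
Qed.

(** Induction on k. With u the automorphism w -> -w, both z + u z and (z - u z) / w are integers of
    the field of w^2, hence lie in Z[w^2]; so 2z lies in Z[w], and [Zspan_half] removes the 2. *)
Lemma cyclotomic_int k (w z : algC) (g : {poly rat}) :
  (2 ^ k.+1).-primitive_root w -> z = (map_poly ratr g).[w] -> z \in Aint ->
  Zspan w z.
Proof.
elim: k w z g => [|k IH] w z g pw zE zA.
  have w1 : w = -1 by have := prim_root_half pw; rewrite expn0 expr1.
  have /intrP [c Ec] : z \in (Num.int : qualifier 1 algC).
    apply: Cint_rat_Aint => //; rewrite zE w1 -(rmorphN1 (ratr : {rmorphism rat -> algC})) horner_map.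
    exact: Crat_rat.
  by rewrite Ec; apply: Zspan_int.
have wN := prim_root_half pw.
have w0 : w != 0 by apply: contra_eq_neq wN => ->; rewrite expr0n expn_eq0 /= eq_sym oppr_eq0 oner_eq0.
have [u uP] : exists u : {rmorphism algC -> algC}, u w = - w.
  have [|u uP] := @Qn_aut_exists (2 ^ k.+1).+1%N (2 ^ k.+2)%N.
    by rewrite coprimeXr // coprimen2 /= oddX.
  by exists u; rewrite uP; [rewrite exprSr wN mulN1r|exact: prim_expr_order].
have uz : u z = (map_poly ratr g).[- w].
  rewrite zE -horner_map uP -map_poly_comp; congr (_.[_]).
  by apply: eq_map_poly => c /=; rewrite fmorph_rat.
have uzA : u z \in Aint by rewrite Aint_aut.
have pw2 : (2 ^ k.+1).-primitive_root (w ^+ 2).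
  have := exp_prim_root pw 2; rewrite (gcdn_idPl _); last by rewrite expnS dvdn_mulr.
  by rewrite expnS mulKn.
pose E : {poly algC} := map_poly ratr (even_poly g).
pose O : {poly algC} := map_poly ratr (odd_poly g).
have gE x : (map_poly ratr g).[x] = E.[x ^+ 2] + O.[x ^+ 2] * x.
  rewrite -{1}[g]poly_even_odd rmorphD rmorphM /= !map_comp_poly !map_polyXn map_polyX.
  by rewrite !hornerE !horner_comp !hornerE.
have zE' : z = E.[w ^+ 2] + O.[w ^+ 2] * w by rewrite zE gE.
have uzE : u z = E.[w ^+ 2] - O.[w ^+ 2] * w by rewrite uz gE sqrrN mulrN.
have wA : w \in Aint by apply: Aint_prim_root pw.
have wVA : w^-1 \in Aint.
  have -> : w^-1 = - w ^+ (2 ^ k.+1).-1.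
    by apply: (mulfI w0); rewrite divff // mulrN -exprS prednK ?expn_gt0 // wN opprK.
  by rewrite rpredN rpredX.
have h1 : Zspan (w ^+ 2) (2%:R * E.[w ^+ 2]).
  apply: (IH _ _ (2%:R *: even_poly g) pw2).
    by rewrite map_polyZ hornerZ rmorph_nat.
  by have -> : 2%:R * E.[w ^+ 2] = z + u z; [rewrite {1}zE' uzE; ring|rewrite rpredD].
have h2 : Zspan (w ^+ 2) (2%:R * O.[w ^+ 2]).
  apply: (IH _ _ (2%:R *: odd_poly g) pw2).
    by rewrite map_polyZ hornerZ rmorph_nat.
  have -> : 2%:R * O.[w ^+ 2] = (z - u z) * w^-1.
    by apply: (mulIf w0); rewrite mulfVK // {1}zE' uzE; ring.
  by rewrite rpredM // rpredB.
have up x : Zspan (w ^+ 2) x -> Zspan w x.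
  by move=> [h ->]; apply: Zspan_horner; apply: ZspanX; apply: Zspan_id.
have [h Eh] : Zspan w (2%:R * z).
  have -> : 2%:R * z = 2%:R * E.[w ^+ 2] + 2%:R * O.[w ^+ 2] * w by rewrite {1}zE'; ring.
  by apply: ZspanD; [|apply: ZspanM; last exact: Zspan_id]; apply: up.
exact: Zspan_half wN zA Eh.
Qed.

End CyclotomicIntegers.

(** * Subfields of the 2-power cyclotomic field *)

Section TwoPowerCyclotomic.

Definition in_Qmu M (z : algC) := exists w (g : {poly rat}),
  (2 ^ M).-primitive_root w /\ z = (map_poly ratr g).[w].

Lemma map_ratr_aut (u : {rmorphism algC -> algC}) (g : {poly rat}) x :
  u (map_poly ratr g).[x] = (map_poly ratr g).[u x].
Proof.
rewrite -horner_map -map_poly_comp; congr (_.[_]).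
by apply: eq_map_poly => c /=; rewrite fmorph_rat.
Qed.

Lemma in_Qmu_poly M z w : in_Qmu M z -> (2 ^ M).-primitive_root w ->
  exists g : {poly rat}, z = (map_poly ratr g).[w].
Proof.
move=> [w' [g [pw' ->]]] pw; have [i ->] := prim_rootP pw (prim_expr_order pw').
exists (g \Po 'X^i); rewrite map_comp_poly horner_comp map_polyXn.
by rewrite hornerXn.
Qed.

Lemma in_Qmu_le M M' z : (M <= M')%N -> in_Qmu M z -> in_Qmu M' z.
Proof.
move=> le [w [g [pw ->]]]; have [w' pw'] := C_prim_root_exists (expn_gt0 2 M').
have : w ^+ (2 ^ M') = 1.
  by rewrite -(subnK le) expnD mulnC exprM (prim_expr_order pw) expr1n.
move=> /(prim_rootP pw') [i ->]; exists w', (g \Po 'X^i); split=> //.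
by rewrite map_comp_poly horner_comp map_polyXn hornerXn.
Qed.

Lemma Q_mu_2inf_in_Qmu z0 : Q_mu_2inf z0 -> exists M, in_Qmu M z0.
Proof.
pose G : set algC := [set z | exists M, in_Qmu M z].
suff : Q_mu_2inf `<=` G by apply.
apply: smallest_sub; last first.
  move=> x [n /unity_rootP xn]; have [w pw] := C_prim_root_exists (expn_gt0 2 n).
  have [i ->] := prim_rootP pw xn; exists n, w, 'X^i; split=> //.
  by rewrite map_polyXn hornerXn.
have common x y : G x -> G y -> exists w (g h : {poly rat}),
    [/\ G w, exists M, (2 ^ M).-primitive_root w, x = (map_poly ratr g).[w]
      & y = (map_poly ratr h).[w]].
  move=> [M1 x1] [M2 y2]; pose M := maxn M1 M2.
  have [w pw] := C_prim_root_exists (expn_gt0 2 M).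
  have [g ->] := in_Qmu_poly (in_Qmu_le (leq_maxl _ _ : M1 <= M)%N x1) pw.
  have [h ->] := in_Qmu_poly (in_Qmu_le (leq_maxr _ _ : M2 <= M)%N y2) pw.
  exists w, g, h; split=> //; last by exists M.
  by exists M, w, 'X; rewrite map_polyX hornerX.
have memG x : x \in [in G] <-> G x by rewrite -[_ \in _]/(x \in G) in_setE.
split.
- apply/memG; have [w pw] := C_prim_root_exists (expn_gt0 2 0).
  by exists 0%N, w, 1; rewrite rmorph1 hornerC.
- move=> x y /memG Gx /memG Gy; apply/memG.
  have [w [g [h [_ [M pw] -> ->]]]] := common x y Gx Gy.
  by exists M, w, (g - h); rewrite rmorphB hornerD hornerN.
- move=> x y /memG Gx /memG Gy; apply/memG.
  have [w [g [h [_ [M pw] -> ->]]]] := common x y Gx Gy.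
  set b := (map_poly ratr h).[w].
  have [->|b0] := eqVneq b 0.
    exists M, w, 0; rewrite rmorph0 horner0 invr0 mulr0; split=> //.
  have [q [Dq mq _]] := minCpolyP b.
  (* To invert b, factors X are stripped from its minimal polynomial until the constant term c is
     nonzero; then p(b) b = -c. *)
  have [r0 [q1 [r00 e]]] : exists r0 (q1 : {poly rat}),
      r0 != 0 /\ (map_poly ratr q1).[b] * b = ratr r0.
    have rb : root (map_poly ratr q) b by rewrite -Dq root_minCpoly.
    have [l] := ubnP (size q); move: (monic_neq0 mq) rb; move: {mq Dq} q.
    elim: l => // l IH p; elim/poly_ind: p => [|p c _]; first by rewrite eqxx.
    have [->|c0] := eqVneq c 0.
      rewrite polyC0 !addr0 mulf_eq0 polyX_eq0 orbF => p0.
      rewrite rmorphM /= rootM map_polyX => /orP [rp|]; last first.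
        by rewrite /root hornerX (negPf b0).
      by rewrite size_mulX // ltnS; apply: IH.
    move=> _ /rootP; rewrite rmorphD rmorphM /= map_polyX map_polyC !hornerE /= => e _.
    exists (- c), p; rewrite oppr_eq0; split=> //.
    by rewrite rmorphN; apply/eqP; rewrite -addr_eq0 e.
  have bV : b^-1 = (map_poly ratr (r0^-1 *: q1)).[b].
    rewrite map_polyZ hornerZ; apply: (mulIf b0); rewrite mulVf // -mulrA e.
    by rewrite -rmorphM /= mulVf ?rmorph1.
  exists M, w, (g * ((r0^-1 *: q1) \Po h)); split=> //.
  by rewrite rmorphM hornerM /= map_comp_poly horner_comp -/b -bV.
Qed.

(** The oddness of the cofactor is what matters: w^(5^(2^k)) = -w for w of order 2^(k+3). *)
Lemma five_pow k : exists o, (5 ^ (2 ^ k) = 1 + 2 ^ k.+2 * (2 * o + 1))%N.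
Proof.
elim: k => [|k [o E]]; first by exists 0%N.
exists (o + 2 ^ k * (2 * o + 1) ^ 2)%N.
rewrite expnSr expnM E !expnS; ring.
Qed.

Lemma iter_gcd (T : Type) (f : T -> T) x a b : iter a f x = x -> iter b f x = x ->
  iter (gcdn a b) f x = x.
Proof.
have mul n k : iter n f x = x -> iter (k * n) f x = x.
  by move=> e; elim: k => // k IH; rewrite mulSn iterD IH.
case: (posnP a) => [->|a0] ea eb; first by rewrite gcd0n.
have [u v E _] := egcdnP b a0.
have := mul _ u ea; rewrite E addnC iterD (mul _ v eb) //.
Qed.

Variables (F : fieldExtType rat) (jota : {rmorphism F -> algC}) (m : nat).
Hypotheses (dimF : \dim {:F} = (2 ^ m)%N) (muF : forall x, Q_mu_2inf (jota x)).

(** All iterates of u at x are among the 2^m conjugates of x, so the least period that is a power of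
    2 is at most 2^m. *)
Lemma aut_period (u : {rmorphism algC -> algC}) x e : iter (2 ^ e) u (jota x) = jota x ->
  iter (2 ^ m) u (jota x) = jota x.
Proof.
move=> ue.
have [sig sigP] := embeddings_exist F (ratr : {rmorphism rat -> algC}).
have [_ _ complete] := sigP.
have /choice [c cP] : forall i, exists j, iter i u (jota x) = sig j x.
  move=> i; have [v vE] : exists v : {rmorphism F -> algC}, forall y, v y = iter i u (jota y).
    elim: i => [|i [v vE]]; first by exists jota.
    by exists (u \o v : {rmorphism F -> algC}) => y; rewrite /= vE.
  have [|j vj] := complete v.
    by move=> a; rewrite alg_num_field fmorph_rat.
  by exists j; rewrite -vE vj.
have uI : forall i y z, iter i u y = iter i u z -> y = z.
  by elim=> // i IH y z; rewrite !iterS => /fmorph_inj /IH.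
have exe : exists e, iter (2 ^ e) u (jota x) == jota x by exists e; apply/eqP.
case: (ex_minnP exe) => e0 /eqP ue0 min.
have [le|lt] := leqP e0 m.
  rewrite -(subnK le) expnD; elim: (2 ^ (m - e0))%N => // l IH.
  by rewrite mulSn iterD IH.
exfalso.
pose g (i : 'I_(2 ^ e0)) := c i.
have /injectivePn [i [j ij gij]] : ~~ injectiveb g.
  apply/negP => /injectiveP /leq_card; rewrite !card_ord dimF.
  by rewrite leq_exp2l // leqNgt lt.
have key : forall a b : 'I_(2 ^ e0), (a < b)%N -> g a = g b -> False.
  move=> a b ab gab.
  have e1 : iter (b - a) u (jota x) = jota x.
    apply: (uI a); rewrite -iterD subnKC; last exact: ltnW.
    by rewrite !cP -/(g a) -/(g b) gab.
  have ug := iter_gcd e1 ue0.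
  have le : (gcdn (b - a) (2 ^ e0) <= b - a)%N.
    by rewrite dvdn_leq ?dvdn_gcdl // subn_gt0.
  have /(dvdn_pfactor _ _ (isT : prime 2)) [f _ E] := dvdn_gcdr (b - a) (2 ^ e0).
  rewrite E in ug le.
  have ef := min f (introT eqP ug).
  have : (2 ^ e0 <= b - a)%N by apply: leq_trans le; rewrite leq_exp2l.
  by rewrite leqNgt (leq_ltn_trans (leq_subr _ _) (ltn_ord b)).
case: (ltngtP i j) => [lt'|lt'|/val_inj /eqP]; last by rewrite (negPf ij).
  exact: key lt' gij.
exact: key lt' (esym gij).
Qed.



(** Let u be w -> w^5. By [aut_period], u^(2^m) fixes x, hence so does u^(2^(M-2)), which is w ->
    -w; so x is a polynomial in w^2. *)
Lemma in_Qmu_descent x M : (m.+2 <= M)%N -> in_Qmu M.+1 (jota x) -> in_Qmu M (jota x).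
Proof.
move=> mM [w [g [pw zE]]].
have wN := prim_root_half pw.
have [u uP] : exists u : {rmorphism algC -> algC}, u w = w ^+ 5.
  have [|u uP] := @Qn_aut_exists 5 (2 ^ M.+1)%N; first by rewrite coprimeXr.
  by exists u; rewrite uP // prim_expr_order.
have uk k : iter k u w = w ^+ (5 ^ k).
  elim: k => [|k IH]; first by rewrite expr1.
  by rewrite iterS IH rmorphXn /= uP -exprM expnS.
have ukz k : iter k u (jota x) = (map_poly ratr g).[w ^+ (5 ^ k)].
  rewrite zE -uk; elim: k => // k IH; by rewrite !iterS IH map_ratr_aut.
have M2 : M = (M - 2).+2 by rewrite -addn2 subnK // (leq_trans _ mM).
have um : iter (2 ^ m) u (jota x) = jota x.
  apply: (@aut_period u x M); rewrite ukz; have [o ->] := five_pow M.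
  rewrite exprD expr1 exprM -[(2 ^ M.+2)%N]/(2 ^ (1 + M.+1))%N expnD mulnC exprM.
  by rewrite (prim_expr_order pw) !expr1n mulr1 zE.
have uM : iter (2 ^ (M - 2)) u (jota x) = jota x.
  have mM2 : (m <= M - 2)%N by rewrite leq_subRL ?addn2 // (leq_trans _ mM).
  rewrite -(subnK mM2) expnD; elim: (2 ^ (_ - m))%N => // l IH.
  by rewrite mulSn iterD IH.
have zE' : jota x = (map_poly ratr g).[- w].
  rewrite -uM ukz; congr (_.[_]); have [o ->] := five_pow (M - 2).
  rewrite -M2 exprD expr1 exprM wN exprD exprM sqrrN expr1n expr1n mul1r expr1.
  by rewrite mulrN1.
exists (w ^+ 2), (even_poly g); split.
  have := exp_prim_root pw 2; rewrite (gcdn_idPl _); last by rewrite expnS dvdn_mulr.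
  by rewrite expnS mulKn.
have gE y : (map_poly ratr g).[y] =
    (map_poly ratr (even_poly g)).[y ^+ 2] + (map_poly ratr (odd_poly g)).[y ^+ 2] * y :> algC.
  rewrite -{1}[g]poly_even_odd rmorphD rmorphM /= !map_comp_poly !map_polyXn map_polyX.
  by rewrite !hornerE !horner_comp !hornerE.
have two0 : 2%:R != 0 :> algC by rewrite pnatr_eq0.
apply: (mulfI two0); rewrite mulr_natl mulr2n {1}zE zE' !gE sqrrN mulrN.
by rewrite mulr_natl mulr2n addrACA subrr addr0.
Qed.

Lemma in_Qmu_level x : in_Qmu m.+2 (jota x).
Proof.
have [M zM] := Q_mu_2inf_in_Qmu (muF x).
have [le|/ltnW le] := leqP M m.+2; first exact: in_Qmu_le zM.
rewrite -(subnKC le) in zM; elim: (M - m.+2)%N zM => [|l IH] zM.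
  by rewrite addn0 in zM.
by apply: IH; apply: in_Qmu_descent; rewrite ?leq_addr // -addnS.
Qed.

Variable w : algC.
Hypothesis pw : (2 ^ m.+2).-primitive_root w.
Local Notation N := (2 ^ m.+1)%N.

Let prim_expN : w ^+ N = -1. Proof. exact: prim_root_half. Qed.

(** Both sides are rational polynomials whose roots are conjugates of x, and the degrees are 2^(m+1)
    and twice 2^m; [conj_poly_square] decides. *)
Lemma jota_gen_conj x (g : {poly rat}) (sig : 'I_(\dim {:F}) -> {rmorphism F -> algC}) :
  is_embeddings (ratr : rat -> algC) sig ->
  jota x = (map_poly ratr g).[w] ->
  \prod_(j < N) ('X - (map_poly ratr g).[w ^+ (2 * j + 1)]%:P) =
  (\prod_i ('X - (sig i x)%:P)) ^+ 2.
Proof.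
move=> sigP xE.
pose P := char_poly (mul_mx x).
have DP : map_poly ratr P = \prod_i ('X - (sig i x)%:P).
  exact: (emb_charpoly (s := ratr) sigP).
(* The product is rational because it is [desc] of the polynomial X - g(Y) in Y, over the rational
   polynomials in X. *)
pose Q : {poly rat} := desc m.+1 ('X%:P - map_poly polyC g).
have DQ : map_poly ratr Q = \prod_(j < N) ('X - (map_poly ratr g).[w ^+ (2 * j + 1)]%:P).
  rewrite -[LHS](desc_map (map_poly (ratr : {rmorphism rat -> algC}))).
  rewrite -(@desc_prod _ m.+1 _ w%:P); last by rewrite -rmorphXn /= prim_expN rmorphN1.
  apply: eq_bigr => j _; rewrite -rmorphXn /= rmorphB /= map_polyC hornerD hornerC hornerN.
  rewrite /= map_polyX; congr (_ - _).
  rewrite -map_poly_comp -[RHS]horner_map -map_poly_comp; congr (_.[_]).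
  by apply: eq_map_poly => c; rewrite /= map_polyC.
rewrite -DQ -DP -rmorphXn; congr map_poly.
apply: (@conj_poly_square (jota x)).
- exact: char_poly_monic.
- by rewrite -(map_monic (ratr : {rmorphism rat -> algC})) DQ monic_prod_XsubC.
- rewrite -(size_map_poly (ratr : {rmorphism rat -> algC})) DQ size_char_poly dimF.
  by rewrite size_prod_XsubC /= /index_enum -enumT size_enum_ord expnS.
- move=> b; rewrite DP.
  have [q [Dq _ qP]] := minCpolyP (jota x).
  have qx : (map_poly (in_alg F) q).[x] = 0.
    apply: (fmorph_inj jota); rewrite rmorph0 -horner_map -map_poly_comp.
    have := root_minCpoly (jota x); rewrite Dq => /rootP e; rewrite -[RHS]e.
    by congr (_.[_]); apply: eq_map_poly => c; rewrite /= alg_num_field fmorph_rat.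
  rewrite (_ : \prod_i _ = \prod_(z <- [seq sig i x | i <- index_enum _]) ('X - z%:P)); last by rewrite big_map.
  rewrite root_prod_XsubC => /mapP [i _ ->].
  have := congr1 (sig i) qx; rewrite rmorph0 -horner_map -map_poly_comp => e.
  apply/rootP; rewrite Dq -[RHS]e; congr (_.[_]).
  by apply: eq_map_poly => c; rewrite /= alg_num_field fmorph_rat.
- move=> b; rewrite DQ.
  rewrite (_ : \prod_(j < N) _ = \prod_(z <- [seq (map_poly ratr g).[w ^+ (2 * (j : 'I_N) + 1)] | j <- index_enum _]) ('X - z%:P)); last by rewrite big_map.
  rewrite root_prod_XsubC => /mapP [j _ ->].
  have [|u uP] := @Qn_aut_exists (2 * j + 1)%N (2 ^ m.+2)%N.
    by rewrite coprimeXr // coprimen2 addn1 /= mul2n odd_double.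
  have -> : (map_poly ratr g).[w ^+ (2 * j + 1)] = u (jota x).
    by rewrite xE map_ratr_aut uP // prim_expr_order.
  by rewrite -(minCpoly_aut u) root_minCpoly.
Qed.

(** [jota_gen_conj] at 0 writes the square of the norm n as a product over the w^(2j+1), which is 1
    mod 2^(m+3) by [desc_one_mod]. To extract the root, n = 1 + 4n' gives n^2 - 1 = 8 n' (2n' + 1)
    with 2n' + 1 odd, so 2^m divides n'. *)
Lemma norm_one_mod4 y : y \in int_closure F ->
  exists k : int, ext_norm (1 + 4%:R * y) = (1 + (2 ^ m.+2)%:R * k)%:~R.
Proof.
move=> iy.
have [sig sigP] := embeddings_exist F (ratr : {rmorphism rat -> algC}).
have [g0 yE] := in_Qmu_poly (in_Qmu_level y) pw.
have yA : jota y \in Aint by rewrite -int_closure_Aint int_closure_rmorphE.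
have [h hE] := cyclotomic_int pw yE yA.
pose H : {poly int} := 1 + (2 ^ 2)%:R *: h.
pose g : {poly rat} := map_poly intr H.
have gi z : (map_poly ratr g).[z] = (map_poly intr H).[z] :> algC.
  rewrite -map_poly_comp; congr (_.[_]).
  by apply: eq_map_poly => c; rewrite /= rmorph_int.
have xE : jota (1 + 4%:R * y) = (map_poly ratr g).[w].
  rewrite gi rmorphD rmorph1 rmorphM rmorph_nat hE /H rmorphD rmorph1 /=.
  by rewrite map_polyZ hornerD hornerZ hornerC rmorph_nat.
have := congr1 (horner^~ 0) (jota_gen_conj sigP xE); rewrite /= horner_prod horner_exp horner_prod.
under eq_bigr => j _ do rewrite !hornerE.
under [in RHS]eq_bigr => j _ do rewrite !hornerE.
rewrite !prodrN.
have PE n (f : 'I_n -> algC) : \prod_(i in xpredT) f i = \prod_i f i by apply: eq_bigl.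
rewrite !PE exprMn -exprM mulnC exprM sqrrN !expr1n mul1r.
have -> : #|(xpredT : pred 'I_N)| = N by rewrite -[RHS]card_ord; apply: eq_card.
rewrite expnS exprM sqrrN !expr1n mul1r -(emb_norm (s := ratr) sigP) -expnS.
under eq_bigr => j _ do rewrite gi.
rewrite (desc_prod _ prim_expN) (desc_map (intr : {rmorphism int -> algC})).
have [k ->] := desc_one_mod m.+1 h (isT : (0 < 2)%N).
have ixy : 1 + 4%:R * y \in int_closure F by rewrite rpredD ?rpred1 // rpredM ?rpred_nat.
have [n nE] := int_closure_rat (int_closure_norm (ratr : {rmorphism rat -> algC}) ixy).
rewrite nE rmorph_int -rmorphXn => /intr_inj E.
have [n' n'E] : exists n' : int, n = 1 + 4%:R * n'.
  have [b bA bE] : exists2 b, b \in Aint & \prod_i sig i (1 + 4%:R * y) = 1 + 4%:R * b.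
    elim/big_ind: _ => [|_ _ [b bA ->] [c cA ->]|i _].
    - by exists 0; rewrite ?Aint0 // mulr0 addr0.
    - exists (b + c + 4%:R * b * c); last by ring.
      by apply: rpredD; [apply: rpredD|apply: rpredM => //; apply: rpredM => //; apply: rpred_nat].
    - exists (sig i y); last by rewrite rmorphD rmorph1 rmorphM rmorph_nat.
      by rewrite -int_closure_Aint int_closure_rmorphE.
  rewrite -(emb_norm (s := ratr) sigP) nE rmorph_int in bE.
  have four0 : 4%:R != 0 :> algC by rewrite pnatr_eq0.
  have bE' : b = (n%:~R - 1) / 4%:R by rewrite bE addrAC subrr add0r mulrC mulKf.
  have /intrP [c Ec] : b \in (Num.int : qualifier 1 algC).
    apply: Cint_rat_Aint => //; rewrite bE' rpred_div ?rpredB ?rpred_int ?rpred1 //.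
    exact: rpred_nat.
  exists c; apply: (intr_inj (R := algC)).
  by rewrite bE Ec rmorphD rmorph1 rmorphM rmorph_nat.
have E' : n' * (2%:R * n' + 1) = (2 ^ m)%:R * k.
  have eight0 : 8%:R != 0 :> int by [].
  apply: (mulfI eight0).
  have -> : 8%:R * ((2 ^ m)%:R * k) = (2 ^ (2 + m.+1))%:R * k :> int.
    by rewrite -addSnnS expnD natrM -mulrA.
  by apply: (addrI 1); rewrite E n'E; ring.
have : ((2 ^ m)%:R %| n')%Z.
  rewrite -(@Gauss_dvdzl _ _ (2%:R * n' + 1)).
    by rewrite E' dvdz_mulr.
  by rewrite natrX; apply: coprimezXl; apply/coprimezP; exists (- n', 1) => /=; ring.
move=> /dvdzP [c c'E]; exists c; rewrite n'E c'E; congr (_%:~R).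
by rewrite !expnS !natrM; ring.
Qed.


(* The generator theta of F takes each of its conjugates at exactly two of the
   primitive roots w^(2j+1); the two roots above theta are then the roots of a
   gcd with coefficients in F. *)
Lemma quadratic_relation : exists (t u : F) (w1 w2 : algC),
  [/\ w1 <> w2, w1 ^+ N = -1, w2 ^+ N = -1, w1 + w2 = jota t & w1 * w2 = - jota u].
Proof.
have [sig sigP] := embeddings_exist F (ratr : {rmorphism rat -> algC}).
have [_ [th _ thI] complete] := sigP.
have [i0 i0P] : exists i, jota =1 sig i.
  by apply: complete => a; rewrite alg_num_field fmorph_rat.
have [g thE] := in_Qmu_poly (in_Qmu_level th) pw.
have sq := jota_gen_conj sigP thE.
pose b (j : 'I_N) := (map_poly ratr g).[w ^+ (2 * j + 1)] : algC.
have lt2 (j : 'I_N) : (2 * j + 1 < 2 ^ m.+2)%N.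
  by have := ltn_ord j; rewrite (expnS 2 m.+1); lia.
have wI : injective (fun j : 'I_N => w ^+ (2 * j + 1)).
  move=> j l /eqP; rewrite (eq_prim_root_expr pw) !modn_small //.
  by rewrite eqn_add2r eqn_pmul2l // => /eqP /val_inj.
have wN (j : 'I_N) : (w ^+ (2 * j + 1)) ^+ N = -1.
  by rewrite -exprM mulnC exprM prim_expN exprD exprM sqrrN !expr1n mul1r expr1.
have pe : perm_eq [seq b j | j <- index_enum 'I_N]
    ([seq sig i th | i <- index_enum _] ++ [seq sig i th | i <- index_enum _]).
  apply/prod_XsubC_eq; rewrite big_cat /= !big_map -expr2 -sq.
  exact: eq_bigr.
have cnt : count_mem (jota th) [seq b j | j <- index_enum 'I_N] = 2%N.
  have /seq.permP -> := pe; rewrite count_cat i0P.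
  rewrite count_uniq_mem; last by rewrite map_inj_uniq ?index_enum_uniq.
  have -> : sig i0 th \in [seq sig i th | i <- index_enum _].
    by apply/mapP; exists i0 => //; rewrite mem_index_enum.
  by [].
pose J := [set j : 'I_N | b j == jota th]%SET.
have /eqP/cards2P [j1 [j2 [j12 EJ]]] : #|J| = 2%N.
  rewrite -[RHS]cnt count_map -sum1_count -sum1_card; apply: eq_big => // j.
  by rewrite !inE.
have inJ j : (b j == jota th) = (j == j1) || (j == j2).
  by have := congr1 (fun S : {set 'I_N} => j \in S) EJ; rewrite !inE.
pose w1 := w ^+ (2 * j1 + 1); pose w2 := w ^+ (2 * j2 + 1).
have w12 : w1 != w2 by apply: contra j12 => /eqP /wI ->.
pose Phi (R : nzRingType) : {poly R} := 'X^N + 1.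
have PhiE : Phi algC = \prod_(j <- index_enum 'I_N) ('X - (w ^+ (2 * j + 1))%:P).
  have szPhi : size (Phi algC) = N.+1.
    by rewrite /Phi size_polyDl size_polyXn // size_poly1 ltnS expn_gt0.
  have -> : \prod_(j <- index_enum 'I_N) ('X - (w ^+ (2 * j + 1))%:P) =
     \prod_(z <- [seq w ^+ (2 * (j : 'I_N) + 1) | j <- index_enum 'I_N]) ('X - z%:P).
    by rewrite big_map.
  rewrite [LHS](@all_roots_prod_XsubC _ _ [seq w ^+ (2 * (j : 'I_N) + 1) | j <- index_enum 'I_N]).
  - by rewrite /Phi lead_coefDl ?lead_coefXn ?scale1r // size_polyXn size_poly1 ltnS expn_gt0.
  - by rewrite szPhi size_map /index_enum -enumT size_enum_ord.
  - by apply/allP => _ /mapP [j _ ->]; rewrite /root /Phi !hornerE wN addNr.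
  - by rewrite uniq_rootsE map_inj_uniq ?index_enum_uniq.
pose G : {poly F} := map_poly (in_alg F) g - th%:P.
have GE : map_poly jota G = map_poly ratr g - (jota th)%:P.
  rewrite /G rmorphB /= map_polyC -map_poly_comp; congr (_ - _).
  by apply: eq_map_poly => c; rewrite /= alg_num_field fmorph_rat.
pose Ga := gcdp G (Phi F).
have Phij : map_poly jota (Phi F) = Phi algC.
  by rewrite /Phi rmorphD rmorphXn /= map_polyX rmorph1.
have GaE : map_poly jota Ga = gcdp (map_poly ratr g - (jota th)%:P) (Phi algC).
  by rewrite /Ga gcdp_map GE Phij.
have rootG (j : 'I_N) : root (map_poly ratr g - (jota th)%:P) (w ^+ (2 * j + 1)) = (b j == jota th).
  by rewrite /root hornerD hornerN hornerC subr_eq0.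
have rootPhi (j : 'I_N) : root (Phi algC) (w ^+ (2 * j + 1)).
  by rewrite /root /Phi !hornerE wN addNr.
pose D := ('X - w1%:P) * ('X - w2%:P).
have DGa : D %| map_poly jota Ga.
  have -> : D = \prod_(z <- [:: w1; w2]) ('X - z%:P).
    by rewrite !big_cons big_nil mulr1.
  apply: uniq_roots_dvdp; last by rewrite uniq_rootsE /= inE w12.
  by rewrite /= GaE !root_gcd !rootG !rootPhi !inJ !eqxx orbT.
have Ga0 : map_poly jota Ga != 0.
  by rewrite GaE gcdp_eq0 negb_and orbC PhiE monic_neq0 // monic_prod_XsubC.
have szGa : (size (map_poly jota Ga) <= 3)%N.
  have : map_poly jota Ga %| Phi algC by rewrite GaE dvdp_gcdr.
  rewrite PhiE => /dvdp_prod_XsubC [msk E].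
  rewrite (eqp_size E) size_prod_XsubC ltnS.
  have um : uniq (mask msk (index_enum 'I_N)) by rewrite mask_uniq ?index_enum_uniq.
  apply: (@uniq_leq_size _ _ [:: j1; j2]) => // j jm.
  have : root (map_poly jota Ga) (w ^+ (2 * j + 1)).
    rewrite (eqp_root E) -(big_map (fun j : 'I_N => w ^+ (2 * j + 1)) xpredT (fun z => 'X - z%:P)).
    by rewrite root_prod_XsubC; apply/mapP; exists j.
  by rewrite GaE root_gcd rootG inJ => /andP [/orP [] /eqP -> _]; rewrite !inE eqxx ?orbT.
have mD : D \is monic by rewrite monicMl monicXsubC.
have szD : size D = 3.
  by rewrite size_Mmonic ?polyXsubC_eq0 ?monicXsubC // !size_XsubC.
have DE : D %= map_poly jota Ga.
  by rewrite -dvdp_size_eqp // eqn_leq dvdp_leq //= szD.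
pose Gm := (lead_coef Ga)^-1 *: Ga.
have Ga0' : Ga != 0 by rewrite map_poly_eq0 in Ga0.
have DGm : D = map_poly jota Gm.
  apply/eqP; rewrite -eqp_monic //.
    rewrite map_polyZ (eqp_trans DE) // eqp_sym eqp_scale // fmorph_eq0 invr_eq0.
    by rewrite lead_coef_eq0.
  rewrite map_monic monicE lead_coefZ mulVf // lead_coef_eq0 //.
have cD1 : D`_1 = - (w1 + w2).
  rewrite /D mulrBl !mulrBr !coefB -!polyCM coefC !coefXM !coefMX !coefX !coefC /=.
  by rewrite -/w1; ring.
have cD0 : D`_0 = w1 * w2.
  by rewrite -horner_coef0 /D hornerM !hornerXsubC !sub0r mulrNN.
exists (- Gm`_1), (- Gm`_0), w1, w2; split.
- exact/eqP.
- exact: wN.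
- exact: wN.
- by rewrite rmorphN -coef_map -DGm cD1 opprK.
- by rewrite rmorphN -coef_map -DGm cD0 opprK.
Qed.

End TwoPowerCyclotomic.

(** * Extensions unramified at 2 *)

Section IntegerMap.

Definition omap (K K' : fieldType) (f : {rmorphism K -> K'}) (x : 'O_K) : 'O_K' :=
  IntRing (int_closure_rmorph f (int_ring_valP x)).

Variables (K K' : fieldType) (f : {rmorphism K -> K'}).

Lemma omap_zmod : zmod_morphism (omap f).
Proof. by move=> x y; apply: val_inj; rewrite /= !rmorphB. Qed.

Lemma omap_monoid : monoid_morphism (omap f).
Proof. by split=> [|x y]; apply: val_inj; rewrite /= ?rmorph1 ?rmorphM. Qed.

HB.instance Definition _ := GRing.isZmodMorphism.Build 'O_K 'O_K' (omap f) omap_zmod.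
HB.instance Definition _ := GRing.isMonoidMorphism.Build 'O_K 'O_K' (omap f) omap_monoid.

End IntegerMap.

Section DetMod.
Variable R : comNzRingType.

Lemma det_mod (I : set R) n (A B : 'M[R]_n) : is_ideal I ->
  (forall i j, I (A i j - B i j)) -> I (\det A - \det B).
Proof.
move=> iI AB; have [I0 ID IM] := iI.
rewrite /determinant -sumrB; apply: ideal_sum => // s.
rewrite -mulrBr; apply: IM.
elim/big_rec2: _ => [|i x y _ H]; first by rewrite subrr.
rewrite -[_ - _](_ : (A i (s i) - B i (s i)) * y + B i (s i) * (y - x) = _); last by ring.
by apply: ID; [apply: idealMr|apply: idealMl].
Qed.

Lemma det_one_mod (I : set R) n (M : 'M[R]_n) : is_ideal I ->
  (forall i j, I (M i j)) -> I (1 - \det (1%:M - M)).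
Proof.
move=> iI MI; rewrite -{1}(det1 R n); apply: det_mod => // i j.
by rewrite !mxE subKr.
Qed.

(** Multilinearity of the determinant, expanding one row at a time: at stage t only the first t rows
    may still be combinations. *)
Lemma det_rows_ideal (S : Type) n (h : 'I_n -> S -> R) (I : set R) (y : 'I_n -> 'I_n -> R) :
  is_ideal I -> (forall g : 'I_n -> S, I (\det (\matrix_(k, i) h i (g k)))) ->
  (forall k, exists r : seq (R * S), forall i, y k i = \sum_(p <- r) p.1 * h i p.2) ->
  I (\det (\matrix_(k, i) y k i)).
Proof.
move=> iI Ig Yy.
suff H : forall t (z : 'I_n -> 'I_n -> R),
    (forall k : 'I_n, (k < t)%N -> exists r : seq (R * S), forall i, z k i = \sum_(p <- r) p.1 * h i p.2) ->
    (forall k : 'I_n, (t <= k)%N -> exists x, forall i, z k i = h i x) ->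
    I (\det (\matrix_(k, i) z k i)).
  by apply: (H n) => [k _|k]; [exact: Yy|rewrite leqNgt ltn_ord].
elim=> [|t IH] z zY zp.
  have /choice [g gP] : forall k, exists x, forall i, z k i = h i x by move=> k; apply: zp.
  have -> : (\matrix_(k, i) z k i) = \matrix_(k, i) h i (g k).
    by apply/matrixP => k i; rewrite !mxE gP.
  exact: Ig.
have [tn|nt] := ltnP t n; last first.
  apply: IH => k kt; first by apply: zY; rewrite ltnS ltnW.
  by have := leq_trans (ltn_ord k) (leq_trans nt kt); rewrite ltnn.
pose k0 := Ordinal tn.
have [r rE] := zY k0 (ltnSn t).
pose zr x k i := if k == k0 then h i x else z k i.
have zrE x : \det (\matrix_(k, i) zr x k i) =
    \sum_i h i x * cofactor (\matrix_(k, i) z k i) k0 i.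
  rewrite (expand_det_row _ k0); apply: eq_bigr => i _.
  rewrite mxE /zr eqxx; congr (_ * (_ * \det _)).
  by apply/matrixP => a b; rewrite !mxE eq_sym (negPf (neq_lift _ _)).
have -> : \det (\matrix_(k, i) z k i) = \sum_(p <- r) p.1 * \det (\matrix_(k, i) zr p.2 k i).
  rewrite (expand_det_row _ k0).
  under eq_bigr => i _ do rewrite mxE rE mulr_suml.
  rewrite exchange_big; apply: eq_bigr => p _.
  by rewrite zrE mulr_sumr; apply: eq_bigr => i _; rewrite mulrA.
apply: ideal_sum => // p; apply: idealMl => //; apply: IH => k kt.
  rewrite /zr; case: eqP => [kk|_]; last by apply: zY; rewrite ltnS ltnW.
  by move: kt; rewrite kk ltnn.
rewrite /zr; case: eqP => [_|/eqP kk]; first by exists p.2.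
apply: zp; rewrite ltn_neqAle kt andbT; apply: contra kk => /eqP e.
by apply/eqP/val_inj.
Qed.

End DetMod.

Section Unramified.
Variables (K : fieldExtType rat) (L : fieldExtType K).
Local Notation n := (\dim {:L}).
Variable s : {rmorphism K -> algC}.
Variable sig : 'I_n -> {rmorphism L -> algC}.
Hypothesis sigP : is_embeddings s sig.
Let ded_K : dedekind_like 'O_K := nf_dedekind K.
Let ded_L : dedekind_like 'O_L := ext_dedekind L.

Lemma intO_natr_neq0 (E : fieldType) (f : {rmorphism E -> algC}) k :
  (k.+1%:R : 'O_E) <> 0.
Proof.
move=> /(congr1 (omap f)); rewrite rmorph_nat rmorph0 => /(congr1 val).
by rewrite rmorph_nat /= => /eqP; rewrite pnatr_eq0.
Qed.

Let emb : 'O_K -> 'O_L := omap (in_alg L).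

Variable P : set 'O_K.
Hypotheses (primeP : is_prime_ideal P) (P2 : P 2%:R).
Hypothesis unram : unramified_prime L P.
Local Notation B := (ext_ideal (L := L) P).

Let n_gt0 : (0 < n)%N. Proof. exact: adim_gt0. Qed.
Let sig0 : {rmorphism L -> algC} := sig (Ordinal n_gt0).

Let twoK : (2%:R : 'O_K) <> 0. Proof. exact: (intO_natr_neq0 s). Qed.
Let twoL : (2%:R : 'O_L) <> 0. Proof. exact: (intO_natr_neq0 sig0). Qed.

Let iB : is_ideal B. Proof. exact: ideal_gen_ideal. Qed.

Lemma ext_ideal_mem a : P a -> B (emb a).
Proof. by move=> Pa; apply: ideal_gen_mem; exists a. Qed.

Let B2 : B 2%:R.
Proof. by have := ext_ideal_mem P2; rewrite /emb rmorph_nat. Qed.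

(** If y^2 is in B, put J = B + (y) and C = (B : J), so that B = J C. If y is not in B, then C lies
    in a maximal ideal Q; as y is in C, J lies in Q too, so B lies in Q^2, against ramification
    index 1. *)
Lemma unram_reduced y : B (y ^+ 2) -> B y.
Proof.
move=> By2; apply: contrapT => By.
pose J := ideal_add B (principal y).
have iJ : is_ideal J by apply: ideal_add_ideal => //; apply: ideal_principal.
have BJ : B `<=` J by apply: ideal_add_l; apply: ideal_principal.
have Jy : J y by apply: ideal_add_r => //; apply: principal_mem.
pose C := ideal_quo J B.
have iC : is_ideal C by apply: ideal_quo_ideal.
have BE := ded_contains_divides ded_L iJ iB (BJ _ B2) twoL BJ.
have BC : B `<=` C by move=> c Bc z _; exact: (idealMl z iB Bc).
have C1 : ~ C 1 by move=> /(_ y Jy); rewrite mulr1.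
have [Q maxQ CQ] := ded_maximal ded_L iC (BC _ B2) twoL C1.
have primeQ := maximal_prime maxQ; have [iQ Q1 _] := maxQ.
have above : ideal_above P Q.
  move=> a b ab; have -> : b = emb a by apply: val_inj; rewrite ab; reflexivity.
  split=> [Qa|Pa]; last by apply: CQ; apply: BC; exact: ext_ideal_mem.
  apply: contrapT => Pa.
  have [z Pz] := maximal_inv (prime_maximal ded_K primeP P2 twoK) Pa.
  apply: Q1; have /CQ Q1z := BC _ (ext_ideal_mem Pz).
  rewrite -[1](subrK (emb (a * z))); have [_ QD _] := iQ; apply: QD.
    by move: Q1z; rewrite /emb rmorphB rmorph1.
  by rewrite /emb rmorphM; apply: idealMr.
have [_] := unram primeQ above; apply.
have -> : ideal_exp Q 2 = ideal_mul Q Q by rewrite /ideal_exp /= ideal_mul1.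
have JQ : J `<=` Q.
  apply: ideal_add_sub => //; first by move=> z /BC /CQ.
  apply: principal_sub => //; apply: CQ => _ [b [_ [Bb [z ->] ->]]].
  rewrite mulrDl; have [_ BD _] := iB; apply: BD; first exact: (idealMr _ iB Bb).
  by rewrite mulrAC -expr2; exact: (idealMr _ iB By2).
have BQ : B `<=` ideal_mul Q Q.
  rewrite BE; apply: ideal_mul_sub => [|a b Ja Cb]; first exact: ideal_mul_ideal.
  by apply: ideal_mul_mem; [apply: JQ|apply: CQ].
have Q2 : Q 2%:R by apply: CQ; exact: BC.
have QQ4 : ideal_mul Q Q (2%:R * 2%:R) by apply: ideal_mul_mem.
have four : (2%:R * 2%:R : 'O_L) <> 0.
  by have [dom _ _] := ded_L; move=> /dom [].
exists (ideal_quo (ideal_mul Q Q) B); first exact: ideal_quo_ideal.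
exact: (ded_contains_divides ded_L (ideal_mul_ideal _ _) iB QQ4 four BQ).
Qed.

(** By finiteness two iterates of Frobenius agree at x, and Frobenius is injective on the reduced
    ring O_L / PO_L, so the earlier iterate can be cancelled. *)
Lemma unram_frob x : exists2 r, (0 < r)%N & B (x ^+ (2 ^ r) - x).
Proof.
have [k idk] := ded_idx ded_L iB B2 twoL.
have [i [j [ij Bij]]] := idx_pigeon (fun i => x ^+ (2 ^ i)) idk.
exists (j - i)%N; first by rewrite subn_gt0.
have frob : forall l (a b : 'O_L), B ((a - b) ^+ (2 ^ l) - (a ^+ (2 ^ l) - b ^+ (2 ^ l))).
  elim=> [|l IH] a b; first by rewrite expn0 !expr1 subrr; have [] := iB.
  rewrite expnSr !exprM.
  have := IH a b; set u := (a - b) ^+ _; set v := a ^+ _; set w := b ^+ _ => IHu.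
  have [_ BD BM] := iB.
  rewrite -[_ - _](_ : (u + (v - w)) * (u - (v - w)) + (w * (w - v)) * 2%:R = _); last by ring.
  by apply: BD; [exact: BM _ _ IHu|exact: BM _ _ B2].
have red : forall l z, B (z ^+ (2 ^ l)) -> B z.
  elim=> [|l IH] z; first by rewrite expn0 expr1.
  by rewrite expnSr exprM => /unram_reduced /IH.
apply: (red i).
rewrite -[_ ^+ _](subrK (x ^+ (2 ^ (j - i)) ^+ (2 ^ i) - x ^+ (2 ^ i))).
have [_ BD _] := iB; apply: BD; first exact: frob.
by rewrite -exprM -expnD subnK // ltnW.
Qed.

Local Notation A := 'O_algC.
Let h i : 'O_L -> A := omap (sig i).
Let hK : 'O_K -> A := omap s.
Definition lift_ideal : set A := ideal_gen [set hK a | a in P].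
Local Notation PA := lift_ideal.

Let iPA : is_ideal PA. Proof. exact: ideal_gen_ideal. Qed.

Lemma lift_ideal_mem a : P a -> PA (hK a).
Proof. by move=> Pa; apply: ideal_gen_mem; exists a. Qed.

Let PA2 : PA 2%:R.
Proof. by have := lift_ideal_mem P2; rewrite /hK rmorph_nat. Qed.

(** There is b in O_K, not a multiple of 2, with bP inside 2O_K. If 1 were in the lifted ideal, b /
    2 would be an algebraic integer of K. *)
Lemma lift_ideal_proper : ~ PA 1.
Proof.
have [iP P1 _] := primeP.
have [b nb bP] := ded_annihilator ded_K iP P1 P2 twoK.
have sub : PA `<=` [set x | exists z, hK b * x = 2%:R * z].
  apply: ideal_gen_sub.
    split; first by exists 0; rewrite !mulr0.
      by move=> x y [u eu] [v ev]; exists (u + v); rewrite !mulrDr eu ev.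
    by move=> a x [u eu]; exists (a * u); rewrite mulrCA eu mulrCA.
  move=> _ [a Pa <-]; have [z ez] := bP a Pa; exists (hK z).
  by rewrite /hK -rmorphM ez rmorphM rmorph_nat.
move=> /sub [z]; rewrite mulr1 => ez; apply: nb.
have two0 : (2%:R : K) != 0 by rewrite -(fmorph_eq0 s) rmorph_nat pnatr_eq0.
have iv : val b / 2%:R \in int_closure K.
  rewrite -(int_closure_rmorphE s) rmorphM fmorphV rmorph_nat.
  have := congr1 val ez; rewrite rmorphM rmorph_nat /= => ->.
  rewrite mulrC mulKf ?int_ring_valP // pnatr_eq0 //.
exists (IntRing iv); apply: val_inj; rewrite rmorphM rmorph_nat /=.
by rewrite mulrC mulfVK.
Qed.

Let h_emb i a : h i (emb a) = hK a.
Proof.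
by apply: val_inj; have [sa _ _] := sigP; rewrite /= -(sa i).
Qed.

(* The ideal generated by P and the sigma_i x - sigma_j x is the unit ideal:
   x -> sigma_i x - sigma_j x behaves like a derivation, which kills PO_L and
   2-power Frobenius powers. *)
Lemma unram_separates i j : i <> j -> exists r : seq (A * 'O_L),
  PA (1 - \sum_(p <- r) p.1 * h i p.2) /\ \sum_(p <- r) p.1 * h j p.2 = 0.
Proof.
move=> ij; have [N [b bZ]] := ext_Zbasis L.
pose v l := h i (b l) - h j (b l).
pose C : set A := [set x | exists (a : 'I_N -> A) p, PA p /\ x = \sum_l a l * v l + p].
have [P0 PD PM] := iPA.
have iC : is_ideal C.
  split; first by exists (fun _ => 0), 0; split=> //; rewrite big1 ?addr0 // => l _; rewrite mul0r.
    move=> _ _ [a [p [Pp ->]]] [a' [p' [Pp' ->]]].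
    exists (fun l => a l + a' l), (p + p'); split; first exact: PD.
    by rewrite addrACA -big_split; congr (_ + _); apply: eq_bigr => l _; rewrite mulrDl.
  move=> c _ [a [p [Pp ->]]]; exists (fun l => c * a l), (c * p); split; first exact: PM.
  by rewrite mulrDr mulr_sumr; congr (_ + _); apply: eq_bigr => l _; rewrite mulrA.
have [C0 CD CM] := iC.
have PC : PA `<=` C.
  by move=> p Pp; exists (fun _ => 0), p; split=> //; rewrite big1 ?add0r // => l _; rewrite mul0r.
have Cv l : C (v l).
  exists (fun k => (k == l)%:R), 0; split=> //; rewrite addr0 (bigD1 l) //= eqxx mul1r.
  by rewrite big1 ?addr0 // => k /negPf ->; rewrite mul0r.
have diff x : exists c : 'I_N -> int, h i x - h j x = \sum_l (c l)%:~R * v l.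
  have [c ->] := bZ x; exists c; rewrite /h !rmorph_sum -sumrB; apply: eq_bigr => l _.
  by rewrite !rmorphM !rmorph_int -mulrBr.
(* The twisted Leibniz rule for h i - h j involves h j x, so the membership of h j x in PA is proved
   along with the claim. *)
have Bdiff x : B x -> exists c : 'I_N -> A, (forall l, PA (c l)) /\
    h i x - h j x = \sum_l c l * v l.
  move: x; suff : B `<=` [set x | PA (h j x) /\ exists c : 'I_N -> A, (forall l, PA (c l)) /\
      h i x - h j x = \sum_l c l * v l] by move=> sub x /sub [].
  apply: ideal_gen_sub.
    split.
    - rewrite /= /h !rmorph0 subrr; split=> //; exists (fun _ => 0); split=> //.
      by rewrite big1 // => l _; rewrite mul0r.
    - move=> x y [Px [c [Pc ec]]] [Py [c' [Pc' ec']]]; split.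
        by rewrite /h rmorphD; apply: PD.
      exists (fun l => c l + c' l); split; first by move=> l; apply: PD.
      rewrite /h !rmorphD opprD addrACA ec ec' -big_split; apply: eq_bigr => l _.
      by rewrite mulrDl.
    - move=> a x [Px [c [Pc ec]]]; split; first by rewrite /h rmorphM; apply: PM.
      have [k ek] := diff a.
      exists (fun l => h i a * c l + (k l)%:~R * h j x); split.
        by move=> l; apply: PD; apply: PM.
      rewrite /h !rmorphM -/(h i a) -/(h i x) -/(h j a) -/(h j x).
      transitivity (h i a * (h i x - h j x) + (h i a - h j a) * h j x); first by ring.
      rewrite ec ek mulr_sumr mulr_suml -big_split; apply: eq_bigr => l _ /=; ring.
  move=> x [a Pa ab]; rewrite /= (_ : x = emb a); last by apply: val_inj; rewrite ab; reflexivity.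
  rewrite !h_emb subrr; split; first exact: lift_ideal_mem.
  by exists (fun _ => 0); split=> //; rewrite big1 // => l _; rewrite mul0r.
(* By Frobenius v_l is X^(2^r) - Y^(2^r) up to a difference of an element of B. The former is a
   multiple of v_l (X + Y), with X + Y = v_l + 2Y in C; so v = Mv with all entries of M in C. *)
have /choice [M MP] : forall l, exists M : 'I_N -> A, (forall k, C (M k)) /\
    v l = \sum_k M k * v k.
  move=> l; have [r r0 /Bdiff [c [Pc ec]]] := unram_frob (b l).
  set X := h i (b l); set Y := h j (b l).
  have [T TE] : exists T, X ^+ (2 ^ r) - Y ^+ (2 ^ r) = v l * (X + Y) * T.
    case: r r0 {ec} => // r _; elim: r => [|r [T TE]].
      by exists 1; rewrite expn1 subr_sqr mulr1.
    exists (T * (X ^+ (2 ^ r.+1) + Y ^+ (2 ^ r.+1))).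
    by rewrite expnSr !exprM subr_sqr TE mulrA.
  exists (fun k => (k == l)%:R * ((X + Y) * T) - c k); split.
    move=> k; apply: idealB => //; last exact: PC.
    apply: CM; apply: idealMr => //.
    have -> : X + Y = v l + 2%:R * Y by rewrite /v -/X -/Y; ring.
    by apply: CD => //; apply: PC; exact: (idealMr _ iPA PA2).
  under eq_bigr => k _ do rewrite mulrBl.
  rewrite sumrB -ec (bigD1 l) //= eqxx big1 ?addr0; last first.
    by move=> k /negPf ->; rewrite !mul0r.
  rewrite /h !rmorphB !rmorphXn /= -/X -/Y mul1r.
  rewrite [(X + Y) * T * v l](_ : _ = X ^+ (2 ^ r) - Y ^+ (2 ^ r)); last by rewrite TE; ring.
  by rewrite /v -/X -/Y; ring.
pose MM : 'M[A]_N := \matrix_(l, k) M l k.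
(* Determinant trick: det(1 - M) kills every v_l, and some v_l is nonzero in a domain, so this
   determinant is 0; but it is 1 modulo C. *)
have detv l : \det (1%:M - MM) * v l = 0.
  have : (1%:M - MM) *m (\col_k v k) = 0.
    apply/colP => k; rewrite mulmxBl mul1mx !mxE; have [_ ->] := MP k.
    rewrite -sumrB big1 // => l' _; rewrite !mxE; have [_ e] := MP k.
    by rewrite subrr.
  move=> /(congr1 (mulmx (\adj (1%:M - MM)))).
  by rewrite mulmxA mul_adj_mx mulmx0 mul_scalar_mx => /colP /(_ l); rewrite !mxE.
have [l vl] : exists l, v l <> 0.
  apply: contrapT => no; apply: ij; apply: (emb_inj sigP) => x.
  have v0 l : v l = 0 by apply: contrapT => e; apply: no; exists l.
  have [c c0 ix] := ext_multiple x.
  have [k] := diff (IntRing ix); rewrite big1 => [/(congr1 val)|l _]; last by rewrite v0 mulr0.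
  rewrite rmorphB /= !rmorphM !rmorph_int -mulrBr => /eqP.
  by rewrite mulf_eq0 intr_eq0 (negPf c0) /= subr_eq0 => /eqP.
have det0 : \det (1%:M - MM) = 0.
  apply: val_inj; have /eqP := congr1 val (detv l); rewrite rmorphM /= mulf_eq0.
  case/orP => /eqP // e; case: vl; exact: val_inj.
have C1 : C 1.
  have := det_one_mod (M := MM) iC; rewrite det0 subr0; apply.
  by move=> a c; rewrite mxE; have [] := MP a.
have [a [p [Pp E]]] := C1.
(* The tensor sum of the a_l (b_l - h j (b_l)): it vanishes under sigma_j, and sigma_i sends it to
   the sum of the a_l v_l, that is to 1 - p. *)
exists ([seq (a l, b l) | l <- index_enum 'I_N] ++ [seq (- (a l * h j (b l)), 1) | l <- index_enum 'I_N]).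
rewrite !big_cat /= !big_map /= -!big_split /=; split.
  rewrite {1}E; rewrite -[_ - _](_ : p = _) //.
  rewrite [X in _ + _ - X](_ : _ = \sum_l a l * v l); first by rewrite addrAC subrr add0r.
  by apply: eq_bigr => l' _; rewrite /v /h rmorph1; ring.
by apply: big1 => l' _; rewrite /h rmorph1; ring.
Qed.

(** A sequence of pairs stands for an element of the tensor product of A and O_L. The product over j
    of the elements of [unram_separates] behaves like the idempotent of the i-th embedding modulo
    [PA]. *)
Lemma unram_idempotent i : exists r : seq (A * 'O_L),
  PA (1 - \sum_(p <- r) p.1 * h i p.2) /\
  forall j, j <> i -> \sum_(p <- r) p.1 * h j p.2 = 0.
Proof.
suff H : forall l : seq 'I_n, i \notin l -> exists r : seq (A * 'O_L),
    PA (1 - \sum_(p <- r) p.1 * h i p.2) /\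
    forall j, j \in l -> \sum_(p <- r) p.1 * h j p.2 = 0.
  have [|r [h1 h2]] := H [seq j <- enum 'I_n | j != i].
    by rewrite mem_filter eqxx.
  by exists r; split=> // j /eqP ji; apply: h2; rewrite mem_filter ji mem_enum.
elim=> [_|j l IH].
  exists [:: (1, 1)]; split=> //; rewrite big_seq1 /= /h rmorph1 mulr1 subrr.
  by have [] := iPA.
rewrite inE negb_or => /andP [/eqP ij il]; have [r [h1 h2]] := IH il.
have [r' [h1' h2']] := unram_separates ij.
pose rr := [seq (p.1 * q.1, p.2 * q.2) | p <- r, q <- r'].
have rrE k : \sum_(p <- rr) p.1 * h k p.2 =
    (\sum_(p <- r) p.1 * h k p.2) * (\sum_(p <- r') p.1 * h k p.2).
  rewrite big_allpairs_dep mulr_suml; apply: eq_bigr => p _.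
  rewrite mulr_sumr; apply: eq_bigr => q _; rewrite /h rmorphM /=; ring.
exists rr; split=> [|k].
  rewrite rrE; set x := \sum_(p <- r) _ in h1 *; set y := \sum_(p <- r') _ in h1' *.
  rewrite -[_ - _](_ : (1 - x) + x * (1 - y) = _); last by ring.
  by have [_ PD PM] := iPA; apply: PD => //; apply: PM.
by rewrite rrE inE => /orP [/eqP ->|/h2 ->]; rewrite ?h2' ?mulr0 ?mul0r.
Qed.

(** Otherwise every det(sigma_i g_k) has its square in PA. As 2 is in PA, such elements form an
    ideal I; by multilinearity I contains the determinant built from the idempotents, which is 1
    modulo PA. *)
Lemma unram_disc : exists (g : n.-tuple L) (d : 'O_K),
  [/\ {subset g <= int_closure L}, val d = basis_disc g & ~ P d].
Proof.
apply: contrapT => no.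
have [P0 PD PM] := iPA.
pose I : set A := [set x | PA (x ^+ 2)].
have iI : is_ideal I.
  split=> [|x y Ix Iy|a x Ix]; rewrite /I /=.
  - by rewrite expr0n.
  - rewrite -[_ ^+ 2](_ : x ^+ 2 + y ^+ 2 + (x * y) * 2%:R = _); last by ring.
    exact: PD _ _ (PD _ _ Ix Iy) (PM _ _ PA2).
  - by rewrite exprMn; apply: PM.
have /choice [r rP] := unram_idempotent.
pose y k i := \sum_(p <- r k) p.1 * h i p.2.
have IE : I (\det (\matrix_(k, i) y k i)).
  apply: (@det_rows_ideal _ _ n h) => // [g|k]; last by exists (r k).
  pose gt := [tuple val (g k) | k < n].
  have ig : {subset gt <= int_closure L}.
    by move=> _ /mapP [k _ ->]; apply: int_ring_valP.
  pose d : 'O_K := IntRing (int_closure_trace_det s ig ig).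
  have Pd : P d by apply: contrapT => Pd; apply: no; exists gt, d; split.
  rewrite /I /=; suff -> : (\det (\matrix_(k, i) h i (g k))) ^+ 2 = hK d.
    exact: lift_ideal_mem.
  have valdet (M : 'M[A]_n) : val (\det M) = \det (map_mx val M) by rewrite det_map_mx.
  apply: val_inj; transitivity (val (\det (\matrix_(k, i) h i (g k))) ^+ 2).
    by rewrite rmorphXn.
  rewrite valdet.
  rewrite [RHS](emb_trace_det sigP) -expr2; congr (_ ^+ 2).
  rewrite -det_tr; congr (\det _); apply/matrixP => a b.
  by rewrite !mxE tnth_mktuple.
apply: lift_ideal_proper.
have D1 : PA (1 - \det (\matrix_(k, i) y k i)).
  rewrite -{1}(det1 A n); apply: det_mod => // k i; rewrite !mxE.
  have [h1 h2] := rP k; case: eqP => [<-//|ki].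
  by rewrite /y h2 ?subrr //; apply: nesym.
set D := \det _ in IE D1.
rewrite -[1](_ : (1 - D) * (1 + D) + D ^+ 2 = _); last by ring.
by apply: PD => //; exact: (idealMr _ iPA D1).
Qed.

End Unramified.

(** * Ryser's formula for the permanent *)

Section Ryser.
Variables (R : comNzRingType) (n : nat) (V : 'I_n -> 'I_n -> R).
Hypothesis two_reg : forall x : R, x + x = 0 -> x = 0.

Lemma toggle_sum0 (T : {set 'I_n}) (j : 'I_n) : j \notin T ->
  \sum_(S : {set 'I_n} | T \subset S) (-1) ^+ (n + #|S|) = 0 :> R.
Proof.
move=> jT; apply: two_reg.
rewrite (bigID (fun S : {set 'I_n} => j \in S)) /=.
pose tog (S : {set 'I_n}) : {set 'I_n} := if j \in S then (S :\ j)%SET else (j |: S)%SET.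
have togK S : tog (tog S) = S.
  rewrite /tog; case: (boolP (j \in S)) => jS.
    by rewrite finset.setD11 finset.setD1K.
  by rewrite finset.setU11 finset.setU1K.
have H : \sum_(S : {set 'I_n} | (T \subset S) && (j \in S)) (-1) ^+ (n + #|S|) =
   - \sum_(S : {set 'I_n} | (T \subset S) && (j \notin S)) (-1) ^+ (n + #|S|) :> R.
  rewrite (reindex_inj (can_inj togK)) -sumrN; apply: eq_big => S.
    rewrite /tog; case: (boolP (j \in S)) => jS; rewrite ?finset.setD11 ?finset.setU11 ?andbF ?andbT //=.
    by rewrite -[in RHS](finset.setU1K jS) finset.subsetD1 jT andbT.
  rewrite /tog; case: (boolP (j \in S)) => jS; first by rewrite finset.setD11 andbF.
  by move=> _; rewrite cardsU1 jS addnCA add1n exprS mulN1r.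
by rewrite H addNr addr0.
Qed.

(** For V i j = sigma_i(g_j) each product of row sums is a norm, so this formula places the
    permanent in K. *)
Lemma permanent_ryser : \sum_(s : 'S_n) \prod_i V i (s i) =
  \sum_(S : {set 'I_n}) (-1) ^+ (n + #|S|) * \prod_i \sum_(j in S) V i j.
Proof.
under [RHS]eq_bigr => S _ do rewrite bigA_distr_big mulr_sumr big_mkcond /=.
rewrite exchange_big /=.
transitivity (\sum_(f : {ffun 'I_n -> 'I_n} | injectiveb f) \prod_i V i (f i)).
  rewrite (reindex (fun s : 'S_n => pval s)) /=.
    by apply: eq_big => [s|s _]; [rewrite (valP s)|apply: eq_bigr => i _; rewrite pvalE].
  exists (insubd (1%g : 'S_n)) => f Hf; first by rewrite valKd.
  by rewrite insubdK.
rewrite big_mkcond; apply: eq_bigr => f _.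
transitivity ((\sum_(S : {set 'I_n} | [set f i | i in 'I_n]%SET \subset S)
    (-1) ^+ (n + #|S|)) * \prod_i V i (f i)); last first.
  rewrite mulr_suml -big_mkcond; apply: eq_bigl => S.
  apply/fintype.subsetP/ffun_onP => [H i|H _ /imsetP [i _ ->] //].
  by apply: H; apply: imset_f.
case: ifP => fI.
  have fi : injective f by apply/injectiveP; rewrite fI.
  have fT : [set f i | i in 'I_n]%SET = [set: 'I_n]%SET.
    by apply/eqP; rewrite eqEcard finset.subsetT cardsT (card_imset _ fi) leqnn.
  rewrite fT (big_pred1 [set: 'I_n]%SET) => [|S]; last by rewrite finset.subTset.
  by rewrite cardsT card_ord addnn -mul2n exprM sqrrN !expr1n mul1r.
have [j jf] : exists j, j \notin [set f i | i in 'I_n]%SET.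
  apply/existsP; apply: contraFT fI; rewrite negb_exists => /forallP H.
  have fT : [set f i | i in 'I_n]%SET = [set: 'I_n]%SET.
    by apply/setP => j; have := H j; rewrite negbK finset.in_setT.
  have /imset_injP fi : #|[set f i | i in 'I_n]%SET| == #|'I_n| by rewrite fT cardsT.
  by apply/injectiveP => a b; apply: fi.
by rewrite (toggle_sum0 jf) mul0r.
Qed.

End Ryser.

(** * Relative discriminants *)

Section Discriminant.
Variables (K : fieldExtType rat) (L : fieldExtType K).
Local Notation n := (\dim {:L}).
Variable s : {rmorphism K -> algC}.
Variable sig : 'I_n -> {rmorphism L -> algC}.
Hypothesis sigP : is_embeddings s sig.
Let ded_K : dedekind_like 'O_K := nf_dedekind K.
Let emb : 'O_K -> 'O_L := omap (in_alg L).

Lemma int_closure_trace x : x \in int_closure L -> ext_trace x \in int_closure K.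
Proof.
move=> ix; rewrite -(int_closure_rmorphE s) (emb_trace sigP).
by apply: rpred_sum => i _; rewrite int_closure_rmorphE.
Qed.

Definition trO (x : 'O_L) : 'O_K := IntRing (int_closure_trace (int_ring_valP x)).

Lemma trO_mod p x y : principal p (trO (x + emb p * y) - trO x).
Proof.
exists (trO y); apply: val_inj; apply: (fmorph_inj s).
rewrite /= !(rmorphB, rmorphM) /= !(emb_trace sigP) /= -sumrB mulr_sumr.
apply: eq_bigr => i _; rewrite rmorphD rmorphM /= addrAC subrr add0r.
by have [sa _ _] := sigP; rewrite (sa i).
Qed.

Lemma trO_scale p x : trO (emb p * x) = p * trO x.
Proof.
apply: val_inj; apply: (fmorph_inj s); rewrite /= rmorphM /= !(emb_trace sigP).
rewrite mulr_sumr; apply: eq_bigr => i _; rewrite rmorphM /=.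
by have [sa _ _] := sigP; rewrite (sa i).
Qed.

Definition trO_det (g e : 'I_n -> 'O_L) : 'O_K := \det (\matrix_(i, j) trO (g i * e j)).

Lemma val_detO (M : 'M['O_K]_n) : val (\det M) = \det (map_mx val M).
Proof. by rewrite det_map_mx. Qed.

Lemma val_trO_det (g e : 'I_n -> 'O_L) : val (trO_det g e) =
  trace_det [tuple val (g i) | i < n] [tuple val (e i) | i < n].
Proof.
rewrite val_detO; congr (\det _); apply/matrixP => i j.
by rewrite !mxE /= !tnth_mktuple.
Qed.

Lemma trO_det_sqr g e : trO_det g e ^+ 2 = trO_det e e * trO_det g g.
Proof.
apply: val_inj; rewrite rmorphXn rmorphM /= !val_trO_det; apply: (fmorph_inj s).
rewrite rmorphXn rmorphM /= !(emb_trace_det sigP); ring.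
Qed.

Lemma disc_mod p (u z : 'I_n -> 'O_L) :
  principal p (trO_det (fun i => u i + emb p * z i) (fun i => u i + emb p * z i) - trO_det u u).
Proof.
apply: det_mod; first exact: ideal_principal.
move=> i j; rewrite !mxE.
rewrite [_ * _](_ : _ = u i * u j + emb p * (u i * z j + z i * u j + emb p * z i * z j)).
  exact: trO_mod.
ring.
Qed.

Lemma disc_scale p (u : 'I_n -> 'O_L) :
  trO_det (fun i => emb p * u i) (fun i => emb p * u i) = p ^+ (2 * n) * trO_det u u.
Proof.
rewrite /trO_det exprM -detZ; congr (\det _); apply/matrixP => i j; rewrite !mxE.
rewrite [emb p * _ * _](_ : _ = emb p * (emb p * (u i * u j))); last by ring.
by rewrite !trO_scale mulrA.
Qed.

Hypothesis unram2 : unramified_at L 2.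
Let twoK : (2%:R : 'O_K) <> 0. Proof. exact: (intO_natr_neq0 s). Qed.

(** Patching modulo 2: a power f of d = disc(g) is idempotent modulo 2. If (2, f) is proper, it lies
    in a prime P, and [unram_disc] gives g' with discriminant outside P. The family f g + (1 - f) g'
    keeps the discriminant where f = 1 and has that of g' modulo P, so the ideal (2, f) of the new
    family is strictly larger, and the process ends at the unit ideal. *)
Lemma odd_disc_exists : exists (g : 'I_n -> 'O_L) b, principal 2%:R (1 - trO_det g g * b).
Proof.
pose I : set 'O_K := principal 2%:R.
have iI : is_ideal I by apply: ideal_principal.
have [I0 ID IM] := iI.
pose e2 x y := I (x - y).
have e2r x : e2 x x by rewrite /e2 subrr.
have e2s x y : e2 x y -> e2 y x by move=> h; rewrite /e2 -opprB; apply: idealN.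
have e2t y x z : e2 x y -> e2 y z -> e2 x z.
  by move=> h1 h2; have := ID _ _ h1 h2; rewrite addrA subrK.
have e2M a x y : e2 x y -> e2 (a * x) (a * y).
  by move=> h; have := IM a _ h; rewrite mulrBr.
have e2Mr a x y : e2 x y -> e2 (x * a) (y * a).
  by rewrite ![_ * a]mulrC; apply: e2M.
have [kI idI] : exists k, has_index setT I k.
  by have [_ fin _] := ded_K; apply: fin.
(* Modulo 2 the powers of d have period t from exponent i on; the exponent (i + 1) t is a positive
   multiple of t that is at least i. *)
have idem d : exists N, (0 < N)%N /\ e2 (d ^+ N * d ^+ N) (d ^+ N).
  have [i [j [ij Iij]]] := idx_pigeon (fun i => d ^+ i) idI.
  pose t := (j - i)%N; have t0 : (0 < t)%N by rewrite subn_gt0.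
  have step l k : e2 (d ^+ (i + k + l * t)) (d ^+ (i + k)).
    elim: l => [|l IH]; first by rewrite addn0.
    apply: (e2t _ _ _ _ IH); rewrite mulSn.
    have -> : (i + k + (t + l * t) = (k + l * t) + j)%N.
      by rewrite -(subnKC (ltnW ij)) -/t; lia.
    have -> : (i + k + l * t = (k + l * t) + i)%N by lia.
    by rewrite !exprD; apply: e2M.
  exists (i.+1 * t)%N; split; first by rewrite muln_gt0.
  have le : (i <= i.+1 * t)%N by rewrite (leq_trans (leqnSn i)) // leq_pmulr.
  have := step i.+1 (i.+1 * t - i)%N; rewrite subnKC // exprD; exact.
pose Bf (f : 'O_K) := ideal_add I (principal f).
have iBf f : is_ideal (Bf f) by apply: ideal_add_ideal => //; apply: ideal_principal.
have IBf f : forall x, I x -> Bf f x by apply: ideal_add_l; apply: ideal_principal.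
have Bff f : Bf f f by apply: ideal_add_r => //; apply: principal_mem.
have I2 : I 2%:R by apply: principal_mem.
suff H : forall l (g : 'I_n -> 'O_L) N k, (0 < N)%N ->
    e2 (trO_det g g ^+ N * trO_det g g ^+ N) (trO_det g g ^+ N) ->
    has_index setT (Bf (trO_det g g ^+ N)) k -> (k < l)%N ->
    exists (g : 'I_n -> 'O_L) b, I (1 - trO_det g g * b).
  have [N [N0 eN]] := idem (trO_det (fun _ => 0) (fun _ => 0)).
  have [k idk] := ded_idx ded_K (iBf (trO_det (fun _ => 0) (fun _ => 0) ^+ N)) (IBf _ _ I2) twoK.
  exact: H N0 eN idk (ltnSn k).
elim=> // l IH g N k N0 eN idk kl.
set d := trO_det g g in eN idk; set f := d ^+ N in eN idk.
have [B1|B1] := pselect (Bf f 1).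
  have [x [_ [Ix [y ->] e]]] := B1.
  exists g, (d ^+ N.-1 * y); rewrite -/d mulrA -exprS prednK // -/f.
  by rewrite {1}e addrK.
have [P maxP BP] := ded_maximal ded_K (iBf f) (IBf _ _ I2) twoK B1.
have primeP := maximal_prime maxP; have [iP P1 Pab] := primeP.
have P2 : P 2%:R by apply: BP; exact: (IBf f _ I2).
have Pf : P f by apply: BP.
have Ppow x k' : P (x ^+ k') -> P x.
  by elim: k' => [|k' IHk]; rewrite ?expr0 // exprS => /Pab [].
have [gt [d' [igt d'E Pd']]] := unram_disc sigP primeP P2 (unram2 primeP P2).
pose g' i : 'O_L := IntRing (igt _ (mem_tnth i gt)).
have gd' : trO_det g' g' = d'.
  apply: val_inj; rewrite val_trO_det d'E.
  rewrite (_ : [tuple val (g' i) | i < n] = gt) //.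
  by apply: eq_from_tnth => i; rewrite tnth_mktuple.
pose g2 i := emb f * g i + (1 - emb f) * g' i.
have [w fw] : exists w, f * f = f + 2%:R * w.
  by have [w e] := eN; exists w; rewrite -e addrC subrK.
pose d2 := trO_det g2 g2.
have nP : (0 < n)%N by apply: adim_gt0.
have fX k' : e2 (f ^+ k'.+1) f.
  elim: k' => [|k' IHk]; first by rewrite expr1.
  by rewrite exprS; apply: (e2t _ _ _ _ eN); exact: e2M.
(* Since f^2 = f modulo 2, f g2 and f g agree modulo 2; their discriminants carry the factor f^(2n),
   which is f modulo 2. *)
have fd : e2 (f * d2) (f * d).
  have E : e2 (f ^+ (2 * n) * d2) (f ^+ (2 * n) * d).
    rewrite -!disc_scale.
    have -> : (fun i => emb f * g2 i) = (fun i => emb f * g i + emb 2%:R * (emb w * (g i - g' i))).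
      apply: funext => i; rewrite /g2.
      have ew : emb f * emb f = emb f + emb 2%:R * emb w.
        by rewrite /emb -!rmorphM fw rmorphD.
      rewrite mulrDr !mulrA mulrBr mulr1 ew; ring.
    exact: disc_mod.
  have fn : e2 (f ^+ (2 * n)) f.
    by have := fX (2 * n).-1; rewrite prednK // muln_gt0.
  apply: (e2t _ _ _ (e2s _ _ (e2Mr d2 _ _ fn))).
  by apply: (e2t _ _ _ E); exact: e2Mr.
have fdk k' : e2 (f * d2 ^+ k') (f * d ^+ k').
  elim: k' => [|k' IHk]; first by rewrite !expr0.
  rewrite !exprS; apply: (e2t (f * d * d2 ^+ k')).
    by rewrite mulrA; apply: e2Mr.
  by rewrite -!mulrA [d * _]mulrC [d * _]mulrC !mulrA; apply: e2Mr.
have [N2 [N20 eN2]] := idem d2.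
have Bf2 : Bf f `<=` Bf (d2 ^+ N2).
  apply: ideal_add_sub => //; first exact: IBf.
  apply: principal_sub => //.
  have E : e2 f (f * d2 ^+ N2 * d ^+ (N.-1 * N2)).
    apply: (e2s); apply: (e2t _ _ _ (e2Mr _ _ _ (fdk N2))).
    rewrite -mulrA -exprD -{1}[N2]mul1n -mulnDl add1n prednK // exprM -/f -exprS.
    exact: fX.
  rewrite -[f](subrK (f * d2 ^+ N2 * d ^+ (N.-1 * N2))).
  have [_ BD _] := iBf (d2 ^+ N2); apply: BD; first exact: (IBf _ _ E).
  by rewrite mulrAC; apply: idealMl.
have Pd2 : ~ P (d2 ^+ N2).
  move=> /Ppow Pd2; apply: Pd'; rewrite -gd'.
  have : principal f (d2 - trO_det g' g').
    have := disc_mod f g' (fun i => g i - g' i).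
    rewrite (_ : (fun i => g' i + _) = g2) //.
    by apply: funext => i; rewrite /g2; ring.
  move=> /(principal_sub iP Pf) h; have := idealB iP Pd2 h.
  by rewrite subKr.
have [k2 idk2] := ded_idx ded_K (iBf (d2 ^+ N2)) (IBf _ _ I2) twoK.
apply: (IH g2 N2 k2) => //; move: kl; rewrite ltnS; apply: leq_trans.
apply: (idx_lt (iBf f) (iBf _) Bf2 (Bff _) _ idk idk2).
by move=> /BP.
Qed.

(** With [Pp] and [Pn] the even and odd halves of the Leibniz expansion, d = (Pp - Pn)^2 = (Pp +
    Pn)^2 - 4 Pp Pn. Ryser's formula puts x = Pp + Pn in K, and then y = -Pp Pn is in K as (d - x^2)
    / 4. *)
Lemma stickelberger (g : 'I_n -> 'O_L) : exists x y, trO_det g g = x ^+ 2 + 4%:R * y.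
Proof.
pose V i j := sig i (val (g j)).
have VA i j : V i j \in Aint.
  by rewrite -int_closure_Aint int_closure_rmorphE int_ring_valP.
pose xK : K := \sum_(S : {set 'I_n}) (-1) ^+ (n + #|S|) * ext_norm (\sum_(j in S) val (g j)).
have xi : xK \in int_closure K.
  apply: rpred_sum => S _; apply: rpredM; first by rewrite rpredX ?rpredN ?rpred1.
  by apply: (int_closure_norm s); apply: rpred_sum => j _; apply: int_ring_valP.
pose per := \sum_(p : 'S_n) \prod_i V i (p i).
have sx : s xK = per.
  rewrite /per permanent_ryser; last first.
    by move=> x /eqP; rewrite -mulr2n mulrn_eq0 => /eqP.
  rewrite rmorph_sum; apply: eq_bigr => S _; rewrite rmorphM rmorphXn rmorphN1; congr (_ * _).
  by rewrite (emb_norm sigP); apply: eq_bigr => i _; rewrite rmorph_sum.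
pose Pp := \sum_(p : 'S_n | ~~ odd_perm p) \prod_i V i (p i).
pose Pn := \sum_(p : 'S_n | odd_perm p) \prod_i V i (p i).
have perE : per = Pn + Pp by rewrite /per (bigID (fun p : 'S_n => odd_perm p)).
have detE : \det (\matrix_(i, j) V i j) = Pp - Pn.
  rewrite /determinant (bigID (fun p : 'S_n => odd_perm p)) /= addrC; congr (_ + _).
    apply: eq_bigr => p /negPf ->; rewrite mul1r.
    by apply: eq_bigr => i _; rewrite mxE.
  rewrite /Pn -sumrN; apply: eq_bigr => p ->; rewrite expr1 mulN1r; congr (- _).
  by apply: eq_bigr => i _; rewrite mxE.
have sd : s (val (trO_det g g)) = (Pp - Pn) ^+ 2.
  rewrite val_trO_det (emb_trace_det sigP) -expr2 -detE; congr (\det _ ^+ 2).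
  by apply/matrixP => i j; rewrite !mxE tnth_mktuple.
have four0 : (4%:R : algC) != 0 by rewrite pnatr_eq0.
have PA (Q : pred 'S_n) : \sum_(p | Q p) \prod_i V i (p i) \in Aint.
  by apply: rpred_sum => p _; apply: rpred_prod => i _.
pose yK := (val (trO_det g g) - xK ^+ 2) / 4%:R.
have sy : s yK = - (Pp * Pn).
  rewrite /yK rmorphM fmorphV rmorphB rmorphXn rmorph_nat sd sx perE.
  by apply: (mulIf four0); rewrite mulfVK //; ring.
have yi : yK \in int_closure K.
  by rewrite -(int_closure_rmorphE s) int_closure_Aint sy rpredN rpredM ?PA.
have four0K : (4%:R : K) != 0 by rewrite -(fmorph_eq0 s) rmorph_nat.
have e : xK ^+ 2 + 4%:R * yK = val (trO_det g g).
  by rewrite /yK mulrC mulfVK // subrKC.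
exists (IntRing xi), (IntRing yi); apply: val_inj.
by rewrite rmorphD rmorphXn rmorphM rmorph_nat.
Qed.

End Discriminant.

(** * Signs of discriminants *)

Section InvolutionSign.

(** Induction on the number of 2-cycles, one for each j < p j: composing with the transposition of
    such a j and p j removes exactly that cycle. *)
Lemma odd_involution n (p : 'S_n) : (forall j, p (p j) = j) ->
  odd_perm p = odd #|[set j : 'I_n | (j < p j)%N]%SET|.
Proof.
move: {2}#|_| (erefl #|[set j : 'I_n | (j < p j)%N]%SET|) => c.
elim: c p => [|c IH] p cp pp.
  have p1 : p = 1%g.
    apply/permP => j; rewrite perm1; apply/eqP.
    have no (k : 'I_n) : ~~ (k < p k)%N.
      apply/negP => lt; have := cards0_eq cp; move/setP/(_ k); rewrite !inE lt.
      by [].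
    have := no j; have := no (p j); rewrite pp -!leqNgt => h1 h2.
    by rewrite -val_eqE eqn_leq h2 h1.
  by rewrite cp p1 odd_perm1.
have [j0 j0p] : exists j0 : 'I_n, (j0 < p j0)%N.
  have : (0 < #|[set j : 'I_n | (j < p j)%N]%SET|)%N by rewrite cp.
  by move=> /card_gt0P [j0]; rewrite inE; exists j0.
have j0n : j0 != p j0 by rewrite -val_eqE neq_ltn j0p.
pose q := (p * tperm j0 (p j0))%g.
have qE j : q j = if (j == j0) || (j == p j0) then j else p j.
  rewrite permM; case: (eqVneq j j0) => [->|jj0]; first by rewrite tpermR.
  case: (eqVneq j (p j0)) => [->|jpj0]; first by rewrite pp tpermL.
  rewrite tpermD //=; last by rewrite (inj_eq perm_inj) eq_sym.
  by apply: contra jpj0 => /eqP ->; rewrite pp.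
have qq j : q (q j) = j.
  rewrite !qE; case: (boolP ((j == j0) || (j == p j0))) => [->//|].
  rewrite negb_or => /andP [h1 h2]; case: ifP => // /orP [/eqP e|]; first by rewrite -e pp eqxx in h2.
  by rewrite (inj_eq perm_inj) (negPf h1).
have cq : #|[set j : 'I_n | (j < q j)%N]%SET| = c.
  apply/eqP; rewrite -eqSS -cp [X in _ == X](cardsD1 j0) inE j0p add1n eqSS.
  apply/eqP/eq_card => j; rewrite !inE qE.
  case: (eqVneq j j0) => [->|jj0] /=; first by rewrite ltnn.
  by case: (eqVneq j (p j0)) => [->|//]; rewrite ltnn pp ltnNge ltnW.
have pE : p = (q * tperm j0 (p j0))%g by rewrite /q -mulgA tperm2 mulg1.
by rewrite cp {1}pE odd_permM odd_tperm j0n (IH q cq qq) cq addbT.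
Qed.

(** The factors at i and [rho i] cancel. For signatures this removes the contribution of the complex
    places of K. *)
Lemma prod_involution (R : comNzRingType) n (rho : 'I_n -> 'I_n) (f : 'I_n -> R) :
  (forall i, rho (rho i) = i) -> (forall i, f (rho i) = f i) -> (forall i, f i * f i = 1) ->
  \prod_(i | rho i != i) f i = 1.
Proof.
move=> rr fr ff; rewrite (bigID (fun i : 'I_n => (i < rho i)%N)) /=.
have rI : injective rho by apply: (can_inj rr).
rewrite [X in _ * X](reindex_inj rI) /=.
have -> : \prod_(i | (rho (rho i) != rho i) && ~~ (rho i < rho (rho i))%N) f (rho i) =
    \prod_(i | (rho i != i) && (i < rho i)%N) f i.
  apply: eq_big => [i|i _]; last exact: fr.
  rewrite rr [i == _]eq_sym -leqNgt; case: (eqVneq (rho i) i) => //= h.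
  by rewrite ltn_neqAle val_eqE eq_sym h.
by rewrite -big_split /=; apply: big1 => i _; apply: ff.
Qed.

End InvolutionSign.

Section Sign.
Variables (K : fieldExtType rat) (L : fieldExtType K).
Local Notation r := (\dim {:K}).
Local Notation n := (\dim {:L}).

(** Let W be the product of the determinants of all matrices of conjugates, so that k = W^2.
    Conjugation multiplies W by the product eps of the signatures, hence eps k = |W|^2 is
    nonnegative. *)
Lemma sign_disc (e : n.-tuple L) (k : int) : ext_norm (basis_disc e) = k%:~R ->
  (-1) ^+ num_complex_over_real L * k = `|k|%N%:Z.
Proof.
move=> Nk.
have [S SP] := embeddings_exist K (ratr : {rmorphism rat -> algC}).
have /choice [tau tauP] : forall i, exists sig, is_embeddings (E := L) (S i) sig.
  by move=> i; apply: embeddings_exist.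
have /choice [rho rhoP] : forall i, exists i', forall x, (S i x)^* = S i' x.
  move=> i; have [_ _ complete] := SP.
  have [|i' e'] := complete (Num.conj_op \o S i : {rmorphism K -> algC}).
    by move=> a; rewrite /= alg_num_field !fmorph_rat.
  by exists i' => x; rewrite -e'.
have tauS i j a : tau i j a%:A = S i a by have [h _ _] := tauP i.
have /choice [pi0 pi0P] : forall ij : 'I_r * 'I_n, exists j', forall x,
    (tau ij.1 ij.2 x)^* = tau (rho ij.1) j' x.
  case=> i j /=; have [_ _ complete] := tauP (rho i).
  have [|j' e'] := complete (Num.conj_op \o tau i j : {rmorphism L -> algC}).
    by move=> a; rewrite /= tauS rhoP.
  by exists j' => x; rewrite -e'.
pose pi i j := pi0 (i, j).
have piP i j x : (tau i j x)^* = tau (rho i) (pi i j) x by apply: (pi0P (i, j)).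
have rho_inv i : rho (rho i) = i.
  by apply: (emb_inj SP) => x; rewrite -!rhoP conjCK.
have tau_eq i j i' j' : (forall x, tau i j x = tau i' j' x) -> (i, j) = (i', j').
  move=> eq; have ii' : i = i'.
    by apply: (emb_inj SP) => a; rewrite -(tauS i j) -(tauS i' j') eq.
  subst i'; congr pair; exact: (emb_inj (tauP i)).
have pi_inv i j : pi (rho i) (pi i j) = j.
  have [] : (rho (rho i), pi (rho i) (pi i j)) = (i, j); last by [].
  by apply: tau_eq => x; rewrite -piP -piP conjCK.
have piI i : injective (pi i) by apply: (can_inj (pi_inv i)).
pose p i := perm (piI i).
pose V i := emb_mx (tau i) e.
have Vconj i : (\det (V i))^* = (-1) ^+ (p i) * \det (V (rho i)).
  rewrite -det_perm -det_mulmx -row_permE -[LHS](det_map_mx Num.conj_op); congr (\det _).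
  by apply/matrixP => a b; rewrite !mxE /p permE -piP.
pose W := \prod_i \det (V i).
have NW : (k%:~R : algC) = W ^+ 2.
  have := emb_norm SP (basis_disc e); rewrite Nk rmorph_int => ->.
  by rewrite /W -prodrXl; apply: eq_bigr => i _; rewrite (emb_disc (tauP i)).
pose eps : algC := \prod_i (-1) ^+ (p i).
have rhoI : injective rho by apply: (can_inj rho_inv).
have Wconj : W^* = eps * W.
  rewrite /W rmorph_prod /= /eps [X in _ = _ * X](reindex_inj rhoI) -big_split /=.
  by apply: eq_bigr => i _; rewrite Vconj.
(* One element for each complex place over a real one: the inequality selects one of the two
   conjugate embeddings and discards the self-conjugate ones. *)
pose X := [set x : 'I_r * 'I_n | (rho x.1 == x.1) && (x.2 < pi x.1 x.2)%N]%SET.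
have epsX : eps = (-1) ^+ #|X|.
  rewrite /eps (bigID (fun i => rho i == i)) /= [X in _ * X]prod_involution //.
  - rewrite mulr1.
    have -> : #|X| = (\sum_(i | rho i == i) #|[set j : 'I_n | (j < p i j)%N]%SET|)%N.
      rewrite -sum1_card (eq_bigl (fun x : 'I_r * 'I_n => (rho x.1 == x.1) && (x.2 < p x.1 x.2)%N)); last first.
        by move=> x; rewrite inE permE.
      rewrite -(pair_big_dep (fun i => rho i == i) (fun i (j : 'I_n) => (j < p i j)%N) (fun _ _ => 1%N)) /=.
      by apply: eq_bigr => i _; rewrite -sum1_card; apply: eq_bigl => j; rewrite inE.
    rewrite -prodrXr; apply: eq_bigr => i /eqP ri.
    rewrite odd_involution ?signr_odd // => j.
    by rewrite !permE -{1}ri pi_inv.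
  - move=> i; have -> : p (rho i) = (p i)^-1%g; last by rewrite odd_permV.
    apply/permP => j; apply: (@perm_inj _ (p i)); rewrite permKV !permE.
    by have := pi_inv (rho i) j; rewrite rho_inv.
  - by move=> i; rewrite -signr_addb addbb.
pose F (x : 'I_r * 'I_n) : set (L -> algC) := emb_place (tau x.1 x.2).
have realS i : rho i = i <-> (forall x, S i x \is Num.real).
  split=> [ri x|re]; first by rewrite CrealE rhoP ri.
  by apply: (emb_inj SP) => x; rewrite -rhoP; apply/eqP; rewrite -CrealE.
have Ccard : num_complex_over_real L = #|X|.
  have Finj : {in X &, injective F}.
    move=> [i j] [i' j']; rewrite !inE /= => /andP [/eqP ri lt] /andP [/eqP ri' lt'] /seteqP [FF _].
    have [h|h] := FF (tau i j) (or_introl erefl).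
      by apply: tau_eq => x; rewrite h.
    have [ii' jj'] : (i, j) = (rho i', pi i' j').
      by apply: tau_eq => x; rewrite h -piP.
    exfalso; rewrite ri' in ii'; subst i'; rewrite jj' in lt.
    have pj : pi i (pi i j') = j' by rewrite -{1}ri pi_inv.
    by rewrite pj in lt; have := ltn_trans lt lt'; rewrite ltnn.
  have CE : @complex_over_real_places K L = [set` [fset F x | x in X]%fset].
    apply/seteqP; split=> w.
      move=> [[t _ <-] nreal real].
      have [i tS] : exists i, forall a, t a%:A = S i a.
        have [_ _ complete] := SP.
        have [|i e'] := complete (t \o in_alg L : {rmorphism K -> algC}).
          by move=> a; rewrite alg_num_field fmorph_rat.
        by exists i => a; rewrite -e'.
      have [_ _ complete] := tauP i; have [j tj] := complete t tS.
      have ri : rho i = i.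
        apply/realS => a; rewrite -tS.
        by apply: (real (fun x => t x%:A)); exists t => //; left.
      have tE : (t : L -> algC) = tau i j by apply: funext.
      have plE : emb_place t = emb_place (tau i j) by rewrite /emb_place tE.
      have pij : pi i (pi i j) = j by rewrite -{1}ri pi_inv.
      have ne : pi i j != j.
        apply/eqP => pj; apply: nreal; rewrite plE => _ [] -> x.
          by rewrite CrealE piP ri pj.
        by rewrite CrealE conjCK piP ri pj.
      rewrite plE /= /mkset; apply/imfsetP.
      move: ne; rewrite -val_eqE neq_ltn => /orP [lt|lt].
        exists (i, pi i j) => /=; first by rewrite inE /= ri eqxx pij.
        have c1 : (fun x => (tau i j x)^*) = tau i (pi i j).
          by apply: funext => x; rewrite piP ri.
        have c2 : (fun x => (tau i (pi i j) x)^*) = tau i j.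
          by apply: funext => x; rewrite piP ri pij.
        by rewrite /F /emb_place /= c1 c2 classical_sets.setUC.
      by exists (i, j) => //=; rewrite inE /= ri eqxx.
    rewrite /= /mkset => /imfsetP [[i j]]; rewrite inE /= => /andP [/eqP ri lt] ->.
    split.
    - by exists (tau i j).
    - move=> re; have := re (tau i j) (or_introl erefl) => {}re.
      have /(congr1 snd) /= e' : (i, pi i j) = (i, j).
        by apply: tau_eq => x; rewrite -{1}ri -piP; apply/eqP; rewrite -CrealE.
      by rewrite e' ltnn in lt.
    - move=> _ [f [] -> <-] a /=.
        by rewrite tauS; exact: ((realS i).1 ri a).
      by rewrite tauS rhoP ri; exact: ((realS i).1 ri a).
  rewrite /num_complex_over_real CE set_fsetK card_in_imfset //=.
  by rewrite cardE.
have key : ((-1) ^+ #|X| * k%:~R : algC) = `|W| ^+ 2.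
  rewrite normCK Wconj NW -epsX; ring.
have ge0 : 0 <= (-1) ^+ #|X| * k.
  by rewrite -(ler0z algC) rmorphM rmorphXn rmorphN1 /= key exprn_ge0.
rewrite Ccard abszE -(ger0_norm ge0) normrM normrX normrN1 expr1n mul1r.
by [].
Qed.

End Sign.

(** * Norms and indices of K through the subfield k *)

Section SubfieldTower.
Variables (K : fieldExtType rat) (k : {subfield K}).
Local Notation F := (subvs_of k).
Local Notation E := (fieldOver k).
Let q : {rmorphism rat -> algC} := ratr.

Lemma over_algE (a : F) : (a%:A : E) = vsval a.
Proof. by rewrite fieldOver_scaleE mulr1. Qed.

(** [fieldOver k] is K with other scalars, so a ring morphism on one is literally a ring morphism on
    the other. *)
Definition over_morph (f : {rmorphism E -> algC}) : {rmorphism K -> algC} := f.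
Definition morph_over (f : {rmorphism K -> algC}) : {rmorphism E -> algC} := f.

(** v is the norm of x to k, and transitivity of norms holds because an embedding of K is an
    embedding of k followed by a choice of extension. The second clause is the form in which
    integrality and the shape 1 + 4b pass from x to v. *)
Lemma norm_subfield (x : K) : exists2 v : F, ext_norm x = ext_norm v &
  forall t : {rmorphism F -> algC}, exists (I : finType) (f : I -> {rmorphism K -> algC}),
    t v = \prod_i f i x.
Proof.
pose v : F := ext_norm (x : E).
exists v; last first.
  move=> t; have [sig sigP] := embeddings_exist E t.
  exists 'I_(\dim {:E}), (fun i => over_morph (sig i)).
  by rewrite (emb_norm sigP).
have [S SP] := embeddings_exist K q.
have [t tP] := embeddings_exist F q.
have /choice [sig sigP] : forall a, exists sig, is_embeddings (E := E) (t a) sig.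
  by move=> a; apply: embeddings_exist.
apply: (fmorph_inj q); rewrite (emb_norm SP) (emb_norm tP).
under [RHS]eq_bigr => a _ do rewrite (emb_norm (sigP a)).
rewrite (pair_bigA _ (fun a b => sig a b x)) /=.
have /choice [c cP] : forall ab, exists i, forall y : K, sig ab.1 ab.2 y = S i y.
  move=> ab; have [_ _ complete] := SP.
  have [|i e] := complete (over_morph (sig ab.1 ab.2)).
    by move=> a; rewrite alg_num_field fmorph_rat.
  by exists i.
have sigF a b (y : F) : sig a b (vsval y) = t a y.
  by have [h _ _] := sigP a; rewrite -(h b) over_algE.
have cI : injective c.
  move=> [a b] [a' b'] e.
  have e' y : sig a b y = sig a' b' y by rewrite (cP (a, b)) (cP (a', b')) e.
  have aa' : a = a' by apply: (emb_inj tP) => y; rewrite -(sigF _ b) -(sigF _ b') e'.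
  by subst a'; congr pair; apply: (emb_inj (sigP a)).
have cS i : exists ab, c ab = i.
  have [_ _ completeF] := tP.
  have [|a ea] := completeF (S i \o vsval : {rmorphism F -> algC}).
    by move=> r; rewrite alg_num_field fmorph_rat.
  have [_ _ completeE] := sigP a.
  have [|b eb] := completeE (morph_over (S i)).
    by move=> y; rewrite over_algE -ea.
  exists (a, b); apply: (emb_inj SP) => y; rewrite -cP /=; exact/esym/eb.
rewrite (reindex c); last first.
  have /choice [d dP] := cS; exists d => i _ //.
  by apply: cI; rewrite dP.
by apply: eq_bigr => ab _; rewrite cP.
Qed.

End SubfieldTower.

Section Final.
Variables (K : fieldExtType rat) (iotaK : {rmorphism K -> algC}) (k : {subfield K}) (m : nat).
Hypotheses (k_def : forall x : K, (x \in k) <-> Q_mu_2inf (iotaK x))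
  (k_deg : \dim k = (2 ^ m)%N).
Local Notation F := (subvs_of k).
Let jota : {rmorphism F -> algC} := iotaK \o vsval.

Lemma subvs_dim : \dim {:F} = (2 ^ m)%N.
Proof. by rewrite -k_deg dimvf. Qed.

Lemma subvs_mu (x : F) : Q_mu_2inf (jota x).
Proof. by apply/k_def/subvsP. Qed.

(** The norm of 1 + 4y to k is a product of conjugates 1 + 4 sigma(y), so it is again 1 + 4z with z
    integral, and [norm_one_mod4] applies to z in k. *)
Lemma norm_one_mod4_K (y : 'O_K) : exists l : int,
  ext_norm (val (1 + 4%:R * y)) = (1 + (2 ^ m.+2)%:R * l)%:~R.
Proof.
have [w pw] := C_prim_root_exists (expn_gt0 2 m.+2).
have [v -> vP] := norm_subfield k (val (1 + 4%:R * y)).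
have four0 : (4%:R : F) != 0 by rewrite -(fmorph_eq0 jota) rmorph_nat pnatr_eq0.
have four0C : (4%:R : algC) != 0 by rewrite pnatr_eq0.
pose z := (v - 1) / 4%:R.
have vE : v = 1 + 4%:R * z by rewrite /z mulrC mulfVK // subrKC.
have iz : z \in int_closure F.
  rewrite -(int_closure_rmorphE jota) int_closure_Aint.
  have [I [f fE]] := vP jota.
  have [b bA bE] : exists2 b, b \in Aint & \prod_i f i (val (1 + 4%:R * y)) = 1 + 4%:R * b.
    elim/big_ind: _ => [|_ _ [b bA ->] [c cA ->]|i _].
    - by exists 0; rewrite ?Aint0 // mulr0 addr0.
    - exists (b + c + 4%:R * b * c); last by ring.
      by apply: rpredD; [apply: rpredD|apply: rpredM => //; apply: rpredM => //; apply: rpred_nat].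
    - exists (f i (val y)); last by rewrite !(rmorphD, rmorph1, rmorphM, rmorph_nat).
      by rewrite -int_closure_Aint int_closure_rmorphE int_ring_valP.
  suff -> : jota z = b by [].
  by apply: (mulfI four0C); apply: (addrI 1); rewrite -bE -fE vE !(rmorphD, rmorph1, rmorphM, rmorph_nat).
rewrite vE; exact: (norm_one_mod4 subvs_dim subvs_mu pw iz).
Qed.

Lemma square_index_mod (A : set 'O_K) a : is_ideal A -> has_index setT A a ->
  (exists w, A (1 - 2%:R * w)) -> (2 ^ m.+2 %| (a * a).-1)%N.
Proof.
move=> iA idA half.
have [w pw] := C_prim_root_exists (expn_gt0 2 m.+2).
have [t [u [w1 [w2 [w12 w1N w2N ht hu]]]]] := quadratic_relation subvs_dim subvs_mu pw.
have wA z : z ^+ (2 ^ m.+1) = -1 -> z \in Aint.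
  move=> zN; apply: (@Aint_unity_root (2 ^ m.+2)); first by rewrite expn_gt0.
  by apply/unity_rootP; rewrite expnSr exprM zN sqrrN expr1n.
have it : vsval t \in int_closure K.
  rewrite -(int_closure_rmorphE iotaK) int_closure_Aint -[iotaK _]/(jota t) -ht.
  by rewrite rpredD ?wA.
have iu : vsval u \in int_closure K.
  rewrite -(int_closure_rmorphE iotaK) int_closure_Aint -[iotaK _]/(jota u).
  by rewrite -[jota u]opprK -hu rpredN rpredM ?wA.
apply: (@idx_square_mod _ A a (IntRing it) (IntRing iu) m.+1 iA idA half) => p.
pose T := quad_act (IntRing it) (IntRing iu).
(* Evaluation at a root z of X^2 - tX - u turns T into multiplication by z. The two roots w1 and w2
   are distinct, so their values determine the pair, and T^(2^(m+1)) = -1. *)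
pose ev (z : algC) (p : 'O_K * 'O_K) := iotaK (val p.1) + z * iotaK (val p.2).
have evT z z' : z + z' = jota t -> z * z' = - jota u -> forall p, ev z (T p) = z * ev z p.
  move=> ht' hu' [x y]; rewrite /ev /T /quad_act /= !(rmorphD, rmorphM) /=.
  rewrite -[iotaK (vsval t)]/(jota t) -[iotaK (vsval u)]/(jota u) -ht'.
  have -> : jota u = - (z * z') by rewrite hu' opprK.
  ring.
have evN z z' : z + z' = jota t -> z * z' = - jota u -> z ^+ (2 ^ m.+1) = -1 ->
    forall p, ev z (iter (2 ^ m.+1) T p) = ev z (- p.1, - p.2).
  move=> ht' hu' zN p'.
  have it' l : ev z (iter l T p') = z ^+ l * ev z p'.
    elim: l => [|l IH]; first by rewrite mul1r.
    by rewrite iterS (evT _ _ ht' hu') IH exprS mulrA.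
  rewrite it' zN /ev /= !rmorphN /=; ring.
have e1 := evN _ _ ht hu w1N p.
have e2 : ev w2 (iter (2 ^ m.+1) T p) = ev w2 (- p.1, - p.2).
  by apply: (evN w2 w1); rewrite // 1?addrC 1?[w2 * w1]mulrC.
rewrite -/T; move: e1 e2; case: (iter _ T p) => x y; rewrite /ev /= => e1 e2.
have w120 : w1 - w2 != 0 by rewrite subr_eq0; apply/eqP.
have yE : iotaK (val y) = iotaK (val (- p.2)).
  apply: (mulfI w120); rewrite !mulrBl.
  have := congr2 (fun a b => a - b) e1 e2.
  by rewrite !opprD !addrA ![_ + _ - iotaK _]addrAC !subrr !add0r.
have xE : iotaK (val x) = iotaK (val (- p.1)).
  by apply: (addIr (w1 * iotaK (val y))); rewrite e1 yE.
congr pair; apply: val_inj; apply: (fmorph_inj iotaK); [exact: xE|exact: yE].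
Qed.

End Final.

(** * The ideal A with A^2 = d D *)

Section RelativeDiscriminant.
Variables (K : fieldExtType rat) (L : fieldExtType K).
Local Notation n := (\dim {:L}).
Variable s : {rmorphism K -> algC}.
Variable sig : 'I_n -> {rmorphism L -> algC}.
Hypothesis sigP : is_embeddings s sig.
Let ded_K : dedekind_like 'O_K := nf_dedekind K.
Local Notation D := (rel_disc L).
Local Notation tdet := (trO_det sigP).

Lemma rel_disc_ideal : is_ideal D. Proof. exact: ideal_gen_ideal. Qed.

Lemma rel_disc_mem (u : 'I_n -> 'O_L) : tdet u u <> 0 -> D (tdet u u).
Proof.
move=> du; apply: ideal_gen_mem; exists [tuple val (u i) | i < n].
have vE := val_trO_det sigP u u; split=> //.
  apply/(disc_neq0 sigP); rewrite -[basis_disc _]/(trace_det _ _) -vE.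
  by apply/eqP => e; apply: du; apply: val_inj.
by move=> _ /mapP [i _ ->]; apply: int_ring_valP.
Qed.

Lemma rel_disc_gen (d : 'O_K) (e : n.-tuple L) : basis_of {:L} e ->
  {subset e <= int_closure L} -> val d = basis_disc e ->
  exists2 u, d = tdet u u & tdet u u <> 0.
Proof.
move=> be ie dE.
pose u i : 'O_L := IntRing (ie _ (mem_tnth i e)).
have uE : val (tdet u u) = basis_disc e.
  rewrite val_trO_det (_ : [tuple val (u i) | i < n] = e) //.
  by apply: eq_from_tnth => i; rewrite tnth_mktuple.
exists u; first by apply: val_inj; rewrite dE uE.
move=> /(congr1 val); rewrite uE => e0.
by have /(disc_neq0 sigP) := be; rewrite e0 eqxx.
Qed.

(* d D = A^2 for the ideal A generated by the det(Tr(u_i g_j)), whose squares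
   are d disc(u). *)
Lemma rel_disc_square (g : 'I_n -> 'O_L) (k : int) : tdet g g <> 0 ->
  ext_norm (val (tdet g g)) = k%:~R ->
  exists A a, [/\ is_ideal A, A (tdet g g), has_index setT A a &
    (a * a = `|k| * abs_norm D)%N].
Proof.
set d := tdet g g => d0 Nk.
(* Only families of nonzero discriminant, that is bases, are kept, to match the generators of
   [rel_disc]. *)
pose X := [set x | exists2 u, x = tdet u g & tdet u u <> 0].
pose A := ideal_gen X.
have iA : is_ideal A by apply: ideal_gen_ideal.
have Ad : A d by apply: ideal_gen_mem; exists g.
have Dd : D d by apply: rel_disc_mem.
have [a ida] := ded_idx ded_K iA Ad d0.
have idAA := ded_idx_mul ded_K iA iA Ad d0 Ad d0 ida.
have iAA := ideal_mul_ideal A A.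
have iD := rel_disc_ideal; have [D0 DD DM] := iD.
pose dD := [set z | exists2 x, D x & z = d * x].
have idD : is_ideal dD.
  split; first by exists 0; rewrite ?mulr0.
    move=> _ _ [x Dx ->] [y Dy ->]; exists (x + y); first exact: DD.
    by rewrite mulrDr.
  by move=> c _ [x Dx ->]; exists (c * x); [exact: DM|rewrite mulrCA].
have AAE : ideal_mul A A = dD.
  apply/seteqP; split.
    apply: ideal_mul_sub => // x y Ax; move: y.
    suff : A `<=` [set y | dD (x * y)] by [].
    have [dD0 dDD dDM] := idD.
    apply: ideal_gen_sub.
      split=> [|y z Hy Hz|c y Hy]; rewrite /= ?mulr0 //.
        by rewrite mulrDr; apply: dDD.
      by rewrite mulrCA; apply: dDM.
    move=> _ [u -> u0] /=; rewrite mulrC; move: x Ax.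
    suff : A `<=` [set x | dD (tdet u g * x)] by [].
    apply: ideal_gen_sub.
      split=> [|y z Hy Hz|c y Hy]; rewrite /= ?mulr0 //.
        by rewrite mulrDr; apply: dDD.
      by rewrite mulrCA; apply: dDM.
    move=> _ [v -> v0] /=.
    have [p [q ->]] := ded_mul_in_squares ded_K (tdet u g) (tdet v g).
    rewrite !trO_det_sqr -/d; exists (p * tdet u u + q * tdet v v); last by ring.
    by apply: (DD); apply: (DM); apply: rel_disc_mem.
  move=> _ [x Dx ->]; move: x Dx.
  suff : D `<=` [set x | ideal_mul A A (d * x)] by [].
  have [I0 ID IM] := iAA.
  apply: ideal_gen_sub.
    split=> [|y z Hy Hz|c y Hy]; rewrite /= ?mulr0 //.
      by rewrite mulrDr; apply: ID.
    by rewrite mulrCA; apply: IM.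
  move=> z [e [be ie ze]]; have [u -> u0] := rel_disc_gen be ie ze.
  rewrite /= -trO_det_sqr expr2.
  by apply: ideal_mul_mem; apply: ideal_gen_mem; exists u.
have [dom _ _] := ded_K.
have dDdd : dD (d * d) by exists d.
have dd0 : d * d <> 0 by move=> /dom [].
have dDpr : dD `<=` principal d by move=> _ [x _ ->]; exists x.
have [b idb] := ded_idx2 ded_K idD (ideal_principal d) dDdd dd0 dDpr.
have idDb : has_index setT D b.
  apply: (@idx_map _ _ (fun x => d * x) _ _ _ _ _ _ _ _ _ idb).
  - exact: ideal_subgroup.
  - by move=> x _; exists x.
  - move=> _ [z ->]; exists z => //; rewrite subrr.
    by exists 0; rewrite ?mulr0.
  - move=> x y _ _; rewrite -mulrBr; split; first by exists (x - y).
    by move=> [z Dz /(ded_mulI ded_K d0) ->].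
exists A, a; split=> //.
rewrite (idx_abs_norm (ideal_subgroup iD) idDb).
have id1 : has_index setT (ideal_mul A A) (a * a).
  by apply: idx_trans ida idAA => //; try exact: ideal_subgroup; apply: ideal_mul_subl.
apply: (idx_uniq id1); rewrite AAE.
by apply: idx_trans (nf_idx Nk d0) idb => //; apply: ideal_subgroup => //; apply: ideal_principal.
Qed.

End RelativeDiscriminant.

(** * Assembly of the congruences *)

Lemma ext_normM (F : fieldType) (E : fieldExtType F) (s : {rmorphism F -> algC}) (x y : E) :
  ext_norm (x * y) = ext_norm x * ext_norm y.
Proof.
have [sig sigP] := embeddings_exist E s; apply: (fmorph_inj s).
rewrite rmorphM !(emb_norm sigP) -big_split; apply: eq_bigr => i _.
by rewrite rmorphM.
Qed.

Lemma two_not_unit (K : fieldType) (f : {rmorphism K -> algC}) : ~ principal (2%:R : 'O_K) 1.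
Proof.
move=> [c /(congr1 (omap f))]; rewrite rmorph1 rmorphM rmorph_nat => /(congr1 val).
rewrite rmorphM rmorph_nat /= => e.
have two0 : (2%:R : algC) != 0 by rewrite pnatr_eq0.
have cE : f (val c) = 2%:R^-1 by apply: (mulfI two0); rewrite -e mulfV.
have /intrP [l lE] : f (val c) \in (Num.int : qualifier 1 algC).
  apply: Cint_rat_Aint; first by rewrite cE rpredV rpred_nat.
  by rewrite -int_closure_Aint int_closure_rmorphE int_ring_valP.
have /(intr_inj (R := algC)) : ((1 : int)%:~R : algC) = (2%:R * l)%:~R.
  rewrite intrM -lE; exact: e.
lia.
Qed.

Lemma int_sqr_pred (k : int) M : (0 < `|k|)%N -> (M %| (`|k| * `|k|).-1)%N ->
  exists l : int, k * k = 1 + M%:Z * l.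
Proof.
move=> k0 /dvdnP [q e]; exists q%:Z.
have -> : k * k = (`|k| * `|k|)%N%:Z by rewrite PoszM !abszE -normrM ger0_norm // -expr2 sqr_ge0.
have -> : (`|k| * `|k| = 1 + q * M)%N.
  by rewrite -e add1n prednK // muln_gt0 k0.
by rewrite PoszD PoszM mulrC.
Qed.

Local Close Scope classical_set_scope.

Theorem theorem2 (K : fieldExtType rat) (L : fieldExtType K)
    (iota : {rmorphism L -> algC}) (k : {subfield K}) (m : nat)
    (unram2 : unramified_at L 2)
    (k_def : forall x : K, (x \in k) <-> Q_mu_2inf (iota x%:A))
    (k_deg : \dim k = (2 ^ m)%N) :
  ((-1) ^+ num_complex_over_real L * (abs_norm (rel_disc L))%:Z
     = 1 %[mod (4 * 2 ^ m)%N%:Z])%Z.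
Proof.
pose iotaK : {rmorphism K -> algC} := iota \o in_alg L.
have k_defK x : (x \in k) <-> Q_mu_2inf (iotaK x) by apply: k_def.
have [sig sigP] := embeddings_exist L iotaK.
have [g [b gb]] := odd_disc_exists sigP unram2.
have [x [y]] := stickelberger sigP g; set d := trO_det sigP g g in gb * => dE.
have [z0 dz] := gb.
have d0 : d <> 0.
  by move=> e; apply: (two_not_unit iotaK); exists z0; rewrite -dz e mul0r subr0.
(* Modulo 2, x^2 = d and d b = 1, so x' is an inverse of x; c is the error term. *)
pose x' := x * b; pose c := z0 + 2%:R * y * b.
have xx' : x * x' = 1 - 2%:R * c.
  have -> : x * x' = d * b - 4%:R * y * b by rewrite /x' dE; ring.
  have -> : d * b = 1 - 2%:R * z0 by rewrite -dz subKr.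
  rewrite /c; ring.
have x'0 : x' <> 0.
  move=> e; apply: (two_not_unit iotaK); exists c.
  by move: xx'; rewrite e mulr0 => /esym /eqP; rewrite subr_eq0 => /eqP.
have dxE : d * x' ^+ 2 = 1 + 4%:R * (c ^+ 2 - c + y * x' ^+ 2).
  have -> : d * x' ^+ 2 = (x * x') ^+ 2 + 4%:R * (y * x' ^+ 2) by rewrite dE; ring.
  rewrite xx'; ring.
have [nd Nd] := nf_norm_int d; have [nx Nx] := nf_norm_int x'.
have [l] := norm_one_mod4_K k_defK k_deg (c ^+ 2 - c + y * x' ^+ 2).
have -> : val (1 + 4%:R * (c ^+ 2 - c + y * x' ^+ 2)) = val d * (val x' * val x').
  by rewrite -dxE expr2.
rewrite (ext_normM ratr (val d)) (ext_normM ratr (val x') (val x')) Nd Nx -!rmorphM => /intr_inj El.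
have idx' := nf_idx Nx x'0.
(* N(x')^2 = 1 mod 2^(m+2), so the factor x'^2 does not disturb N d. *)
have [l2 El2] : exists l2, nx * nx = 1 + (2 ^ m.+2)%N%:Z * l2.
  apply: int_sqr_pred; first by apply: (@idx_gt0 _ [set: 'O_K]%classic _ _ I idx').
  apply: (square_index_mod k_defK k_deg (ideal_principal x') idx').
  by exists c; exists x; rewrite -xx' mulrC.
have [A [a [iA Ad ida aa]]] := rel_disc_square (sigP := sigP) d0 Nd.
have div : (2 ^ m.+2 %| (a * a).-1)%N.
  apply: (square_index_mod k_defK k_deg iA ida); exists z0.
  have -> : 1 - 2%:R * z0 = d * b by rewrite -dz subKr.
  exact: idealMr.
have a0 : (0 < a)%N by apply: (@idx_gt0 _ [set: 'O_K]%classic _ _ I ida).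
have [l3] := int_sqr_pred (k := a%:Z) a0 div.
rewrite -PoszM aa PoszM => El3.
have vE : val d = basis_disc [tuple val (g i) | i < \dim {:L}].
  exact: val_trO_det.
have := sign_disc (e := [tuple val (g i) | i < \dim {:L}]) (k := nd).
rewrite -vE => /(_ Nd) sgn.
set eps := _ ^+ _ in sgn *; set N := abs_norm _ in El3 *.
have ME : (4 * 2 ^ m)%N%:Z = (2 ^ m.+2)%N%:Z by rewrite !expnS mulnA.
apply/eqP; rewrite ME eqz_mod_dvd; apply/dvdzP.
set M := (2 ^ m.+2)%N%:Z in El El2 El3 *.
have El' : nd * (nx * nx) = 1 + M * l.
  by rewrite El /M natz.
(* Here |N d| N(D) = N(A)^2 = 1 modulo M; replacing |N d| by (-1)^c N d and using N d = 1 modulo M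
   leaves (-1)^c N(D) = 1. *)
rewrite -sgn in El3.
rewrite El2 in El'.
have ndE : nd = 1 + M * (l - nd * l2).
  by rewrite mulrBr addrA -El'; ring.
exists (l3 - eps * N%:Z * (l - nd * l2)).
have E : eps * N%:Z * (1 + M * (l - nd * l2)) = 1 + M * l3.
  by rewrite -ndE -El3; ring.
have -> : eps * N%:Z - 1 = (1 + M * l3) - eps * N%:Z * (M * (l - nd * l2)) - 1.
  by rewrite -E; ring.
ring.
Qed.
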